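(* Fix $T>0$ and $\Lambda>0$. There is a numerical constant $C$ such that, for every $r\ge2$ and $n\ge1$, $$\sup_{P\in\mathfrak M_\Lambda}\Bigl\|\,\|Q^n(X)-[X]^P\|_\infty\Bigr\|_{L^r(P)}\le Cr\Lambda T2^{-n/2}.$$ In particular, there are numerical constants $c,C>0$ such that, for all $n\ge1$, $$\sup_{P\in\mathfrak M_\Lambda}P\bigl(\|Q^n(X)-[X]^P\|_\infty>u\bigr)\le C\exp\Bigl(-c\,\frac{2^{n/2}u}{\Lambda T}\Bigr),\qquad u\ge0.$$ Consequently, $P(\mathcal G_{\mathrm{dyad}})=1$ for every $P\in\mathfrak M_\Lambda$. Moreover, for each $P\in\mathfrak M_\Lambda$, the intrinsic limit $Q(X)$ is a version of the $P$-quadratic variation: $$Q(X)=[X]^P\qquad P\text{-almost surely},$$ where $[X]^P$ denotes any $P$-quadratic-variation version.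
   Context: $\Omega=C_0([0,T];\mathbb R)$ is the space of continuous paths with $x_0=0$, with the uniform norm $\|\cdot\|_\infty$; $X$ is the coordinate process. For $n\ge1$ let $t_k^n=kT2^{-n}$ and, for $t\in[t_j^n,t_{j+1}^n]$, $$Q^n_t(x)=\sum_{k=0}^{j-1}(x_{t^n_{k+1}}-x_{t^n_k})^2+(x_t-x_{t^n_j})^2 .$$ $\mathcal C_{\mathrm{dyad}}$ is the set of $x\in\Omega$ for which $(Q^n(x))_{n\ge1}$ is Cauchy in the uniform norm, $\widehat Q(x)$ is its uniform limit, $\mathcal G_{\mathrm{dyad}}=\{x\in\mathcal C_{\mathrm{dyad}}:\widehat Q(x)\text{ is increasing (nondecreasing) and }\widehat Q_0(x)=0\}$, and $Q=\widehat Q|_{\mathcal G_{\mathrm{dyad}}}$. $\mathfrak M_\Lambda$ is the family of all Borel probability measures $P$ on $\Omega$ such that, in the usual augmentation of its natural filtration, $X$ is a continuous local martingale and there is a predictable process $a^P$ with $[X]^P_t=\int_0^ta^P_s\,ds$ for $t\in[0,T]$, $P$-a.s., and $0\le a^P_s\le\Lambda$, $P\otimes ds$-a.e. ''Numerical constant'' means an absolute constant, independent of all parameters. *)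

(* Defs.v *)
From HB Require Import structures.
From mathcomp Require Import all_boot all_order all_algebra.
From mathcomp Require Import all_classical all_reals all_analysis.

Set Implicit Arguments.
Unset Strict Implicit.
Unset Printing Implicit Defensive.

Import Order.TTheory GRing.Theory Num.Theory.
Import numFieldNormedType.Exports.

Local Open Scope classical_set_scope.
Local Open Scope ring_scope.

Section path_space.
Context {R : realType}.
Implicit Types (T : R) (f : R -> R).

(* Uniform norm over [0, T], in \bar R so that it is +oo (and not a default
   value) on functions that are unbounded on [0, T]. *)
Definition unorm T f : \bar R :=
  ereal_sup [set `|f t|%:E | t in `[0, T]].

(* A path on [0, T] is represented by its extension to R that is constant on
   each side of [0, T]: this makes the representation unique. *)
Definition C0_paths T : set (R -> R) :=
  [set x | [/\ {within `[0, T], continuous x},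
               x 0 = 0 &
               forall t, x t = x (Num.max 0 (Num.min t T))]].

Definition C0_path T : Type := set_type (C0_paths T).

HB.instance Definition _ T := Choice.on (C0_path T).

Lemma C0_paths0 T : (cst 0 : R -> R) \in C0_paths T.
Proof. by rewrite inE; split => //; exact: cst_continuous. Qed.

HB.instance Definition _ T :=
  isPointed.Build (C0_path T) (exist _ (cst 0) (C0_paths0 T)).

Definition unorm_open T : set (set (C0_path T)) :=
  [set U | forall x : C0_path T, U x -> exists2 e : R, 0 < e &
    forall y : C0_path T, (unorm T (\val y \- \val x)%R < e%:E)%E -> U y].

(* [Omega T] carries the Borel sigma-algebra of the uniform norm. *)
Definition Omega T := g_sigma_algebraType (@unorm_open T).

HB.instance Definition _ T := Measurable.on (Omega T).

Definition coord_proc T : R -> Omega T -> R :=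
  fun t x => \val (x : C0_path T) t.

End path_space.

(* Times range over R, but only the times of [0, T] matter. *)
Section processes.
Context d {W : measurableType d} {R : realType} (P : probability W R) (T : R).
Implicit Types (F : R -> set (set W)) (M A : R -> W -> R) (Y Z : W -> R).

(* The completion of P: its sigma-algebra of Caratheodory-measurable sets is
   the P-completion of that of W, since P is finite. It is needed because
   random variables of an augmented filtration are only measurable for it. *)
Definition completion :
    {measure set (caratheodory_type (P^*)%mu) -> \bar R} :=
  @completed_measure_extension _ _ _ P.

Definition natural_filtration M (t : R) : set (set W) :=
  <<s [set M s @^-1` B | s in [set s | 0 <= s <= T /\ s <= t]
                       & B in [set B : set R | measurable B]] >>.

(* [natural_filtration] is constant on [T, +oo[, so that at t = T the right
   limit below only adds the negligible sets. *)
Definition usual_augmentation F (t : R) : set (set W) :=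
  \bigcap_(s in [set s | t < s]) <<s F s `|` P.-negligible >>.

Definition measurable_wrt (G : set (set W)) Y :=
  forall B : set R, measurable B -> G (Y @^-1` B).

Definition adapted F M := forall t, 0 <= t <= T -> measurable_wrt (F t) (M t).

Definition integrable_rv Y := completion.-integrable setT (EFin \o Y).

Definition is_cond_exp (G : set (set W)) Y Z :=
  [/\ measurable_wrt G Z, integrable_rv Z &
      forall B, G B ->
        (\int[completion]_(x in B) (Z x)%:E
         = \int[completion]_(x in B) (Y x)%:E)%E].

Definition martingale F M :=
  [/\ adapted F M,
      forall t, 0 <= t <= T -> integrable_rv (M t) &
      forall s t, 0 <= s -> s <= t -> t <= T ->
        is_cond_exp (F s) (M t) (M s)].

Definition stopping_time F (tau : W -> R) :=
  (forall x, 0 <= tau x <= T) /\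
  (forall t, 0 <= t <= T -> F t [set x | tau x <= t]).

Definition stopped M (tau : W -> R) : R -> W -> R :=
  fun t x => M (Num.min t (tau x)) x.

(* On the closed interval [0, T], a localizing sequence reaches T after
   finitely many steps. *)
Definition localizing F (tau : nat -> W -> R) :=
  [/\ forall n, stopping_time F (tau n),
      {ae P, forall x, forall m n, (m <= n)%N -> tau m x <= tau n x} &
      {ae P, forall x, exists n, tau n x = T}].

Definition continuous_paths M :=
  {ae P, forall x, {within `[0, T], continuous (M^~ x)}}.

Definition continuous_local_martingale F M :=
  [/\ adapted F M, continuous_paths M &
      exists2 tau, localizing F tau &
        forall n, martingale F (fun t x => stopped M (tau n) t x - M 0 x)].

(* The bracket of M, as the increasing process that compensates M^2; any version
   of it qualifies, since F is meant to contain the negligible sets. *)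
Definition quadratic_variation F M A :=
  [/\ adapted F A, continuous_paths A,
      {ae P, forall x, A 0 x = 0 /\
        {in `[0, T] &, {homo A^~ x : s t / s <= t}}} &
      continuous_local_martingale F
        (fun t x => (M t x) ^+ 2 - (M 0 x) ^+ 2 - A t x)].

(* Generators of the predictable sigma-algebra of the space W x [0, T]. *)
Definition predictable_rect F : set (set (W * R)) :=
  [set B `*` [set 0] | B in F 0] `|`
  [set C | exists s t B,
     [/\ 0 <= s, s < t, t <= T, F s B & C = B `*` `]s, t] ]].

Definition predictable F (a : R -> W -> R) :=
  forall B : set R, measurable B ->
    <<s setT `*` `[0, T], predictable_rect F >>
      [set z | 0 <= z.2 <= T /\ B (a z.2 z.1)].

End processes.

Section dyadic.
Context {R : realType}.
Implicit Types (T L : R) (n j : nat).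

Definition canonical_filtration T (P : probability (Omega T) R) :
    R -> set (set (Omega T)) :=
  usual_augmentation P (natural_filtration T (@coord_proc R T)).

Definition is_QV T (P : probability (Omega T) R) (A : R -> Omega T -> R) :=
  quadratic_variation P T (canonical_filtration P) (@coord_proc R T) A.

Definition MLambda T L : set (probability (Omega T) R) :=
  [set P | continuous_local_martingale P T
             (canonical_filtration P) (@coord_proc R T) /\
    exists A a : R -> Omega T -> R,
    [/\ is_QV P A,
        predictable T (canonical_filtration P) a,
        {ae P, forall x, forall t, 0 <= t <= T ->
          ((A t x)%:E
           = \int[lebesgue_measure]_(s in `[0%R, t]) (a s x)%:E)%E} &
        {ae (P \x lebesgue_measure)%E, forall z,
          0 <= z.2 <= T -> 0 <= a z.2 z.1 <= L}]].

Definition dyad T n k : R := k%:R * T / 2 ^+ n.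

Definition dyad_qv_piece T n j (x : Omega T) (t : R) : R :=
  \sum_(k < j) (coord_proc (dyad T n k.+1) x - coord_proc (dyad T n k) x) ^+ 2
  + (coord_proc t x - coord_proc (dyad T n j) x) ^+ 2.

(* For t in [t_j, t_j+1], j can be read off as the integer part of 2^n t / T:
   see dyad_qvE. *)
Definition dyad_qv T n (x : Omega T) (t : R) : R :=
  dyad_qv_piece n (Num.truncn (t * 2 ^+ n / T)) x t.

Lemma dyad_qvE T n j (x : Omega T) (t : R) : 0 < T ->
  dyad T n j <= t <= dyad T n j.+1 -> dyad_qv n x t = dyad_qv_piece n j x t.
Proof.
move=> T0 /andP[jt tj].
have e0 : 0 < 2 ^+ n :> R by rewrite exprn_gt0.
rewrite /dyad_qv; have [tE|tN] := eqVneq t (dyad T n j.+1).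
  have -> : Num.truncn (t * 2 ^+ n / T) = j.+1.
    by rewrite tE /dyad mulfVK ?gt_eqF// mulfK ?gt_eqF// natrK.
  by rewrite /dyad_qv_piece tE big_ord_recr/= subrr expr0n/= addr0.
suff -> : Num.truncn (t * 2 ^+ n / T) = j by [].
apply: truncn_def; rewrite ler_pdivlMr// ltr_pdivrMr//.
rewrite -ler_pdivrMr// -ltr_pdivlMr// jt lt_neqAle.
by rewrite tN tj.
Qed.

Definition dyad_cauchy T : set (Omega T) :=
  [set x | forall e : R, 0 < e -> exists N, forall m n,
    (N <= m)%N -> (N <= n)%N ->
    (unorm T (dyad_qv m x \- dyad_qv n x)%R < e%:E)%E].

(* Only the values on [0, T] are meaningful, there the limit is unique. *)
Definition dyad_lim T (x : Omega T) : R -> R :=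
  xget (cst 0) [set q : R -> R |
    (fun n => unorm T (dyad_qv n x \- q)) @ \oo --> 0%E].

Definition dyad_good T : set (Omega T) :=
  [set x | [/\ @dyad_cauchy T x,
               {in `[0, T] &, {homo dyad_lim x : s t / s <= t}} &
               dyad_lim x 0 = 0]].

Definition dyad_err T n (A : R -> Omega T -> R) (x : Omega T) : \bar R :=
  unorm T (fun t => dyad_qv n x t - A t x).

End dyadic.

(* Main.v *)
Require Import Defs.
From HB Require Import structures.
From mathcomp Require Import all_boot all_order all_algebra.
From mathcomp Require Import all_classical all_reals all_analysis.
From mathcomp Require Import measurable_realfun ring lra zify.

Import Order.TTheory GRing.Theory Num.Theory.
Import numFieldNormedType.Exports.

Local Open Scope classical_set_scope.
Local Open Scope ring_scope.

Set Implicit Arguments.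
Unset Strict Implicit.
Unset Printing Implicit Defensive.

(** The theorem rests on one estimate: for a continuous local martingale [X]
    with [X 0 = 0] and a bracket [A] satisfying [A t - A s <= L * (t - s)], the
    error [Q^n - A] has exponential tails of rate of order
    [2 ^ (n / 2) / (L * T)], uniformly in time. The bounds on norms, the almost
    sure convergence and the identification of the limit follow from it.

    No stochastic integral is used. Everything is derived from two properties
    of the increments of [X] over [[s, t]]: they are centered given the past,
    and so is the compensated square [(X t - X s) ^+ 2 - (A t - A s)]; hence
    their conditional second moments are at most [L * (t - s)].

    _Sub-Gaussian increments_ ([subgaussian]). If [|u| <= 1 / 2] then
    [expR u <= 1 + u + 2 * u ^+ 2], and the right-hand side, positive
    everywhere, has a conditional expectation at [theta * (X t - X s)] of at most
    [expR (2 * theta ^+ 2 * L * (t - s))] by the second moment bound alone.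
    Conditioning successively over the points of a fine grid and letting the
    mesh tend to [0] (the increments are then small, by continuity of the paths)
    gives the sub-Gaussian bound by Fatou's lemma.

    _Localization_. The two properties hold first for stopped processes, by
    optional stopping ([stopped_martingale]). The second moment bound survives
    the removal of the localization by Fatou's lemma. The sub-Gaussian bound for
    the stopped processes then bounds their fourth moments uniformly, so the
    centering of the compensated squares passes to the limit as well
    ([bracket_controlled]). Besides, a martingale of integrable variation
    vanishes ([variation_martingale_eq0]), so any two versions of the bracket
    agree almost surely ([bracket_unique]), and it suffices to treat the version
    that is the integral of a density with values in [[0, L]], which is Lipschitz
    in time ([bracket_lipschitz]).

    _Exponential moments of the error_. Put [h := L * T / 2 ^+ n]. By mixing
    sub-Gaussian bounds, [expR (z ^+ 2 / (32 * h))] has bounded conditional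
    expectation for an increment [z] over one dyadic block, so the compensated
    square [D] of the block is sub-exponential at scale [h]; being centered, it
    satisfies [E (expR (nu * D)) <= 1 + c * (nu * h) ^+ 2] for
    [|nu| * h <= 1 / 64] ([block_exponential]). At [T] the error is the sum of
    [2 ^ n] such terms. When [|nu|] is [2 ^ (n / 2) / (64 * L * T)], each factor
    is [1 + O (1 / 2 ^ n)] and the product is bounded
    ([comp_qvT_exponential]). The error is also a martingale in time: a
    first-passage argument along the dyadic grids of all levels extends the
    bound to the supremum over time ([exceed_exponential], [dyad_exceed_le]).

    _Conclusion_. An exponential tail of rate [rho] bounds the norm of exponent
    [r] by a multiple of [r / rho] ([tail_Lnorm]). The tails are summable in
    [n], so the error tends to [0] almost surely ([dyad_err_ae_cvg]). Whenever it
    does, the path is good and the limit is the bracket, because a uniform limit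
    of the [Q^n] is automatically nondecreasing ([dyad_goodE]). Random variables
    adapted to the augmented filtration are measurable for the completed
    probability only, so the estimates are carried out under [cprob P]. *)

(** * Integrals of real functions and sub-sigma-algebras *)

Section integral_toolbox.
Context d (W : measurableType d) (R : realType) (mu : probability W R).
Implicit Types (B : set W) (f g h : W -> R).

Lemma ae_int_le B f g : measurable B ->
  measurable_fun setT f -> measurable_fun setT g ->
  (forall x, 0 <= f x) -> (forall x, 0 <= g x) ->
  {ae mu, forall x, f x <= g x} ->
  (\int[mu]_(x in B) (f x)%:E <= \int[mu]_(x in B) (g x)%:E)%E.
Proof.
move=> mB mf mg f0 g0 fg; apply: ae_ge0_le_integral => //.
- by move=> x _; rewrite lee_fin.
- by apply/measurable_EFinP; exact: measurable_funTS.
- by move=> x _; rewrite lee_fin.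
- by apply/measurable_EFinP; exact: measurable_funTS.
- by apply: filterS fg => x ? _; rewrite lee_fin.
Qed.

Lemma limn_einf_ge (u : (\bar R)^nat) (l : \bar R) :
  (\forall n \near \oo, (l <= u n)%E) -> (l <= limn_einf u)%E.
Proof.
case=> N _ uN; rewrite limn_einf_lim.
apply: lime_ge; first exact: is_cvg_einfs.
exists N => // n /= Nn; apply: le_ereal_inf_tmp => _ [p /= pn <-].
by apply: uN => /=; exact: leq_trans pn.
Qed.

Lemma limn_einf_le_cst (u : (\bar R)^nat) (l : \bar R) :
  (forall n, (u n <= l)%E) -> (limn_einf u <= l)%E.
Proof.
move=> ul; rewrite limn_einf_lim; apply: lime_le; first exact: is_cvg_einfs.
apply: nearW => n; apply: ge_ereal_inf; exists (u n) => //.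
by exists n => /=.
Qed.

(** Fatou's lemma, asking only that [f] be asymptotically below [f_ n]: this
    covers both convergence and domination for all large [n]. *)
Lemma fatou_bound B (f_ : nat -> W -> R) f (c : \bar R) : measurable B ->
  (forall n, measurable_fun setT (f_ n)) -> measurable_fun setT f ->
  (forall n x, 0 <= f_ n x) -> (forall x, 0 <= f x) ->
  {ae mu, forall x, forall e : R, 0 < e ->
     \forall n \near \oo, f x <= f_ n x + e} ->
  (forall n, (\int[mu]_(x in B) (f_ n x)%:E <= c)%E) ->
  (\int[mu]_(x in B) (f x)%:E <= c)%E.
Proof.
move=> mB mf_ mf f_0 f0 fle fc.
have mE n : measurable_fun B (EFin \o f_ n).
  by apply/measurable_EFinP; exact: measurable_funTS.
have E0 n x : B x -> (0 <= (f_ n x)%:E)%E by move=> _; rewrite lee_fin.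
apply: (@le_trans _ _ (\int[mu]_(x in B) limn_einf (fun n => (f_ n x)%:E))%E).
  apply: ae_ge0_le_integral => //.
  - by move=> x _; rewrite lee_fin.
  - by apply/measurable_EFinP; exact: measurable_funTS.
  - by move=> x _; apply: limn_einf_ge; apply: nearW => n; rewrite lee_fin.
  - rewrite (_ : (fun _ => _) = (fun x => - limn_esup (fun n => - (f_ n x)%:E))%E)//.
    apply: measurableT_comp => //.
    apply: (measurable_fun_limn_esup (f := fun n x => (- (f_ n x)%:E)%E)) => n.
    by apply: measurableT_comp => //; exact: mE.
  - apply: filterS fle => x fle _.
    apply/lee_addgt0Pr => e e0.
    rewrite -leeBlDr// -EFinB; apply: limn_einf_ge.
    by apply: filterS (fle e e0) => n; rewrite lee_fin lerBlDr.
apply: (le_trans (fatou mu mB mE E0)).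
exact: limn_einf_le_cst.
Qed.

End integral_toolbox.

Section sub_sigma_algebra.
Context d (W : measurableType d) (R : realType) (mu : probability W R).
Implicit Types (B C : set W) (f g h : W -> R) (G : set (set W)).

Lemma measurable_wrtP G f : sigma_algebra setT G ->
  measurable_wrt G f <->
  measurable_fun setT (f : g_sigma_algebraType G -> R).
Proof.
move=> sG; split => [fG _ B mB|mf B mB].
  by rewrite setTI; apply: sub_sigma_algebra; exact: fG.
by have := mf measurableT _ mB; rewrite setTI /measurable/= sigma_algebra_id.
Qed.

Lemma sub_sigma_measurable G B : sigma_algebra setT G ->
  G B <-> measurable (B : set (g_sigma_algebraType G)).
Proof. by move=> sG; rewrite /measurable/= sigma_algebra_id. Qed.

Lemma sub_sigmaI G B C : sigma_algebra setT G -> G B -> G C -> G (B `&` C).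
Proof.
move=> sG /(sub_sigma_measurable _ sG) mB /(sub_sigma_measurable _ sG) mC.
exact/(sub_sigma_measurable _ sG)/measurableI.
Qed.

Lemma sub_sigmaU G B C : sigma_algebra setT G -> G B -> G C -> G (B `|` C).
Proof.
move=> sG /(sub_sigma_measurable _ sG) mB /(sub_sigma_measurable _ sG) mC.
exact/(sub_sigma_measurable _ sG)/measurableU.
Qed.

Lemma sub_sigmaC G B : sigma_algebra setT G -> G B -> G (~` B).
Proof.
move=> sG /(sub_sigma_measurable _ sG) mB.
exact/(sub_sigma_measurable _ sG)/measurableC.
Qed.

Lemma sub_sigmaT G : sigma_algebra setT G -> G setT.
Proof. by move=> sG; exact/(sub_sigma_measurable _ sG)/measurableT. Qed.

Lemma measurable_wrt_fun G f : G `<=` measurable ->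
  measurable_wrt G f -> measurable_fun setT f.
Proof. by move=> Gm fG _ B mB; rewrite setTI; apply: Gm; exact: fG. Qed.

Lemma integral_indic_mul B C f : 
  (\int[mu]_(x in B) (\1_C x * f x)%:E = \int[mu]_(x in B `&` C) (f x)%:E)%E.
Proof.
rewrite integral_mkcondr; apply: eq_integral => x _.
by rewrite patchE indicE; case: ifPn => _; rewrite ?mul1r ?mul0r.
Qed.

(** The multiples of [1 / m.+1] below [z], at most [m.+1 ^ 2] of them, counted
    through the sets [[c <= z]]: an integral against it is a combination of
    integrals over such sets. *)
Definition staircase (m : nat) (z : R) : R :=
  m.+1%:R^-1 * \sum_(k < m.+1 ^ 2) ((k.+1%:R * m.+1%:R^-1 <= z)%R%:R : R).

Lemma staircaseE m z : 0 <= z ->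
  staircase m z = m.+1%:R^-1 * (minn (m.+1 ^ 2) (Num.truncn (z * m.+1%:R)))%:R.
Proof.
move=> z0; rewrite /staircase; congr (_ * _).
rewrite -natr_sum; congr (_%:R).
under eq_bigr => k _.
  rewrite (_ : (_ <= z) = (k < Num.truncn (z * m.+1%:R))%N); last first.
    by rewrite ler_pdivrMr ?ltr0n// truncn_gt_nat.
  over.
elim: (m.+1 ^ 2)%N => [|K IH]; first by rewrite big_ord0 min0n.
by rewrite big_ord_recr/= IH; case: ltnP; lia.
Qed.

Lemma staircase_le m z : 0 <= z -> 0 <= staircase m z <= z.
Proof.
move=> z0; rewrite staircaseE// mulr_ge0//= mulrC ler_pdivrMr ?ltr0n//.
rewrite (@le_trans _ _ (Num.truncn (z * m.+1%:R))%:R)//.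
  by rewrite ler_nat geq_minr.
by rewrite truncn_le mulr_ge0.
Qed.

Lemma staircase_ge m z : 0 <= z -> z <= m.+1%:R ->
  z <= staircase m z + m.+1%:R^-1.
Proof.
move=> z0 zm; rewrite staircaseE//.
have m0 : 0 < m.+1%:R :> R by rewrite ltr0n.
rewrite -[X in _ + X]mulr1 -mulrDr mulrC ler_pdivlMr//.
have [h|h] := leqP (m.+1 ^ 2) (Num.truncn (z * m.+1%:R)).
  rewrite natrX expr2 (le_trans (ler_wpM2r _ zm))//.
  by rewrite lerDl.
by rewrite natr1; exact/ltW/truncnS_gt.
Qed.

(** It is enough to test a domination of conditional expectations on indicator
    functions: a nonnegative [G]-measurable weight is a limit of staircases,
    which are combinations of indicator functions of sets of [G]. *)
Lemma int_weight_le G B Z f g : sigma_algebra setT G -> G `<=` measurable ->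
  G B -> measurable_wrt G Z -> (forall x, 0 <= Z x) ->
  measurable_fun setT f -> (forall x, 0 <= f x) ->
  measurable_fun setT g -> (forall x, 0 <= g x) ->
  (forall C, G C -> \int[mu]_(x in C) (f x)%:E <= \int[mu]_(x in C) (g x)%:E)%E ->
  (\int[mu]_(x in B) (Z x * f x)%:E <= \int[mu]_(x in B) (Z x * g x)%:E)%E.
Proof.
move=> sG Gm GB GZ Z0 mf f0 mg g0 fg.
have mZ := measurable_wrt_fun Gm GZ.
pose C (m k : nat) := Z @^-1` [set z | k.+1%:R * m.+1%:R^-1 <= z].
have GC m k : G (C m k).
  by apply: GZ; rewrite -set_itvcy; exact: measurable_itv.
have stE m x : staircase m (Z x) =
    m.+1%:R^-1 * \sum_(k < m.+1 ^ 2) \1_(C m k) x.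
  by congr (_ * _); apply: eq_bigr => k _; rewrite indicE/= /C/= mem_setE.
have mst m : measurable_fun setT (fun x => staircase m (Z x)).
  under eq_fun do rewrite stE.
  apply: measurable_funM => //; apply: measurable_sum => k.
  by apply: measurable_indic; exact: Gm.
have int_st m h : measurable_fun setT h -> (forall x, 0 <= h x) ->
    (\int[mu]_(x in B) (staircase m (Z x) * h x)%:E =
     (m.+1%:R^-1)%:E * \sum_(k < m.+1 ^ 2) \int[mu]_(x in B `&` C m k) (h x)%:E)%E.
  move=> mh h0.
  under eq_integral => x _.
    rewrite stE -mulrA EFinM mulr_suml -sumEFin; over.
  rewrite ge0_integralZl//.
  - rewrite ge0_integral_sum//.
    + by under eq_bigr do rewrite integral_indic_mul.
    + exact: Gm.
    + move=> k; apply/measurable_EFinP; apply: measurable_funTS.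
      by apply: measurable_funM => //; apply: measurable_indic; exact: Gm.
    + by move=> k x _; rewrite lee_fin mulr_ge0.
  - exact: Gm.
  - apply: emeasurable_sum => k; apply/measurable_EFinP; apply: measurable_funTS.
    by apply: measurable_funM => //; apply: measurable_indic; exact: Gm.
  - by move=> x _; apply: sume_ge0 => k _; rewrite lee_fin mulr_ge0.
apply: (@fatou_bound _ _ _ mu B (fun m x => staircase m (Z x) * f x)).
- exact: Gm.
- by move=> m; exact: measurable_funM.
- exact: measurable_funM.
- by move=> m x; rewrite mulr_ge0//; have /andP[] := staircase_le m (Z0 x).
- by move=> x; rewrite mulr_ge0.
- apply: aeW => x e e0; near=> m.
  have zm : Z x <= m.+1%:R.
    apply: (@le_trans _ _ m%:R); last by rewrite ler_nat.
    by near: m; exact: nbhs_infty_ger.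
  have fm : m.+1%:R^-1 * f x <= e.
    rewrite mulrC ler_pdivrMr ?ltr0n// mulrC -ler_pdivrMr//.
    apply: (@le_trans _ _ m%:R); last by rewrite ler_nat.
    by near: m; exact: nbhs_infty_ger.
  have := ler_wpM2r (f0 x) (staircase_ge (Z0 x) zm).
  by rewrite mulrDl => /le_trans; apply; rewrite lerD2l.
- move=> m; rewrite int_st//.
  apply: (@le_trans _ _ (\int[mu]_(x in B) (staircase m (Z x) * g x)%:E)%E).
    rewrite int_st// lee_wpmul2l ?lee_fin//; apply: lee_sum => k _.
    by apply: fg; exact: sub_sigmaI.
  apply: ae_int_le.
  - exact: Gm.
  - exact: measurable_funM.
  - exact: measurable_funM.
  - by move=> x; rewrite mulr_ge0//; have /andP[] := staircase_le m (Z0 x).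
  - by move=> x; rewrite mulr_ge0.
  - apply: aeW => x; apply: ler_wpM2r => //.
    by have /andP[] := staircase_le m (Z0 x).
Unshelve. all: by end_near. Qed.
End sub_sigma_algebra.

Section integral_toolbox2.
Context d (W : measurableType d) (R : realType) (mu : probability W R).
Implicit Types (B C : set W) (f g h : W -> R) (G : set (set W)).

Definition L1 f := mu.-integrable setT (EFin \o f).

Lemma L1_measurable f : L1 f -> measurable_fun setT f.
Proof. by move=> /measurable_int /measurable_EFinP. Qed.

Lemma L1_integrable B f : measurable B -> L1 f -> mu.-integrable B (EFin \o f).
Proof. by move=> mB; apply: integrableS. Qed.

Lemma L1_le f g : measurable_fun setT f -> L1 g ->
  {ae mu, forall x, `|f x| <= g x} -> L1 f.
Proof.
move=> mf ig fg; apply/integrableP; split; first exact/measurable_EFinP.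
have /integrableP[mg] := ig; apply: le_lt_trans.
apply: ae_ge0_le_integral => //.
- by apply: measurableT_comp => //; exact/measurable_EFinP.
- exact: measurableT_comp.
- apply: filterS fg => x fg _; rewrite /= lee_fin.
  by rewrite (le_trans fg)// ler_norm.
Qed.

Lemma L1_cst (k : R) : L1 (cst k).
Proof. exact: finite_measure_integrable_cst. Qed.

Lemma L1_bounded f k : measurable_fun setT f -> (forall x, `|f x| <= k) -> L1 f.
Proof. by move=> mf fk; apply: L1_le (L1_cst k) _ => //; exact: aeW. Qed.

Lemma L1D f g : L1 f -> L1 g -> L1 (f \+ g).
Proof. exact: integrableD. Qed.

Lemma L1B f g : L1 f -> L1 g -> L1 (f \- g).
Proof. exact: integrableB. Qed.

Lemma L1Z (k : R) f : L1 f -> L1 (fun x => k * f x).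
Proof. exact: integrableZl. Qed.

Lemma L1_ge0 f (c : R) : measurable_fun setT f -> (forall x, 0 <= f x) ->
  (\int[mu]_x (f x)%:E <= c%:E)%E -> L1 f.
Proof.
move=> mf f0 fc; apply/integrableP; split; first exact/measurable_EFinP.
apply: le_lt_trans (ltry c); apply: le_trans fc.
by under eq_integral do rewrite /= ger0_norm//.
Qed.

Lemma int_cst B (k : R) : measurable B ->
  (\int[mu]_(x in B) k%:E = k%:E * mu B)%E.
Proof. by move=> mB; exact: (integral_cst mu mB k%:E). Qed.

Lemma int_cstT (k : R) : (\int[mu]_x k%:E = k%:E)%E.
Proof. by rewrite int_cst// [X in (_ * X)%E](probability_setT mu) mule1. Qed.

Lemma L1_norm f : L1 f -> L1 (fun x => `|f x|).
Proof. exact: (integrable_norm (f := f)). Qed.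

Lemma intD B f g : measurable B -> L1 f -> L1 g ->
  (\int[mu]_(x in B) (f x + g x)%:E =
   \int[mu]_(x in B) (f x)%:E + \int[mu]_(x in B) (g x)%:E)%E.
Proof.
by move=> mB Lf Lg; rewrite -integralD_EFin//; exact: L1_integrable.
Qed.

Lemma intB B f g : measurable B -> L1 f -> L1 g ->
  (\int[mu]_(x in B) (f x - g x)%:E =
   \int[mu]_(x in B) (f x)%:E - \int[mu]_(x in B) (g x)%:E)%E.
Proof.
by move=> mB Lf Lg; rewrite -integralB_EFin//; exact: L1_integrable.
Qed.

Lemma intZ B f (k : R) : measurable B -> L1 f ->
  (\int[mu]_(x in B) (k * f x)%:E = k%:E * \int[mu]_(x in B) (f x)%:E)%E.
Proof.
move=> mB Lf; under eq_integral do rewrite EFinM.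
by rewrite integralZl//; exact: L1_integrable.
Qed.

Lemma L1_int_le B f g : measurable B -> L1 f -> L1 g ->
  {ae mu, forall x, f x <= g x} ->
  (\int[mu]_(x in B) (f x)%:E <= \int[mu]_(x in B) (g x)%:E)%E.
Proof.
move=> mB Lf Lg fg; have mgf := L1_measurable (L1B Lg Lf).
rewrite -sube_ge0; last first.
  by rewrite (integrable_fin_num _ (L1_integrable mB Lf)) ?orbT.
rewrite -intB// (_ : (\int[mu]_(x in B) _)%E =
  (\int[mu]_(x in B) (Num.max (g x - f x) 0)%:E)%E).
  by apply: integral_ge0 => x _; rewrite lee_fin le_max lexx orbT.
apply: ae_eq_integral => //.
- by apply/measurable_EFinP/measurable_funTS.
- by apply/measurable_EFinP/measurable_funTS; exact: measurable_maxr.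
- by apply: filterS fg => x fgx _; rewrite max_l// subr_ge0.
Qed.

Lemma int_posneg B f : measurable B -> L1 f ->
  (\int[mu]_(x in B) (f x)%:E = 0)%E <->
  (\int[mu]_(x in B) (Num.max (f x) 0)%:E =
   \int[mu]_(x in B) (Num.max (- f x) 0)%:E)%E.
Proof.
move=> mB Lf; have mf := L1_measurable Lf.
have Lp : L1 (fun x => Num.max (f x) 0).
  apply: (@L1_le _ (fun x => `|f x|)).
  - exact: measurable_maxr.
  - exact: L1_norm.
  - by apply: aeW => x; rewrite ger0_norm ?le_max ?lexx ?orbT// ge_max ler_norm/=.
have Ln : L1 (fun x => Num.max (- f x) 0).
  apply: (@L1_le _ (fun x => `|f x|)).
  - by apply: measurable_maxr => //; exact: measurableT_comp.
  - exact: L1_norm.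
  - apply: aeW => x; rewrite ger0_norm ?le_max ?lexx ?orbT//.
    by rewrite ge_max -normrN ler_norm/=.
have fE x : f x = Num.max (f x) 0 - Num.max (- f x) 0.
  by rewrite /Num.max; case: ifPn => h1; case: ifPn => h2; lra.
under eq_integral do rewrite fE.
rewrite intB//; split => [/eqP|->].
  rewrite sube_eq ?add0e ?fin_num_adde_defl//; first by move/eqP.
  - exact/integrable_fin_num/L1_integrable.
  - exact/integrable_fin_num/L1_integrable.
by rewrite subee//; exact/integrable_fin_num/L1_integrable.
Qed.

Lemma maxr0_mul (a b : R) : Num.max a 0 * Num.max b 0 +
  Num.max (- a) 0 * Num.max (- b) 0 = Num.max (a * b) 0.
Proof.
have [a0|a0] := leP 0 a; have [b0|b0] := leP 0 b.
- rewrite (max_r (_ : - a <= 0)) ?oppr_le0// mul0r addr0.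
  by rewrite max_l// mulr_ge0.
- rewrite (max_r (_ : - a <= 0)) ?oppr_le0// mul0r addr0 mulr0.
  by rewrite max_r// mulr_ge0_le0// ltW.
- rewrite (max_r (_ : - b <= 0)) ?oppr_le0// mulr0 addr0 mul0r.
  by rewrite max_r// mulr_le0_ge0// ltW.
- rewrite mul0r add0r !max_l ?oppr_ge0 ?ltW// ?mulrNN//.
  by rewrite nmulr_rgt0.
Qed.

(** The positive and negative parts of [f] have the same integral over each set
    of [G], so [int_weight_le] compares them both ways. *)
Lemma int_weight_eq0 G B Z f : sigma_algebra setT G -> G `<=` measurable ->
  G B -> measurable_wrt G Z -> L1 f -> L1 (fun x => Z x * f x) ->
  (forall C, G C -> \int[mu]_(x in C) (f x)%:E = 0)%E ->
  (\int[mu]_(x in B) (Z x * f x)%:E = 0)%E.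
Proof.
move=> sG Gm GB GZ Lf LZf f0.
have mf := L1_measurable Lf; have mZ := measurable_wrt_fun Gm GZ.
have mB := Gm _ GB.
have mp h : measurable_fun setT h -> measurable_fun setT (fun x => Num.max (h x) 0).
  by move=> mh; exact: measurable_maxr.
have mfn : measurable_fun setT (fun x => - f x) by exact: measurableT_comp.
have E C : G C -> (\int[mu]_(x in C) (Num.max (f x) 0)%:E =
   \int[mu]_(x in C) (Num.max (- f x) 0)%:E)%E.
  by move=> GC; apply/int_posneg/f0 => //; exact: Gm.
have m0 (z : R) : 0 <= Num.max z 0 by rewrite le_max lexx orbT.
have key Z' : measurable_wrt G Z' -> (forall x, 0 <= Z' x) ->
  (\int[mu]_(x in B) (Z' x * Num.max (f x) 0)%:E =
   \int[mu]_(x in B) (Z' x * Num.max (- f x) 0)%:E)%E.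
  move=> GZ' Z'0; apply/eqP; rewrite eq_le; apply/andP; split.
    by apply: (int_weight_le (G := G)) => //; [exact: mp|exact: mp|by move=> C /E->].
  by apply: (int_weight_le (G := G)) => //; [exact: mp|exact: mp|by move=> C /E->].
have GZp : measurable_wrt G (fun x => Num.max (Z x) 0).
  apply/measurable_wrtP => //; apply: measurable_maxr => //.
  exact/measurable_wrtP.
have GZn : measurable_wrt G (fun x => Num.max (- Z x) 0).
  apply/measurable_wrtP => //; apply: measurable_maxr => //.
  by apply: measurableT_comp => //; exact/measurable_wrtP.
have mZp := measurable_wrt_fun Gm GZp; have mZn := measurable_wrt_fun Gm GZn.
have mM g h : measurable_fun setT g -> measurable_fun setT h ->
    measurable_fun B (fun x => (g x * h x)%:E).
  move=> mg mh; apply/measurable_EFinP/measurable_funTS.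
  exact: measurable_funM.
apply/int_posneg => //.
transitivity (\int[mu]_(x in B) (Num.max (Z x) 0 * Num.max (f x) 0)%:E +
  \int[mu]_(x in B) (Num.max (- Z x) 0 * Num.max (- f x) 0)%:E)%E.
  rewrite -ge0_integralD//.
  - apply: eq_integral => x _; rewrite -EFinD; congr EFin.
    by rewrite maxr0_mul.
  - by move=> x _; rewrite lee_fin mulr_ge0.
  - by apply: mM => //; exact: mp.
  - by move=> x _; rewrite lee_fin mulr_ge0.
  - by apply: mM => //; exact: mp.
rewrite key// -(key (fun x => Num.max (- Z x) 0))// -ge0_integralD//.
- apply: eq_integral => x _; rewrite -EFinD; congr EFin.
  by rewrite -mulrN -maxr0_mul opprK.
- by move=> x _; rewrite lee_fin mulr_ge0.
- by apply: mM => //; exact: mp.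
- by move=> x _; rewrite lee_fin mulr_ge0.
- by apply: mM => //; exact: mp.
Qed.

(** Uniform integrability of a family is the uniform smallness of the integrals
    of its excesses over large levels. *)
Definition excess (k u : R) := Num.max (`|u| - k) 0.

Definition clip (k u : R) := Num.max (- k) (Num.min u k).

Lemma excess_ge0 k u : 0 <= excess k u.
Proof. by rewrite /excess le_max lexx orbT. Qed.

Lemma clip_le k u : 0 <= k -> `|clip k u| <= k.
Proof.
move=> k0; rewrite /clip ler_norml ge_max le_max lexx/= ge_min lexx orbT andbT.
by rewrite -subr_ge0 opprK addr_ge0.
Qed.

Lemma clip_excess k u : 0 <= k -> `|u - clip k u| = excess k u.
Proof.
move=> k0; rewrite /excess /clip.
have [u0|u0] := leP 0 u; have [uk|uk] := leP u k.
- rewrite max_r; last by lra.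
  by rewrite subrr normr0 max_r// ger0_norm//; lra.
- rewrite max_r; last by lra.
  by rewrite ger0_norm ?subr_ge0 1?ltW// ger0_norm// max_l// subr_ge0 ltW.
- have [h|h] := leP (- k) u.
    by rewrite subrr normr0 max_r// ltr0_norm//; lra.
  by rewrite !ltr0_norm; [|lra..]; rewrite max_l//; lra.
- lra.
Qed.

Lemma continuous_clip k : continuous (clip k).
Proof.
move=> u; apply: (@continuous_max R R (cst (- k)) (fun u => Num.min u k)).
  exact: cvg_cst.
by apply: (@continuous_min R R id (cst k)); [exact: cvg_id|exact: cvg_cst].
Qed.

Lemma measurable_clip k f : measurable_fun setT f ->
  measurable_fun setT (fun x => clip k (f x)).
Proof.
move=> mf; apply: measurable_maxr => //; exact: measurable_minr.
Qed.

Lemma measurable_excess k f : measurable_fun setT f ->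
  measurable_fun setT (fun x => excess k (f x)).
Proof.
move=> mf; apply: measurable_maxr => //; apply: measurable_funB => //.
exact: measurableT_comp.
Qed.

Lemma continuous_excess k : continuous (excess k).
Proof.
move=> u; apply: (@continuous_max R R (fun u => `|u| - k) (cst 0)).
  by apply: cvgB; [exact: norm_continuous|exact: cvg_cst].
exact: cvg_cst.
Qed.

Section vitali.
Variables (U_ : nat -> W -> R) (U : W -> R).
Hypothesis mU_ : forall n, measurable_fun setT (U_ n).
Hypothesis mU : measurable_fun setT U.
Hypothesis U_U : {ae mu, forall x, U_ ^~ x @ \oo --> U x}.
Hypothesis UI : forall e : R, 0 < e -> exists2 k, 0 <= k &
  forall n, (\int[mu]_x (excess k (U_ n x))%:E <= e%:E)%E.

Lemma excess_int_le e k : (forall n, \int[mu]_x (excess k (U_ n x))%:E <= e%:E)%E ->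
  (\int[mu]_x (excess k (U x))%:E <= e%:E)%E.
Proof.
apply: fatou_bound => //.
- by move=> n; exact: measurable_excess.
- exact: measurable_excess.
- by move=> n x; exact: excess_ge0.
- by move=> x; exact: excess_ge0.
- apply: filterS U_U => x Ux r r0.
  have /cvgrPdist_le/(_ _ r0) : excess k (U_ n x) @[n --> \oo] --> excess k (U x).
    by apply: (cvg_comp _ _ Ux); exact: continuous_excess.
  apply: filterS => n; rewrite ler_norml => /andP[_].
  by rewrite lerBlDl.
Qed.

Lemma excess_L1 f k e : measurable_fun setT f -> 0 <= k ->
  (\int[mu]_x (excess k (f x))%:E <= e%:E)%E -> L1 f.
Proof.
move=> mf k0 fe; apply: (@L1_le _ (fun x => k + excess k (f x))) => //.
  apply: L1D; first exact: L1_cst.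
  apply: (L1_ge0 _ _ fe); first exact: measurable_excess.
  by move=> x; exact: excess_ge0.
by apply: aeW => x; rewrite /excess -lerBlDl le_max lexx.
Qed.

Lemma vitali_L1 : L1 U.
Proof.
have [k k0 kU] := UI ltr01.
by apply: (excess_L1 mU k0 (e := 1)); exact: excess_int_le.
Qed.

(** Vitali's convergence theorem, for integrals equal to zero: the clipped
    functions converge by domination, and clipping costs at most the excess. *)
Lemma vitali_int0 B : measurable B ->
  (forall n, \int[mu]_(x in B) (U_ n x)%:E = 0)%E ->
  (\int[mu]_(x in B) (U x)%:E = 0)%E.
Proof.
move=> mB U0; apply/eqP; rewrite -abse_eq0 eq_le abse_ge0 andbT.
apply/lee_addgt0Pr => e e0.
rewrite add0e; have e20 : 0 < e / 2 by rewrite divr_gt0.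
have [k k0 kU_] := UI e20.
have kU := excess_int_le kU_.
have mc f : measurable_fun setT f -> measurable_fun setT (fun x => f x - clip k (f x)).
  by move=> mf; apply: measurable_funB => //; exact: measurable_clip.
have Lc f : measurable_fun setT f -> L1 (fun x => clip k (f x)).
  move=> mf; apply: (@L1_bounded _ k); first exact: measurable_clip.
  by move=> x; exact: clip_le.
have Lfc f : L1 f -> L1 (fun x => f x - clip k (f x)).
  by move=> Lf; apply: L1B => //; apply: Lc; exact: L1_measurable.
have split f : L1 f -> (\int[mu]_(x in B) (f x)%:E =
    \int[mu]_(x in B) (clip k (f x))%:E +
    \int[mu]_(x in B) (f x - clip k (f x))%:E)%E.
  move=> Lf; rewrite -intD//; [|exact/Lc/L1_measurable|exact: Lfc].
  by under [RHS]eq_integral do rewrite addrC subrK.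
have small f : L1 f -> (\int[mu]_x (excess k (f x))%:E <= (e / 2)%:E)%E ->
    (`|\int[mu]_(x in B) (f x - clip k (f x))%:E| <= (e / 2)%:E)%E.
  move=> Lf; apply: le_trans; have mf := L1_measurable Lf.
  apply: le_trans (le_abse_integral _ _ _) _ => //.
    by apply/measurable_EFinP; apply: measurable_funTS; exact: mc.
  apply: (@le_trans _ _ (\int[mu]_(x in B) (excess k (f x))%:E)%E).
    rewrite le_eqVlt; apply/orP; left; apply/eqP.
    by apply: eq_integral => x _ /=; rewrite clip_excess.
  apply: ge0_subset_integral => //.
    by apply/measurable_EFinP; exact: measurable_excess.
  by move=> x _; rewrite lee_fin excess_ge0.
have LU_ n : L1 (U_ n) by exact: (excess_L1 _ k0 (kU_ n)).
have clip_small n : (`|\int[mu]_(x in B) (clip k (U_ n x))%:E| <= (e / 2)%:E)%E.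
  have fi : (\int[mu]_(x in B) (U_ n x - clip k (U_ n x))%:E \is a fin_num)%E.
    exact/integrable_fin_num/L1_integrable/Lfc.
  have ci : (\int[mu]_(x in B) (clip k (U_ n x))%:E \is a fin_num)%E.
    exact/integrable_fin_num/L1_integrable/Lc.
  have := small _ (LU_ n) (kU_ n); have := U0 n; rewrite split//.
  rewrite -(fineK ci) -(fineK fi) -EFinD => -[/eqP]; rewrite addr_eq0 => /eqP->.
  by rewrite /= normrN.
have LU : L1 U by exact: (excess_L1 mU k0 kU).
have [||||_ _ cvgI] := dominated_convergence mB
  (f_ := fun n x => (clip k (U_ n x))%:E) (f := fun x => (clip k (U x))%:E)
  (g := fun=> k%:E) (mu := mu) _ _ _ (L1_integrable mB (L1_cst k)).
- by move=> n; apply/measurable_EFinP/measurable_funTS/measurable_clip.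
- by apply/measurable_EFinP/measurable_funTS/measurable_clip.
- apply: filterS U_U => x Ux _; apply: cvg_EFin; first exact: nearW.
  by apply: (cvg_comp _ _ Ux); exact: continuous_clip.
- by apply: aeW => x n _; rewrite lee_fin clip_le.
rewrite split//; apply: (le_trans (lee_abs_add _ _)).
rewrite [in leRHS](splitr e) EFinD; apply: leeD; last exact: small.
apply: (cvge_le _ (cvg_abse cvgI)).
by apply: nearW => n; exact: clip_small.
Qed.

End vitali.

End integral_toolbox2.

(** * Continuous paths and time grids *)

Section uniform_continuity.
Context (R : realType).

Lemma within_continuousP (T : R) (f : R -> R) :
  {within `[0, T], continuous f} <->
  forall x, 0 <= x <= T -> forall e, 0 < e -> exists2 dl, 0 < dl &
    forall y, 0 <= y <= T -> `|x - y| < dl -> `|f x - f y| < e.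
Proof.
split => [/subspace_continuousP fc x xT e e0|fc].
  have xI : `[0, T]%classic x by rewrite /= in_itv.
  have /cvgrPdist_lt/(_ _ e0) := fc _ xI.
  rewrite near_withinE => -[dl /= dl0 H]; exists dl => // y yT xy.
  by apply: H => //=; rewrite in_itv.
apply/subspace_continuousP => x; rewrite /= in_itv/= => xT.
apply/cvgrPdist_lt => e e0; rewrite near_withinE.
have [dl dl0 H] := fc _ xT _ e0.
by exists dl => //= y xy; rewrite in_itv/= => yT; exact: H.
Qed.

Lemma time_itv (T s t : R) : 0 <= s -> s <= t -> t <= T ->
  (0 <= s <= T) * (0 <= t <= T).
Proof. by move=> s0 st tT; rewrite s0 (le_trans st)// tT (le_trans s0). Qed.

Lemma heine_cantor (T : R) (f : R -> R) :
  {within `[0, T], continuous f} -> forall e, 0 < e -> exists2 dl, 0 < dl &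
    forall x y, 0 <= x <= T -> 0 <= y <= T -> `|x - y| < dl -> `|f x - f y| < e.
Proof.
move=> /within_continuousP fc e e0.
pose P (dl x : R) := 0 <= x <= T ->
  forall y, 0 <= y <= T -> `|x - y| < dl -> `|f x - f y| < e.
have /compact_near_coveringP cpt := @segment_compact R 0 T.
have [|dl /= dl0 H] := cpt R (0^'+) P _.
  move=> x; rewrite /= in_itv/= => xT.
  have e20 : 0 < e / 2 by rewrite divr_gt0.
  have [r r0 fr] := fc _ xT _ e20.
  have r20 : 0 < r / 2 by rewrite divr_gt0.
  exists (ball x (r / 2), [set s | s < r / 2]) => /=.
    by split; [exact: nbhsx_ballx|exact: nbhs_right_lt].
  move=> [x' dl]/= [xx' dlr] x'T y yT x'y.
  rewrite (splitr e) -(subrKA (f x)) (le_lt_trans (ler_normD _ _))// ltrD//.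
    by rewrite distrC; apply: fr => //; apply: (lt_trans xx'); lra.
  apply: fr => //; rewrite -(subrKA x') (le_lt_trans (ler_normD _ _))//.
  rewrite (splitr r) ltrD//; exact: lt_trans dlr.
have dl20 : 0 < dl / 2 by rewrite divr_gt0.
exists (dl / 2) => // x y xT yT; apply: (H (dl / 2)) => //=.
by rewrite sub0r normrN gtr0_norm// ltr_pdivrMr// ltr_pMr// ltr1n.
Qed.

Lemma distr_min (s t c : R) : `|Num.min s c - Num.min t c| <= `|s - t|.
Proof.
by rewrite /Num.min; case: ltP => h1; case: ltP => h2; rewrite ler_norml;
  have [h|h] := lerP t s; rewrite ?(ger0_norm, ltr0_norm) ?subr_ge0 ?subr_lt0//;
  apply/andP; split; lra.
Qed.

Lemma within_continuous_min (T : R) (f : R -> R) (c : R) : 0 <= c ->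
  {within `[0, T], continuous f} ->
  {within `[0, T], continuous (fun t => f (Num.min t c))}.
Proof.
move=> c0 /within_continuousP cf; apply/within_continuousP => t /andP[t0 tT] e e0.
have mT s : 0 <= s <= T -> 0 <= Num.min s c <= T.
  by move=> /andP[s0 sT]; rewrite le_min s0 c0/= ge_min sT.
have [|dl dl0 H] := cf _ (mT t _) _ e0; first by rewrite t0.
exists dl => // s sT ts; apply: H; first exact: mT.
exact: le_lt_trans (distr_min _ _ _) ts.
Qed.

End uniform_continuity.

Section grid.
Context (R : realType).
Implicit Types (s t T : R) (n i : nat).

Definition grid s t n i : R := s + i%:R * ((t - s) / n.+1%:R).

Lemma grid0 s t n : grid s t n 0 = s.
Proof. by rewrite /grid mul0r addr0. Qed.

Lemma grid_end s t n : grid s t n n.+1 = t.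
Proof. by rewrite /grid mulrC divfK ?pnatr_eq0// addrC subrK. Qed.

Lemma grid_step s t n i : grid s t n i.+1 - grid s t n i = (t - s) / n.+1%:R.
Proof. by rewrite /grid -natr1 mulrDl mul1r; ring. Qed.

Lemma grid_mono s t n i j : s <= t -> (i <= j)%N -> grid s t n i <= grid s t n j.
Proof.
move=> st ij; rewrite /grid lerD2l ler_wpM2r ?ler_nat//.
by rewrite divr_ge0 ?subr_ge0.
Qed.

Lemma grid_itv s t n i : s <= t -> (i <= n.+1)%N -> s <= grid s t n i <= t.
Proof.
move=> st ile; apply/andP; split.
  by rewrite -[leLHS](grid0 s t n) grid_mono.
by rewrite -[leRHS](grid_end s t n) grid_mono.
Qed.

Lemma grid_itvT T s t n i : 0 <= s -> s <= t -> t <= T -> (i <= n.+1)%N ->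
  0 <= grid s t n i <= T.
Proof.
move=> s0 st tT ile; have /andP[h1 h2] := grid_itv st ile.
by rewrite (le_trans s0)//= (le_trans h2).
Qed.

Lemma mesh_small s t dl : 0 < dl -> \forall n \near \oo, (t - s) / n.+1%:R < dl.
Proof.
move=> dl0; near=> n.
rewrite ltr_pdivrMr ?ltr0n// mulrC -ltr_pdivrMr//.
apply: (@lt_le_trans _ _ n.+1%:R) => //.
rewrite -natr1 (@le_lt_trans _ _ n%:R) ?ltrDl//.
by near: n; exact: nbhs_infty_ger.
Unshelve. all: by end_near. Qed.

Lemma grid_osc T s t (f : R -> R) (e : R) : {within `[0, T], continuous f} ->
  0 <= s -> s <= t -> t <= T -> 0 < e ->
  \forall n \near \oo, forall i, (i <= n)%N ->
    forall u v, grid s t n i <= u <= grid s t n i.+1 ->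
    grid s t n i <= v <= grid s t n i.+1 -> `|f u - f v| < e.
Proof.
move=> fc s0 st tT e0; have [dl dl0 fdl] := heine_cantor fc e0.
apply: filterS (mesh_small s t dl0) => n ndl i ile u v /andP[u1 u2] /andP[v1 v2].
have /andP[g1 _] : 0 <= grid s t n i <= T by apply: grid_itvT => //; exact: leqW.
have /andP[_ g2] : 0 <= grid s t n i.+1 <= T by apply: grid_itvT.
rewrite -(grid_step s t n i) in ndl.
apply: fdl.
- by rewrite (le_trans g1)//= (le_trans u2).
- by rewrite (le_trans g1)//= (le_trans v2).
- by rewrite ltr_norml; apply/andP; split; lra.
Qed.

End grid.

Section exponential_inequalities.
Context (R : realType).

(** A majorant of the exponential near [0] that is positive everywhere: its
    conditional expectation at a martingale increment needs only second
    moments, however large the increment may be. *)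
Definition quad (u : R) : R := 1 + u + 2 * u ^+ 2.

Lemma quad_gt0 u : 0 < quad u.
Proof. by have := sqr_ge0 (u + 1 / 4); rewrite /quad; lra. Qed.

Lemma expR_le_quad u : `|u| <= 1 / 2 -> expR u <= quad u.
Proof.
rewrite ler_norml => /andP[u1 u2].
have h : 1 - u <= expR (- u) by exact: expR_ge1Dx.
have p : 0 < expR u by exact: expR_gt0.
have E : expR u * expR (- u) = 1 by rewrite -expRD subrr expR0.
have : expR u * (1 - u) <= 1 by rewrite -[leRHS]E ler_wpM2l// ltW.
have : 1 <= (1 - u) * quad u.
  rewrite /quad; have : 0 <= u ^+ 2 * (1 - 2 * u) by rewrite mulr_ge0 ?sqr_ge0//; lra.
  by lra.
have u3 : 0 < 1 - u by lra.
move=> h1 h2; rewrite -(ler_pM2l u3); lra.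
Qed.

Lemma expR_le_taylor (u : R) : expR u <= 1 + u + 4 * u ^+ 2 * expR `|u|.
Proof.
have [u1|u1] := leP `|u| (1 / 2).
  have e1 : 1 <= expR `|u| by rewrite -expR0 ler_expR.
  have := expR_le_quad u1; rewrite /quad => /le_trans; apply.
  have := sqr_ge0 u; nra.
have [u0|u0] := leP 0 u.
  rewrite ger0_norm// in u1 *.
  have p : 0 < expR u by exact: expR_gt0.
  have : 1 <= 4 * u ^+ 2 by nra.
  by nra.
have e1 : expR u <= 1 by rewrite -expR0 ler_expR ltW.
apply: (le_trans e1); rewrite ltr0_norm// in u1 *.
have e2 : 1 <= expR (- u) by rewrite -expR0 ler_expR; lra.
have := sqr_ge0 u; nra.
Qed.

Lemma geometric_sum_le (q : R) N : 0 <= q -> q < 1 ->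
  \sum_(k < N) q ^+ k <= (1 - q)^-1.
Proof.
move=> q0 q1; rewrite -[leRHS]mul1r ler_pdivlMr ?subr_gt0//.
have := subrX1 q N; rewrite -opprB -(opprB 1) mulNr => /oppr_inj.
by rewrite mulrC => <-; rewrite gerBl exprn_ge0.
Qed.

End exponential_inequalities.

(** * Sub-Gaussian martingales *)

Section filtrations.
Context d (W : measurableType d) (R : realType) (mu : probability W R).
Implicit Types (s t : R) (B : set W).

Record complete_filtration (F : R -> set (set W)) : Prop := CompleteFiltration {
  fil_sigma : forall t, sigma_algebra setT (F t) ;
  fil_mono : forall s t, s <= t -> F s `<=` F t ;
  fil_meas : forall t, F t `<=` measurable ;
  fil_null : forall t N, mu.-negligible N -> F t N }.

(** An upper bound on conditional second moments is all that sub-Gaussian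
    estimates need. It survives stopping, and passes to the limit in a
    localization by Fatou's lemma before any uniform integrability is known. *)
Record controlled_martingale (F : R -> set (set W)) (T L : R) (Y : R -> W -> R)
  : Prop := ControlledMartingale {
  cm_adapted : adapted T F Y ;
  cm_cont : {ae mu, forall x, {within `[0, T], continuous (Y ^~ x)}} ;
  cm_L1 : forall t, 0 <= t <= T -> L1 mu (Y t) ;
  cm_center : forall s t B, 0 <= s -> s <= t -> t <= T -> F s B ->
    (\int[mu]_(x in B) (Y t x - Y s x)%:E = 0)%E ;
  cm_square : forall s t B, 0 <= s -> s <= t -> t <= T -> F s B ->
    (\int[mu]_(x in B) ((Y t x - Y s x) ^+ 2)%:E <= (L * (t - s))%:E * mu B)%E }.

Variable F : R -> set (set W).
Hypothesis cF : complete_filtration F.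

(** Conditioning step by step on a product of adapted factors. *)
Lemma int_prod_le (tau : nat -> R) (f : nat -> W -> R) (c : R) K B :
  (forall i j, (i <= j)%N -> (j <= K)%N -> tau i <= tau j) -> 0 <= c ->
  (forall i, (i < K)%N -> measurable_wrt (F (tau i.+1)) (f i)) ->
  (forall i x, 0 <= f i x) ->
  (forall i C, (i < K)%N -> F (tau i) C ->
    (\int[mu]_(x in C) (f i x)%:E <= c%:E * mu C)%E) ->
  F (tau 0) B -> forall j, (j <= K)%N ->
  (\int[mu]_(x in B) (\prod_(i < j) f i x)%:E <= (c ^+ j)%:E * mu B)%E /\
  measurable_wrt (F (tau j)) (fun x => \prod_(i < j) f i x).
Proof.
move=> tau_mono c0 wf f0 fc FB; have mB := fil_meas cF FB.
have P0 j x : 0 <= \prod_(i < j) f i x by exact: prodr_ge0.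
have wP j : (j <= K)%N -> measurable_wrt (F (tau j)) (fun x => \prod_(i < j) f i x).
  move=> jK; have sG := fil_sigma cF (tau j); apply/(measurable_wrtP _ sG).
  apply: measurable_prod => i _; apply/(measurable_wrtP _ sG) => A mA.
  apply: (fil_mono cF (tau_mono i.+1 j _ jK)) => //.
  exact: wf (leq_trans _ jK) _ _.
move=> j jK; split; last exact: wP.
elim: j jK => [_|j IH jK].
  under eq_integral do rewrite big_ord0.
  by rewrite expr0 int_cst.
have FjB : F (tau j) B by apply: (fil_mono cF _ FB); apply: tau_mono => //; exact: ltnW.
have mP := measurable_wrt_fun (fil_meas cF (t:=tau j)) (wP j (ltnW jK)).
under eq_integral do rewrite big_ord_recr/=.
apply: (@le_trans _ _ (\int[mu]_(x in B) (\prod_(i < j) f i x * c)%:E)%E).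
  apply: (@int_weight_le _ _ _ mu (F (tau j)) B _ (f j) (cst c)) => //.
  - exact: (fil_sigma cF).
  - exact: (fil_meas cF).
  - by apply: wP; exact: ltnW.
  - exact: P0.
  - exact: (measurable_wrt_fun (fil_meas cF (t:=tau j.+1)) (wf j jK)).
  - by move=> C FC; rewrite (int_cst mu _ (fil_meas cF FC)); exact: fc.
under eq_integral do rewrite mulrC EFinM.
rewrite ge0_integralZl ?lee_fin//.
- by rewrite exprS [in leRHS]EFinM -muleA lee_wpmul2l ?lee_fin// IH// ltnW.
- by apply/measurable_EFinP; exact: measurable_funTS.
- by move=> x _; rewrite lee_fin.
Qed.

End filtrations.

Section subgaussian.
Context d (W : measurableType d) (R : realType) (mu : probability W R).
Variables (F : R -> set (set W)) (T L : R) (Y : R -> W -> R).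
Hypothesis cF : complete_filtration mu F.
Hypothesis L0 : 0 <= L.
Hypothesis cY : controlled_martingale mu F T L Y.

Implicit Types (s t theta : R) (B : set W).

Let mY t : 0 <= t <= T -> measurable_fun setT (Y t).
Proof. by move=> /(cm_L1 cY)/L1_measurable. Qed.

Lemma adapted_le s t : 0 <= s -> s <= t -> t <= T -> measurable_wrt (F t) (Y s).
Proof.
move=> s0 st tT B mB; apply: (fil_mono cF st).
by apply: (cm_adapted cY) => //; rewrite s0 (le_trans st).
Qed.

Lemma int_quad_le theta s t B : 0 <= s -> s <= t -> t <= T -> F s B ->
  (\int[mu]_(x in B) (quad (theta * (Y t x - Y s x)))%:E <=
   (1 + 2 * theta ^+ 2 * (L * (t - s)))%:E * mu B)%E.
Proof.
move=> s0 st tT FB; have mB := fil_meas cF FB.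
have LYt : L1 mu (Y t) by apply: (cm_L1 cY); rewrite (le_trans s0).
have LYs : L1 mu (Y s) by apply: (cm_L1 cY); rewrite s0 (le_trans st).
have LD : L1 mu (fun x => Y t x - Y s x) by exact: L1B.
have mD := L1_measurable LD.
have FT : F s setT by apply: sub_sigmaT; exact: (fil_sigma cF).
have LD2 : L1 mu (fun x => (Y t x - Y s x) ^+ 2).
  apply: (@L1_ge0 _ _ _ _ _ (L * (t - s))).
  - exact: measurable_funX.
  - by move=> x; exact: sqr_ge0.
  - by have := cm_square cY s0 st tT FT; rewrite probability_setT mule1.
rewrite (_ : (\int[mu]_(x in B) _)%E =
  (\int[mu]_(x in B) ((cst 1 x : R) + theta * (Y t x - Y s x) +
    2 * theta ^+ 2 * (Y t x - Y s x) ^+ 2)%:E)%E); last first.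
  by apply: eq_integral => x _; rewrite /quad exprMn mulrA.
rewrite intD//; last 2 first.
- by apply: L1D; [exact: L1_cst|exact: L1Z].
- exact: L1Z.
rewrite intD//; [|exact: L1_cst|exact: L1Z].
rewrite !intZ// (cm_center cY)// mule0 adde0.
rewrite EFinD ge0_muleDl ?lee_fin//; last first.
  by apply: mulr_ge0; rewrite mulr_ge0 ?sqr_ge0 ?subr_ge0.
rewrite mul1e; apply: leeD; first by rewrite int_cst// mul1e.
rewrite [in leRHS]EFinM -muleA; apply: lee_wpmul2l; last exact: (cm_square cY).
by rewrite lee_fin mulr_ge0 ?sqr_ge0.
Qed.

(** Sub-Gaussian increments without stochastic calculus. Cut [[s, t]] into small
    steps: the product of the [quad]s of the scaled increments has an
    expectation below the stated bound, by conditioning step by step. By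
    continuity of the paths all the increments end up below [1 / 2], where
    [quad] dominates the exponential, so the product dominates
    [expR (theta * (Y t - Y s))] for all fine grids, and Fatou's lemma
    concludes. *)
Lemma subgaussian theta s t B : 0 <= s -> s <= t -> t <= T -> F s B ->
  (\int[mu]_(x in B) (expR (theta * (Y t x - Y s x)))%:E <=
   (expR (2 * theta ^+ 2 * (L * (t - s))))%:E * mu B)%E.
Proof.
move=> s0 st tT FB; have mB := fil_meas cF FB.
pose D n i x := theta * (Y (grid s t n i.+1) x - Y (grid s t n i) x).
pose P n j x := \prod_(i < j) quad (D n i x).
have gT n i : (i <= n.+1)%N -> 0 <= grid s t n i <= T.
  by move=> ?; exact: grid_itvT.
have wq G f : sigma_algebra setT G -> measurable_wrt G f ->
    measurable_wrt G (fun x => quad (f x)).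
  move=> sG /(measurable_wrtP _ sG) mf; apply/(measurable_wrtP _ sG).
  rewrite /quad; apply: measurable_funD; first exact: measurable_funD.
  by apply: measurable_funM => //; exact: measurable_funX.
have wD n i j : (i < j)%N -> (j <= n.+1)%N -> measurable_wrt (F (grid s t n j)) (D n i).
  move=> ij jn; have sG := fil_sigma cF (grid s t n j).
  have h k : (k <= j)%N -> measurable_fun setT
      (Y (grid s t n k) : g_sigma_algebraType (F (grid s t n j)) -> R).
    move=> kj; apply/(measurable_wrtP _ sG); apply: adapted_le.
    - by have /andP[] := gT n k (leq_trans kj jn).
    - exact: grid_mono.
    - by have /andP[] := gT n j jn.
  apply/(measurable_wrtP _ sG); apply: measurable_funM => //.
  by apply: measurable_funB; apply: h => //; exact: ltnW.
pose c n := 1 + 2 * theta ^+ 2 * (L * ((t - s) / n.+1%:R)).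
have c0 n : 0 <= c n.
  apply: addr_ge0 => //; apply: mulr_ge0; rewrite mulr_ge0 ?sqr_ge0//.
  by rewrite divr_ge0 ?subr_ge0.
have wqD n i : (i < n.+1)%N ->
    measurable_wrt (F (grid s t n i.+1)) (fun x => quad (D n i x)).
  by move=> ile; apply: wq; [exact: (fil_sigma cF)|exact: wD].
have bound n : (\int[mu]_(x in B) (P n n.+1 x)%:E <= (c n ^+ n.+1)%:E * mu B)%E /\
    measurable_wrt (F (grid s t n n.+1)) (P n n.+1).
  apply: (@int_prod_le _ _ _ mu F cF (grid s t n) (fun i x => quad (D n i x))
    (c n) n.+1 B _ (c0 n) _ _ _ _ _ (leqnn _)) => //.
  - by move=> i j ij _; exact: grid_mono.
  - exact: wqD.
  - by move=> i x; rewrite ltW// quad_gt0.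
  - move=> i C iK FC; rewrite /c -(grid_step s t n i).
    have /andP[? _] := gT n i (ltnW iK); have /andP[_ ?] := gT n i.+1 iK.
    by apply: int_quad_le => //; exact: grid_mono.
  - by rewrite grid0.
have P0 n x : 0 <= P n n.+1 x.
  by apply: prodr_ge0 => i _; rewrite ltW// quad_gt0.
have fin_P m : (\int[mu]_(x in B) (P m m.+1 x)%:E <=
    (expR (2 * theta ^+ 2 * (L * (t - s))))%:E * mu B)%E.
  apply: (le_trans (bound m).1); rewrite lee_wpmul2r//.
  rewrite lee_fin (_ : 2 * theta ^+ 2 * (L * (t - s)) =
    m.+1%:R * (2 * theta ^+ 2 * (L * ((t - s) / m.+1%:R)))); last first.
    have m0 : m.+1%:R != 0 :> R by rewrite pnatr_eq0.
    by rewrite -[in LHS](divfK m0 (t - s)); ring.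
  by rewrite expRM_natl lerXn2r ?nnegrE ?expR_ge0// expR_ge1Dx.
have tT0 : 0 <= t <= T by rewrite (le_trans s0).
have sT0 : 0 <= s <= T by rewrite s0 (le_trans st).
apply: (@fatou_bound _ _ _ mu B (fun n => P n n.+1)) fin_P => //.
- move=> n; apply: (@measurable_wrt_fun _ _ _ (F (grid s t n n.+1))).
    exact: (fil_meas cF).
  exact: (bound n).2.
- apply: measurableT_comp => //; apply: measurable_funM => //.
  by apply: measurable_funB; exact: mY.
apply: filterS (cm_cont cY) => x cx e e0.
have t10 : 0 < (`|theta| + 1)^-1 / 2 by rewrite divr_gt0// invr_gt0 ltr_wpDl.
have := grid_osc cx s0 st tT t10.
apply: filterS => n osc.
have smallD i : (i <= n)%N -> expR (D n i x) <= quad (D n i x).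
  move=> ile; apply: expR_le_quad; rewrite /D normrM.
  have gle : grid s t n i <= grid s t n i.+1 by exact: grid_mono.
  have := osc i ile (grid s t n i.+1) (grid s t n i).
  rewrite !lexx !gle => /(_ isT isT) h.
  have th : `|theta| * (`|theta| + 1)^-1 <= 1.
    by rewrite ler_pdivrMr ?ltr_wpDl// mul1r lerDl.
  rewrite (le_trans (ler_wpM2l (normr_ge0 _) (ltW h)))//.
  by rewrite mulrA ler_pdivrMr// divfK// .
suff : expR (theta * (Y t x - Y s x)) <= P n n.+1 x by lra.
have : forall j, (j <= n.+1)%N ->
    expR (theta * (Y (grid s t n j) x - Y s x)) <= P n j x.
  elim=> [_|j IH jn].
    by rewrite grid0 subrr mulr0 expR0 /P big_ord0.
  rewrite /P big_ord_recr/= (_ : theta * _ =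
    theta * (Y (grid s t n j) x - Y s x) + D n j x); last by rewrite /D; ring.
  rewrite expRD ler_pM ?expR_ge0//; last exact: smallD.
  by apply: IH; exact: ltnW.
by move=> /(_ n.+1 (leqnn _)); rewrite grid_end.
Qed.

End subgaussian.

(** * Exponential moments of squares *)

Section power_exponential.
Context (R : realType).
Implicit Types (x z h : R).

Lemma exprn_le_expR n x : 0 <= x -> x ^+ n <= n%:R ^+ n * expR x.
Proof.
case: n => [|n] x0; first by rewrite !expr0 mul1r -expR0 ler_expR.
have n0 : 0 < n.+1%:R :> R by rewrite ltr0n.
have h : x / n.+1%:R <= expR (x / n.+1%:R).
  by apply: le_trans (expR_ge1Dx _); rewrite lerDr.
have -> : x = n.+1%:R * (x / n.+1%:R) by rewrite mulrC divfK// gt_eqF.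
rewrite exprMn expRM_natl ler_wpM2l ?exprn_ge0 ?ler0n// lerXn2r ?nnegrE ?expR_ge0//.
by rewrite divr_ge0.
Qed.

Lemma expR_norm_le z : expR `|z| <= expR z + expR (- z).
Proof.
have [z0|z0] := leP 0 z.
  by rewrite ger0_norm// lerDl expR_ge0.
by rewrite ltr0_norm// lerDr expR_ge0.
Qed.

(** The summand at the integer part [k] of [`|z|] is enough: up to the choice of
    a sign, its exponent is [(1 - (`|z| - k) ^+ 2 + z ^+ 2) / 16]. The weights
    are such that the series still converges when the bracketed exponentials are
    replaced by their sub-Gaussian bound [expR (2 * (k / 8) ^+ 2)]. *)
Lemma expR_sqr_le_sum z N : (Num.truncn `|z| < N)%N ->
  expR (z ^+ 2 / 32) <= \sum_(k < N)
    (expR (1 / 16 - k%:R ^+ 2 / 16) *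
     (expR (k%:R / 8 * z) + expR (- (k%:R / 8) * z))).
Proof.
set k := Num.truncn _ => kN.
rewrite (bigD1 (Ordinal kN))//=.
have s0 : 0 <= \sum_(i < N | i != Ordinal kN)
    (expR (1 / 16 - i%:R ^+ 2 / 16) *
     (expR (i%:R / 8 * z) + expR (- (i%:R / 8) * z))).
  by apply: sumr_ge0 => i _; rewrite mulr_ge0 ?addr_ge0 ?expR_ge0.
rewrite -[leLHS]addr0 lerD//.
have z0 : 0 <= `|z| by [].
have /andP[k1 k2] := truncn_itv z0; rewrite -/k -natr1 in k1 k2.
have k0 : 0 <= k%:R :> R by rewrite ler0n.
apply: (@le_trans _ _ (expR (1 / 16 - k%:R ^+ 2 / 16) * expR `|k%:R / 8 * z|)).
  rewrite -expRD ler_expR normrM ger0_norm ?divr_ge0//.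
  rewrite -[z ^+ 2]real_normK ?num_real//; nra.
by rewrite ler_wpM2l ?expR_ge0// mulNr expR_norm_le.
Qed.

(** An absolute bound for the Gaussian sum of [expR (- k ^+ 2 / 32)]. *)
Definition theta_bound : R := (1 - expR (- (1 / 32)))^-1.

Lemma theta_bound_gt0 : 0 < theta_bound.
Proof. by rewrite invr_gt0 subr_gt0 expR_lt1; lra. Qed.

Lemma sum_gauss_le N : \sum_(k < N) expR (- (k%:R ^+ 2 / 32)) <= theta_bound.
Proof.
pose q : R := expR (- (1 / 32)).
have q1 : q < 1 by rewrite expR_lt1; lra.
apply: (@le_trans _ _ (\sum_(k < N) q ^+ k)).
  apply: ler_sum => k _; rewrite -expRM_natl ler_expR.
  have : k%:R <= k%:R ^+ 2 :> R.
    by rewrite -natrX ler_nat; case: (nat_of_ord k) => // m; rewrite expnS expn1 leq_pmulr.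
  by lra.
by apply: geometric_sum_le => //; exact: expR_ge0.
Qed.

(** Bounds the conditional expectation of [expR (z ^+ 2 / 32)] when [z] is a
    normalized increment. *)
Definition expsq_cst : R := 2 * expR (1 / 16) * theta_bound.

Lemma expsq_cst_gt0 : 0 < expsq_cst.
Proof. by rewrite !mulr_gt0 ?expR_gt0 ?theta_bound_gt0. Qed.

Definition block_cst : R := 16 * 64 ^+ 2 * expR (1 / 32) * expsq_cst.

Lemma block_cst_gt0 : 0 < block_cst.
Proof.
rewrite mulr_gt0 ?expsq_cst_gt0// mulr_gt0 ?expR_gt0// mulr_gt0.
Qed.

(** Second order expansion of the exponential at [nu * (z ^+ 2 - a)]. The factor
    [expR (z ^+ 2 / (32 * h))] of the remainder is integrable for increments
    [z] over a time step of bracket at most [h]. *)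
Lemma expR_block_le z a h nu : 0 < h -> `|nu| * h <= 1 / 64 -> 0 <= a <= h ->
  expR (nu * (z ^+ 2 - a)) <= 1 + nu * (z ^+ 2 - a) +
    16 * 64 ^+ 2 * expR (1 / 32) * (nu * h) ^+ 2 * expR (z ^+ 2 / (32 * h)).
Proof.
move=> h0 nuh /andP[a0 ah]; set D := z ^+ 2 - a.
apply: (le_trans (expR_le_taylor _)); rewrite lerD2l.
have Dle : `|D| <= z ^+ 2 + h.
  by rewrite ler_norml /D; have := sqr_ge0 z; move=> ?; apply/andP; split; lra.
(* a scale at which two factors [expR y], one for [y ^+ 2] and one for the
   exponential of the remainder, are absorbed by [expR (z ^+ 2 / (32 * h))] *)
set y := `|D| / (64 * h).
have y0 : 0 <= y by rewrite divr_ge0// mulr_ge0// ltW.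
have yD : `|D| = y * (64 * h) by rewrite divfK// gt_eqF// mulr_gt0.
have nuD : `|nu * D| <= y.
  rewrite normrM yD; have : y * (64 * (`|nu| * h)) <= y * 1 by rewrite ler_wpM2l//; lra.
  by lra.
have D2 : (nu * D) ^+ 2 = 64 ^+ 2 * (nu * h) ^+ 2 * y ^+ 2.
  by rewrite exprMn -[D ^+ 2]real_normK ?num_real// yD; ring.
have y2 := exprn_le_expR 2 y0.
have e1 : expR `|nu * D| <= expR y by rewrite ler_expR.
have e2 : expR y * expR y <= expR (1 / 32) * expR (z ^+ 2 / (32 * h)).
  rewrite -!expRD ler_expR /y.
  have -> : 1 / 32 + z ^+ 2 / (32 * h) = (z ^+ 2 + h) / (32 * h).
    by field; rewrite gt_eqF.
  have -> : `|D| / (64 * h) + `|D| / (64 * h) = `|D| / (32 * h).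
    by field; rewrite gt_eqF.
  by rewrite ler_wpM2r// invr_ge0 mulr_ge0// ltW.
rewrite D2.
have c0 : 0 <= 4 * (64 ^+ 2 * (nu * h) ^+ 2) by rewrite mulr_ge0// mulr_ge0// sqr_ge0.
apply: (@le_trans _ _ (4 * (64 ^+ 2 * (nu * h) ^+ 2) * ((2%:R ^+ 2 * expR y) * expR y))).
  rewrite [leLHS](_ : _ = 4 * (64 ^+ 2 * (nu * h) ^+ 2) * (y ^+ 2 * expR `|nu * D|)); last by ring.
  by rewrite ler_wpM2l// ler_pM ?sqr_ge0 ?expR_ge0.
rewrite [leLHS](_ : _ = 16 * 64 ^+ 2 * (nu * h) ^+ 2 * (expR y * expR y)); last by ring.
rewrite [leRHS](_ : _ = 16 * 64 ^+ 2 * (nu * h) ^+ 2 * (expR (1 / 32) * expR (z ^+ 2 / (32 * h)))); last by ring.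
by rewrite ler_wpM2l// mulr_ge0// sqr_ge0.
Qed.

End power_exponential.

Section moments.
Context d (W : measurableType d) (R : realType) (mu : probability W R).
Variables (F : R -> set (set W)) (T L : R) (Y : R -> W -> R).
Hypothesis cF : complete_filtration mu F.
Hypothesis L0 : 0 <= L.
Hypothesis cY : controlled_martingale mu F T L Y.
Implicit Types (s t theta : R) (B : set W).

Let mD s t : 0 <= s -> s <= t -> t <= T ->
  measurable_fun setT (fun x => Y t x - Y s x).
Proof.
move=> s0 st tT; apply: measurable_funB; apply/L1_measurable/(cm_L1 cY).
  by rewrite tT (le_trans s0).
by rewrite s0 (le_trans st).
Qed.

Let mexp (c : R) s t : 0 <= s -> s <= t -> t <= T ->
  measurable_fun setT (fun x => expR (c * (Y t x - Y s x))).
Proof.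
by move=> *; apply: measurableT_comp => //; apply: measurable_funM => //; exact: mD.
Qed.

Lemma subgaussian_sym theta s t B : 0 <= s -> s <= t -> t <= T -> F s B ->
  (\int[mu]_(x in B) (expR (theta * (Y t x - Y s x)) +
                      expR (- theta * (Y t x - Y s x)))%:E <=
   (2 * expR (2 * theta ^+ 2 * (L * (t - s))))%:E * mu B)%E.
Proof.
move=> s0 st tT FB; have mB := fil_meas cF FB.
under eq_integral do rewrite EFinD.
rewrite ge0_integralD//.
- rewrite mulr_natl mulr2n EFinD ge0_muleDl ?lee_fin ?expR_ge0//.
  apply: leeD; first exact: (subgaussian cF L0 cY).
  by rewrite -(sqrrN theta); exact: (subgaussian cF L0 cY).
- by apply/measurable_EFinP/measurable_funTS; exact: mexp.
- by apply/measurable_EFinP/measurable_funTS; exact: mexp.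
Qed.

(** The bound depends on [L] and [T] only, hence is uniform in a localizing
    sequence. *)
Lemma fourth_moment s t : 0 <= s -> s <= t -> t <= T ->
  (\int[mu]_x ((Y t x - Y s x) ^+ 4)%:E <=
   (4 ^+ 4 * (2 * expR (2 * L * T)))%:E)%E.
Proof.
move=> s0 st tT; have FT : F s setT by apply: sub_sigmaT; exact: (fil_sigma cF).
have sg := subgaussian_sym 1 s0 st tT FT.
apply: (@le_trans _ _ (\int[mu]_x (4 ^+ 4 * (expR (1 * (Y t x - Y s x)) +
                      expR (- 1 * (Y t x - Y s x))))%:E)%E).
  apply: ae_int_le => //.
  - by apply: measurable_funX; exact: mD.
  - apply: measurable_funM => //; apply: measurable_funD; exact: mexp.
  - by move=> x; rewrite exprn_even_ge0.
  - apply: aeW => x; set y := _ - _.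
    have -> : y ^+ 4 = `|y| ^+ 4.
      by rewrite -[4%N]/(2 * 2)%N !exprM real_normK ?num_real.
    apply: (le_trans (exprn_le_expR 4 (normr_ge0 y))).
    by rewrite ler_wpM2l// mulN1r mul1r expR_norm_le.
under eq_integral do rewrite EFinM.
rewrite ge0_integralZl//.
- rewrite [in leRHS]EFinM lee_wpmul2l// ?lee_fin//.
  apply: (le_trans sg); rewrite probability_setT mule1 lee_fin ler_wpM2l//.
  rewrite ler_expR expr1n mulr1 -mulrA ler_wpM2l//.
  by rewrite ler_wpM2l//; lra.
- by apply/measurable_EFinP; apply: measurable_funD; exact: mexp.
Qed.

(** Mixing the sub-Gaussian bounds at the parameters [k / 8], [k] a natural
    number, with Gaussian weights replaces integration against a Gaussian
    density. *)
Lemma square_exponential s t B : 0 < L -> 0 <= s -> s < t -> t <= T -> F s B ->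
  (\int[mu]_(x in B) (expR ((Y t x - Y s x) ^+ 2 / (32 * (L * (t - s)))))%:E <=
   (expsq_cst R)%:E * mu B)%E.
Proof.
move=> Lp s0 st tT FB; have mB := fil_meas cF FB; have st' := ltW st.
set h := L * (t - s).
have h0 : 0 < h by rewrite mulr_gt0// subr_gt0.
pose r := Num.sqrt h; have r0 : 0 < r by rewrite sqrtr_gt0.
have rh : r ^+ 2 = h by rewrite sqr_sqrtr// ltW.
pose g k x := expR (k%:R / 8 / r * (Y t x - Y s x)) +
  expR (- (k%:R / 8 / r) * (Y t x - Y s x)).
have mg k : measurable_fun setT (g k).
  by apply: measurable_funD; exact: mexp.
have g0 k x : 0 <= g k x by rewrite addr_ge0 ?expR_ge0.
pose f N x := \sum_(k < N) expR (1 / 16 - k%:R ^+ 2 / 16) * g k x.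
have mf N : measurable_fun setT (f N).
  by apply: measurable_sum => k; exact: measurable_funM.
have f0 N x : 0 <= f N x.
  by apply: sumr_ge0 => k _; rewrite mulr_ge0 ?expR_ge0.
apply: (@fatou_bound _ _ _ mu B f) => //.
- apply: measurableT_comp => //; apply: measurable_funM => //.
  by apply: measurable_funX; exact: mD.
- apply: aeW => x e e0; near=> N.
  suff : expR ((Y t x - Y s x) ^+ 2 / (32 * h)) <= f N x by lra.
  have zN : (Num.truncn `|(Y t x - Y s x) / r| < N)%N.
    by near: N; exact: nbhs_infty_gt.
  have := expR_sqr_le_sum zN.
  rewrite (_ : ((Y t x - Y s x) / r) ^+ 2 / 32 = (Y t x - Y s x) ^+ 2 / (32 * h)); last first.
    by rewrite -rh; field; rewrite gt_eqF.
  move/le_trans; apply; rewrite le_eqVlt; apply/orP; left; apply/eqP.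
  apply: eq_bigr => k _; rewrite /g; congr (_ * (expR _ + expR _)).
    by rewrite mulrA mulrAC.
  by rewrite !mulNr; congr (- _); rewrite mulrA mulrAC.
- move=> N; rewrite /f; under eq_integral do rewrite -sumEFin.
  rewrite ge0_integral_sum//; last 2 first.
  + move=> k; apply/measurable_EFinP/measurable_funTS; exact: measurable_funM.
  + by move=> k x _; rewrite lee_fin mulr_ge0 ?expR_ge0.
  apply: (@le_trans _ _ (\sum_(k < N)
     ((2 * expR (1 / 16) * expR (- (k%:R ^+ 2 / 32)))%:E * mu B)))%E.
    apply: lee_sum => k _; under eq_integral do rewrite EFinM.
    rewrite ge0_integralZl ?lee_fin ?expR_ge0//; last 2 first.
    * by apply/measurable_EFinP/measurable_funTS; exact: mg.
    * by move=> x _; rewrite lee_fin.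
    apply: (le_trans (lee_wpmul2l _ (subgaussian_sym _ s0 st' tT FB))).
      by rewrite lee_fin expR_ge0.
    rewrite muleA -EFinM lee_wpmul2r// lee_fin -/h.
    rewrite mulrCA -expRD -[in leRHS]mulrA -expRD.
    rewrite le_eqVlt; apply/orP; left; apply/eqP; congr (2 * expR _).
    by rewrite -rh; field; rewrite gt_eqF.
  rewrite -ge0_sume_distrl; last by move=> k _; rewrite lee_fin !mulr_ge0 ?expR_ge0.
  rewrite lee_wpmul2r// sumEFin lee_fin -mulr_sumr /expsq_cst.
  by rewrite ler_wpM2l ?sum_gauss_le// mulr_ge0// expR_ge0.
Unshelve. all: by end_near. Qed.

(** The compensated square of an increment is centered and sub-exponential, so
    its exponential moments near [0] are of second order. *)
Lemma block_exponential s t (a : W -> R) nu B :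
  0 < L -> 0 <= s -> s < t -> t <= T -> F s B ->
  measurable_fun setT a -> {ae mu, forall x, 0 <= a x <= L * (t - s)} ->
  (\int[mu]_(x in B) ((Y t x - Y s x) ^+ 2 - a x)%:E = 0)%E ->
  `|nu| * (L * (t - s)) <= 1 / 64 ->
  (\int[mu]_(x in B) (expR (nu * ((Y t x - Y s x) ^+ 2 - a x)))%:E <=
   (1 + block_cst R * (nu * (L * (t - s))) ^+ 2)%:E * mu B)%E.
Proof.
move=> Lp s0 st tT FB ma ab D0; have mB := fil_meas cF FB; have st' := ltW st.
set h := L * (t - s) in ab * => nuh.
have h0 : 0 < h by rewrite mulr_gt0// subr_gt0.
have FT : F s setT by apply: sub_sigmaT; exact: (fil_sigma cF).
pose e x := expR ((Y t x - Y s x) ^+ 2 / (32 * h)).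
have me : measurable_fun setT e.
  apply: measurableT_comp => //; apply: measurable_funM => //.
  by apply: measurable_funX; exact: mD.
have eB C : F s C -> (\int[mu]_(x in C) (e x)%:E <= (expsq_cst R)%:E * mu C)%E.
  exact: square_exponential.
have Le : L1 mu e.
  apply: (L1_ge0 (c := expsq_cst R)) => //.
    by move=> x; exact: expR_ge0.
  by have := eB _ FT; rewrite probability_setT mule1.
have LY2 : L1 mu (fun x => (Y t x - Y s x) ^+ 2).
  apply: (L1_ge0 (c := L * (t - s))).
  - by apply: measurable_funX; exact: mD.
  - by move=> x; exact: sqr_ge0.
  - by have := cm_square cY s0 st' tT FT; rewrite probability_setT mule1.
have La : L1 mu a.
  apply: (L1_le ma (L1_cst mu h)); apply: filterS ab => x /andP[a0 ah].
  by rewrite ger0_norm.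
have LD : L1 mu (fun x => (Y t x - Y s x) ^+ 2 - a x) by exact: L1B.
pose c := 16 * 64 ^+ 2 * expR (1 / 32) * (nu * h) ^+ 2.
have c0 : 0 <= c by rewrite mulr_ge0 ?sqr_ge0// mulr_ge0 ?expR_ge0.
pose D x := (Y t x - Y s x) ^+ 2 - a x.
have LnD : L1 mu (fun x => 1 + nu * D x).
  by apply: L1D; [exact: L1_cst|exact: L1Z].
have Lb : L1 mu (fun x => (1 + nu * D x) + c * e x).
  by apply: L1D => //; exact: L1Z.
have le_b : {ae mu, forall x, expR (nu * D x) <= (1 + nu * D x) + c * e x}.
  by apply: filterS ab => x ax; exact: expR_block_le.
apply: (@le_trans _ _ (\int[mu]_(x in B) ((1 + nu * D x) + c * e x)%:E)%E).
  apply: L1_int_le => //; apply: (L1_le _ Lb).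
    apply: measurableT_comp => //; apply: measurable_funM => //.
    exact: (L1_measurable LD).
  by apply: filterS le_b => x; rewrite ger0_norm ?expR_ge0.
rewrite intD//; last exact: L1Z.
rewrite (intD (f := cst 1))//; [|exact: L1_cst|exact: L1Z].
rewrite !intZ// D0 mule0 adde0 int_cst// mul1e.
rewrite EFinD ge0_muleDl ?lee_fin//; last first.
  by rewrite mulr_ge0 ?sqr_ge0// ltW// block_cst_gt0.
rewrite mul1e leeD2l//.
apply: (le_trans (lee_wpmul2l _ (eB _ FB))); first by rewrite lee_fin.
rewrite muleA -EFinM lee_wpmul2r// lee_fin /block_cst /c.
by rewrite le_eqVlt; apply/orP; left; apply/eqP; ring.
Qed.

End moments.

(** * Optional stopping *)

Section completeness.
Context d (W : measurableType d) (R : realType) (mu : probability W R).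
Implicit Types (G : set (set W)) (f : W -> R).

(** Since [G] contains the negligible sets, changing the limit on one of them
    does not affect its measurability. *)
Lemma measurable_wrt_ae_lim G (f_ : nat -> W -> R) f :
  sigma_algebra setT G -> (forall N, mu.-negligible N -> G N) ->
  (forall n, measurable_wrt G (f_ n)) ->
  {ae mu, forall x, f_ ^~ x @ \oo --> f x} -> measurable_wrt G f.
Proof.
move=> sG nG wf fx.
pose N := ~` [set x | f_ ^~ x @ \oo --> f x].
have GN : G N by exact: nG.
pose g_ n x := \1_(~` N) x * f_ n x; pose g x := \1_(~` N) x * f x.
have mN : measurable (~` N : set (g_sigma_algebraType G)).
  by apply/(sub_sigma_measurable _ sG); exact: sub_sigmaC.
have mg : measurable_wrt G g.
  apply/(measurable_wrtP _ sG); apply: (@measurable_fun_cvg _ (g_sigma_algebraType G) R setT g_).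
    move=> n; apply: measurable_funM; last exact/(measurable_wrtP _ sG).
    exact: (measurable_indic (T := g_sigma_algebraType G)).
  move=> x _; rewrite /g_ /g indicE; case: (boolP (x \in ~` N)) => xN /=.
    under eq_fun do rewrite mul1r.
    by rewrite mul1r; move: xN; rewrite inE /N setCK.
  by under eq_fun do rewrite mul0r; rewrite mul0r; exact: cvg_cst.
move=> B mB.
rewrite (_ : f @^-1` B = (g @^-1` B `&` ~` N) `|` (f @^-1` B `&` N)).
  apply: sub_sigmaU => //.
    by apply: sub_sigmaI => //; [exact: mg|exact: sub_sigmaC].
  by apply: nG; apply: negligibleS fx => x [].
apply/seteqP; split => x /=.
  move=> fB; have [xN|xN] := pselect (N x); [by right|left; split=> //].
  by rewrite /g indicE mem_set// mul1r.
by move=> [[+ xN]|[]//]; rewrite /g indicE mem_set// mul1r.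
Qed.

Lemma L1_excess f : L1 mu f -> forall e : R, 0 < e -> exists2 k, 0 <= k &
  (\int[mu]_x (excess k (f x))%:E <= e%:E)%E.
Proof.
move=> Lf e e0; have mf := L1_measurable Lf.
have [|||||_ _ cvgI] := dominated_convergence measurableT
  (f_ := fun n x => (excess n%:R (f x))%:E) (f := fun x => 0%E)
  (g := fun x => (`|f x|)%:E) (mu := mu).
- by move=> n; apply/measurable_EFinP; exact: measurable_excess.
- exact: measurable_cst.
- apply: aeW => x _; apply: cvg_near_cst; near=> n.
  congr EFin; rewrite /excess max_r// subr_le0.
  by near: n; exact: nbhs_infty_ger.
- exact: L1_norm.
- apply: aeW => x n _; rewrite lee_fin ger0_norm ?excess_ge0//.
  by rewrite /excess ge_max normr_ge0 andbT gerBl.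
move: cvgI; rewrite integral0 => /fine_cvgP[fn /cvgrPdist_le/(_ _ e0) c].
near \oo => n.
exists n%:R => //.
have fi : (\int[mu]_x (excess n%:R (f x))%:E \is a fin_num)%E by near: n; exact: fn.
rewrite -(fineK fi) lee_fin.
have : `|0 - fine (\int[mu]_x (excess n%:R (f x))%:E)| <= e by near: n; exact: c.
by rewrite sub0r normrN => /ler_normlW.
Unshelve. all: by end_near. Qed.

End completeness.

Section optional_stopping.
Context d (W : measurableType d) (R : realType) (mu : probability W R).
Implicit Types (s t : R) (B : set W).

Record continuous_martingale (F : R -> set (set W)) (T : R) (M : R -> W -> R)
  : Prop := ContinuousMartingale {
  mg_adapted : adapted T F M ;
  mg_cont : {ae mu, forall x, {within `[0, T], continuous (M ^~ x)}} ;
  mg_L1 : forall t, 0 <= t <= T -> L1 mu (M t) ;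
  mg_center : forall s t B, 0 <= s -> s <= t -> t <= T -> F s B ->
    (\int[mu]_(x in B) (M t x - M s x)%:E = 0)%E }.

Variables (F : R -> set (set W)) (T : R) (M : R -> W -> R) (sigma : W -> R).
Hypothesis cF : complete_filtration mu F.
Hypothesis cM : continuous_martingale F T M.
Hypothesis stop : stopping_time T F sigma.

Definition late t : set W := [set x | t < sigma x].

Lemma late_wrt t : 0 <= t <= T -> F t (late t).
Proof.
move=> tT; rewrite (_ : late t = ~` [set x | sigma x <= t]).
  by apply: sub_sigmaC; [exact: (fil_sigma cF)|exact: stop.2].
by apply/seteqP; split => x /=; rewrite /late/= ltNge => /negP.
Qed.

(** [M] stopped at the first point of a grid of [[s, t]] that [sigma] does not
    exceed, minus [M s]. *)
Definition grid_stopped s t n j x : R := \sum_(i < j)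
  \1_(late (grid s t n i)) x * (M (grid s t n i.+1) x - M (grid s t n i) x).

Lemma grid_stopped_cvg s t x : 0 <= s -> s <= t -> t <= T ->
  {within `[0, T], continuous (M ^~ x)} ->
  (fun n => grid_stopped s t n n.+1 x) @ \oo -->
    stopped M sigma t x - stopped M sigma s x.
Proof.
move=> s0 st tT cx; apply/cvgrPdist_lt => e e0.
apply: filterS (grid_osc cx s0 st tT e0) => n osc.
pose u i := grid s t n i.
have key j : (j <= n.+1)%N ->
    if u j < sigma x then grid_stopped s t n j x = M (u j) x - M s x
    else `|M (Num.max s (sigma x)) x - M s x - grid_stopped s t n j x| < e.
  elim: j => [_|j IH jn].
    rewrite /u grid0 /grid_stopped big_ord0 subrr; case: ifPn => //.
    by rewrite -leNgt => h; rewrite max_l// subrr subr0 normr0.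
  move: (IH (ltnW jn)); rewrite /grid_stopped big_ord_recr/= -/(grid_stopped s t n j x).
  rewrite indicE /late -/(u j) -/(u j.+1).
  have uu : u j <= u j.+1 by exact: grid_mono.
  have [jlt|jge] := ltP (u j) (sigma x).
    move=> ->; rewrite mem_set//= mul1r.
    have -> : M (u j) x - M s x + (M (u j.+1) x - M (u j) x) = M (u j.+1) x - M s x.
      by ring.
    case: ifPn => //; rewrite -leNgt => sle.
    have su : s <= u j by have /andP[] := grid_itv (n := n) st (ltnW jn).
    rewrite max_r; last by rewrite (le_trans su)// ltW.
    rewrite opprB addrA subrK.
    by apply: (osc j) => //; [rewrite -/(u j) -/(u j.+1) ltW|rewrite -/(u j) -/(u j.+1) uu lexx].
  rewrite memNset/=; last by apply/negP; rewrite -leNgt.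
  rewrite mul0r addr0.
  by have /negbTE-> : ~~ (u j.+1 < sigma x) by rewrite -leNgt (le_trans jge).
have := key _ (leqnn _); rewrite /u grid_end /stopped.
case: ifPn => [tlt ->|].
  by rewrite !min_l ?subrr ?normr0// ltW// (le_lt_trans st).
rewrite -leNgt => sle; rewrite (min_r sle).
by have [ss|ss] := leP s (sigma x); rewrite ?subrr.
Qed.

(** A subgradient of [excess k]. *)
Definition excess_slope (k y : R) : R := (k < y)%R%:R - (y < - k)%R%:R.

Lemma excess_subgradient k y z : 0 <= k ->
  excess k y + excess_slope k y * (z - y) <= excess k z.
Proof.
move=> k0; rewrite /excess /excess_slope.
have zz := ler_norm z; have := ler_norm (- z); rewrite normrN => nz.
have z0 := normr_ge0 z.
set m := Num.max (`|z| - k) 0.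
have m1 : `|z| - k <= m by rewrite le_max lexx.
have m2 : 0 <= m by rewrite le_max lexx orbT.
have [ky|yk] := ltP k y; have [yn|yn] := ltP y (- k) => /=.
- lra.
- have y0 : 0 <= y by lra.
  by rewrite (ger0_norm y0) max_l; lra.
- have y0 : y <= 0 by lra.
  by rewrite (ler0_norm y0) max_l; lra.
- rewrite max_r; first lra.
  by rewrite subr_le0 ler_norml yn yk.
Qed.

Lemma excess_slope_le1 k y : `|excess_slope k y| <= 1.
Proof.
rewrite /excess_slope; have [h1|h1] := ltP k _; have [h2|h2] := ltP _ (- k) => /=.
- by rewrite subrr normr0.
- by rewrite subr0 normr1.
- by rewrite sub0r normrN normr1.
- by rewrite subr0 normr0.
Qed.

Lemma measurable_excess_slope d' (W' : measurableType d') k :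
  forall f : W' -> R, measurable_fun setT f ->
  measurable_fun setT (fun x => excess_slope k (f x)).
Proof.
move=> f mf.
have mn (b : W' -> bool) : measurable_fun setT b ->
    measurable_fun setT (fun x => (b x)%:R : R).
  by move=> mb; apply: (measurableT_comp (f := fun b : bool => b%:R : R)).
by apply: measurable_funB; apply: mn; exact: measurable_fun_ltr.
Qed.

Let gT s t n i : 0 <= s -> s <= t -> t <= T -> (i <= n.+1)%N ->
  0 <= grid s t n i <= T.
Proof. by move=> *; exact: grid_itvT. Qed.

Let wM s t : 0 <= s -> s <= t -> t <= T -> measurable_wrt (F t) (M s).
Proof.
move=> s0 st tT B mB; apply: (fil_mono cF st).
by apply: (mg_adapted cM) => //; rewrite s0 (le_trans st).
Qed.

Lemma grid_stopped_wrt s t n j : 0 <= s -> s <= t -> t <= T -> (j <= n.+1)%N ->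
  measurable_wrt (F (grid s t n j)) (grid_stopped s t n j).
Proof.
move=> s0 st tT jn; have sG := fil_sigma cF (grid s t n j).
have /andP[_ jT] := gT s0 st tT jn.
have h k : (k <= j)%N -> measurable_fun setT
    (M (grid s t n k) : g_sigma_algebraType (F (grid s t n j)) -> R).
  move=> kj; apply/(measurable_wrtP _ sG); apply: wM => //.
  - by have /andP[] := gT s0 st tT (leq_trans kj jn).
  - exact: grid_mono.
apply/(measurable_wrtP _ sG); apply: measurable_sum => i.
have ij : (i <= j)%N by exact: ltnW.
apply: measurable_funM; last by apply: measurable_funB; exact: h.
apply: (measurable_indic (T := g_sigma_algebraType _)).
apply/(sub_sigma_measurable _ sG).
apply: (fil_mono cF (grid_mono n st ij)); apply: late_wrt.
exact: (gT s0 st tT (leq_trans ij jn)).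
Qed.

Lemma L1_indic_mul C f : measurable C -> L1 mu f -> L1 mu (fun x => \1_C x * f x).
Proof.
move=> mC Lf; apply: (@L1_le _ _ _ _ _ (fun x => `|f x|)).
- apply: measurable_funM; last exact: (L1_measurable Lf).
  exact: measurable_indic.
- exact: L1_norm.
- apply: aeW => x; rewrite normrM indicE; case: (_ \in _).
    by rewrite normr1 mul1r.
  by rewrite normr0 mul0r.
Qed.

Let LdM s t n i : 0 <= s -> s <= t -> t <= T -> (i <= n)%N ->
  L1 mu (fun x => M (grid s t n i.+1) x - M (grid s t n i) x).
Proof.
move=> s0 st tT ile; apply: L1B; apply: (mg_L1 cM); apply: gT => //.
exact: leqW.
Qed.

Let dM0 s t n i B : 0 <= s -> s <= t -> t <= T -> (i <= n)%N ->
  F (grid s t n i) B ->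
  (\int[mu]_(x in B) (M (grid s t n i.+1) x - M (grid s t n i) x)%:E = 0)%E.
Proof.
move=> s0 st tT ile FB; apply: (mg_center cM) => //.
- by have /andP[] := gT s0 st tT (leqW ile).
- exact: grid_mono.
- have : (i.+1 <= n.+1)%N by [].
  by move=> /(gT s0 st tT)/andP[].
Qed.

Lemma grid_stopped_L1 s t n j : 0 <= s -> s <= t -> t <= T -> (j <= n.+1)%N ->
  L1 mu (grid_stopped s t n j).
Proof.
move=> s0 st tT; rewrite /grid_stopped; elim: j => [_|j IH jn].
  by under eq_fun do rewrite big_ord0; exact: L1_cst.
under eq_fun do rewrite big_ord_recr/=.
apply: L1D; first by apply: IH; exact: ltnW.
apply: L1_indic_mul; last exact: LdM.
apply: (fil_meas cF); apply: late_wrt; apply: gT => //; exact: ltnW.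
Qed.

Lemma int_L1_sum (I : Type) (r : seq I) (f : I -> W -> R) B : measurable B ->
  (forall i, L1 mu (f i)) ->
  (\int[mu]_(x in B) (\sum_(i <- r) f i x)%:E =
   \sum_(i <- r) \int[mu]_(x in B) (f i x)%:E)%E.
Proof.
move=> mB Lf; under eq_integral do rewrite -sumEFin.
by rewrite integral_sum// => i; exact: L1_integrable.
Qed.

Lemma grid_stopped_int0 s t n B : 0 <= s -> s <= t -> t <= T -> F s B ->
  (\int[mu]_(x in B) (grid_stopped s t n n.+1 x)%:E = 0)%E.
Proof.
move=> s0 st tT FB; have mB := fil_meas cF FB.
have Fl (i : 'I_n.+1) : F (grid s t n i) (late (grid s t n i)).
  by apply: late_wrt; apply: gT => //; exact: ltnW.
rewrite int_L1_sum//; last first.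
  move=> i; apply: L1_indic_mul; first exact: (fil_meas cF (Fl i)).
  by apply: LdM => //; rewrite -ltnS.
apply: big1 => i _; rewrite integral_indic_mul; apply: dM0 => //.
  by rewrite -ltnS.
apply: sub_sigmaI; [exact: (fil_sigma cF)| |exact: Fl].
apply: (fil_mono cF _ FB).
by have /andP[] := grid_itv (n := n) st (ltnW (ltn_ord i)).
Qed.

(** Stopping on a grid does not increase the expectation of a convex function:
    on the event that the grid point of index [i] is past [sigma], the stopped
    value, hence the slope there, is known at that grid point. *)
Lemma grid_stopped_excess k s t n : 0 <= k -> 0 <= s -> s <= t -> t <= T ->
  (\int[mu]_x (excess k (M s x + grid_stopped s t n n.+1 x)%R)%:E <=
   \int[mu]_x (excess k (M t x))%:E)%E.
Proof.
move=> k0 s0 st tT.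
have [sT tT'] := time_itv s0 st tT.
pose V j x := M s x + grid_stopped s t n j x.
have wV j : (j <= n.+1)%N -> measurable_wrt (F (grid s t n j)) (V j).
  move=> jn; have sG := fil_sigma cF (grid s t n j).
  apply/(measurable_wrtP _ sG); apply: measurable_funD; last first.
    by apply/(measurable_wrtP _ sG); exact: grid_stopped_wrt.
  apply/(measurable_wrtP _ sG); apply: wM => //.
    by have /andP[] := grid_itv (n := n) st jn.
  by have /andP[] := gT s0 st tT jn.
have LV : L1 mu (V n.+1).
  by apply: L1D; [exact: (mg_L1 cM)|exact: grid_stopped_L1].
have mV := L1_measurable LV.
have LMt := mg_L1 cM tT'; have mMt := L1_measurable LMt.
have Lex f : L1 mu f -> L1 mu (fun x => excess k (f x)).
  move=> Lf; apply: (@L1_le _ _ _ _ _ (fun x => `|f x|)).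
  - by apply: measurable_excess; exact: (L1_measurable Lf).
  - exact: L1_norm.
  - apply: aeW => x; rewrite ger0_norm ?excess_ge0//.
    by rewrite /excess ge_max normr_ge0 andbT gerBl.
(* what is missed by stopping is made of the increments after [sigma] *)
have remE x : M t x - V n.+1 x = \sum_(i < n.+1)
    \1_(~` late (grid s t n i)) x * (M (grid s t n i.+1) x - M (grid s t n i) x).
  have : M t x - M s x = \sum_(i < n.+1) (M (grid s t n i.+1) x - M (grid s t n i) x).
    rewrite -(big_mkord xpredT (fun i => M (grid s t n i.+1) x - M (grid s t n i) x)).
    by rewrite telescope_sumr// grid_end grid0.
  rewrite /V opprD addrA => ->; rewrite /grid_stopped -sumrB.
  apply: eq_bigr => i _; rewrite -[X in X - _]mul1r -mulrBl; congr (_ * _).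
  by rewrite !indicE in_setC; case: (_ \in _); rewrite ?subrr ?subr0.
have Vstop (i : 'I_n.+1) x : (~` late (grid s t n i)) x -> V n.+1 x = V i x.
  move=> /negP; rewrite /late/= -leNgt => le_i.
  have : forall j, (i <= j)%N -> (j <= n.+1)%N -> V j x = V i x; last first.
    by apply => //; exact: ltnW.
  elim=> [|j IH]; first by rewrite leqn0 => /eqP->.
  rewrite leq_eqVlt => /orP[/eqP<-//|]; rewrite ltnS => ij jn.
  rewrite /V /grid_stopped big_ord_recr/= indicE memNset; last first.
    apply/negP; rewrite -leNgt (le_trans le_i)//; exact: grid_mono.
  by rewrite mul0r addr0; apply: IH => //; exact: ltnW.
pose q i x := \1_(~` late (grid s t n i)) x * excess_slope k (V i x).
have qE x : excess_slope k (V n.+1 x) * (M t x - V n.+1 x) =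
    \sum_(i < n.+1) q i x * (M (grid s t n i.+1) x - M (grid s t n i) x).
  rewrite remE mulr_sumr; apply: eq_bigr => i _; rewrite /q mulrA; congr (_ * _).
  rewrite indicE; case: (boolP (x \in _)) => xl; rewrite ?mul0r ?mulr0// mulrC.
  by rewrite (@Vstop i x)//; rewrite inE in xl.
have wq i : (i <= n.+1)%N -> measurable_wrt (F (grid s t n i)) (q i).
  move=> ile; have sG := fil_sigma cF (grid s t n i).
  apply/(measurable_wrtP _ sG); apply: measurable_funM.
    apply: (measurable_indic (T := g_sigma_algebraType _)).
    apply/(sub_sigma_measurable _ sG); apply: sub_sigmaC => //.
    by apply: late_wrt; exact: gT.
  apply: (@measurable_excess_slope _ (g_sigma_algebraType _)).
  by apply/(measurable_wrtP _ sG); exact: wV.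
have q1 i x : `|q i x| <= 1.
  rewrite /q normrM -[leRHS]mul1r ler_pM//.
    by rewrite indicE; case: (_ \in _); rewrite ?normr1 ?normr0.
  exact: excess_slope_le1.
have Lq i : (i <= n)%N -> L1 mu (fun x => q i x * (M (grid s t n i.+1) x - M (grid s t n i) x)).
  move=> ile; have Ld := LdM s0 st tT ile.
  apply: (@L1_le _ _ _ _ _ (fun x => `|M (grid s t n i.+1) x - M (grid s t n i) x|)).
  - apply: measurable_funM; last exact: (L1_measurable Ld).
    apply: (@measurable_wrt_fun _ _ _ (F (grid s t n i))); first exact: (fil_meas cF).
    by apply: wq; exact: leqW.
  - exact: L1_norm.
  - by apply: aeW => x; rewrite normrM -[leRHS]mul1r ler_wpM2r.
have int0 : (\int[mu]_x (excess_slope k (V n.+1 x) * (M t x - V n.+1 x))%:E = 0)%E.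
  under eq_integral do rewrite qE.
  rewrite int_L1_sum//; last by move=> i; apply: Lq; rewrite -ltnS.
  apply: big1 => i _; have ile : (i <= n)%N by rewrite -ltnS.
  apply: (@int_weight_eq0 _ _ _ mu (F (grid s t n i))).
  - exact: (fil_sigma cF).
  - exact: (fil_meas cF).
  - by apply: sub_sigmaT; exact: (fil_sigma cF).
  - by apply: wq; exact: leqW.
  - exact: LdM.
  - exact: Lq.
  - by move=> C FC; exact: dM0.
have Ls : L1 mu (fun x => excess_slope k (V n.+1 x) * (M t x - V n.+1 x)).
  have Ld : L1 mu (fun x => M t x - V n.+1 x) by exact: L1B.
  apply: (@L1_le _ _ _ _ _ (fun x => `|M t x - V n.+1 x|)).
  - apply: measurable_funM; last exact: (L1_measurable Ld).
    exact: measurable_excess_slope.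
  - exact: L1_norm.
  - by apply: aeW => x; rewrite normrM -[leRHS]mul1r ler_wpM2r// excess_slope_le1.
have := intD measurableT (Lex _ LV) Ls.
rewrite int0 adde0 => <-.
apply: le_integral => //.
- by apply: L1D => //; exact: Lex.
- exact: Lex.
- by move=> x _; rewrite lee_fin; exact: excess_subgradient.
Qed.

(** The grid-stopped values are bounded, in the sense of [grid_stopped_excess],
    by the terminal value [M t], which is integrable. *)
Lemma grid_stopped_UI s t (e : R) : 0 <= s -> s <= t -> t <= T -> 0 < e ->
  exists2 k, 0 <= k & forall n,
    (\int[mu]_x (excess k (grid_stopped s t n n.+1 x))%:E <= e%:E)%E.
Proof.
move=> s0 st tT e0.
have [sT tT'] := time_itv s0 st tT.
have e20 : 0 < e / 2 by rewrite divr_gt0.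
have [k1 k10 h1] := L1_excess (mg_L1 cM tT') e20.
have [k2 k20 h2] := L1_excess (mg_L1 cM sT) e20.
exists (k1 + k2); first by rewrite addr_ge0.
move=> n; rewrite (splitr e) EFinD.
have LV : L1 mu (fun x => M s x + grid_stopped s t n n.+1 x).
  by apply: L1D; [exact: (mg_L1 cM)|exact: grid_stopped_L1].
apply: le_trans (leeD (le_trans (grid_stopped_excess n k10 s0 st tT) h1) h2).
rewrite -ge0_integralD//.
- apply: ge0_le_integral => //.
  + by move=> x _; rewrite lee_fin excess_ge0.
  + apply/measurable_EFinP/measurable_excess.
    by apply: (L1_measurable (mu := mu)); exact: grid_stopped_L1.
  + apply: emeasurable_funD; apply/measurable_EFinP/measurable_excess.
      exact: (L1_measurable LV).
    by apply: (L1_measurable (mu := mu)); exact: (mg_L1 cM).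
  + move=> x _; rewrite -EFinD lee_fin {1}/excess ge_max addr_ge0 ?excess_ge0// andbT.
    set a := M s x; set b := grid_stopped _ _ _ _ _.
    have : `|a + b| - k1 <= excess k1 (a + b) by rewrite /excess le_max lexx.
    have : `|a| - k2 <= excess k2 a by rewrite /excess le_max lexx.
    have : `|b| <= `|a + b| + `|a|.
      by rewrite -{1}(addKr a b) addrC ler_normB.
    by lra.
- by move=> x _; rewrite lee_fin excess_ge0.
- by apply/measurable_EFinP/measurable_excess; exact: (L1_measurable LV).
- by move=> x _; rewrite lee_fin excess_ge0.
- apply/measurable_EFinP/measurable_excess.
  by apply: (L1_measurable (mu := mu)); exact: (mg_L1 cM).
Qed.

Let stopped0 x : stopped M sigma 0 x = M 0 x.
Proof. by rewrite /stopped min_l//; have /andP[] := stop.1 x. Qed.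

Lemma stopped_adapted : adapted T F (stopped M sigma).
Proof.
move=> t tT; have /andP[t0 tT'] := tT; have sG := fil_sigma cF t.
have wU : measurable_wrt (F t) (fun x => stopped M sigma t x - stopped M sigma 0 x).
  apply: (measurable_wrt_ae_lim (f_ := fun n => grid_stopped 0 t n n.+1) sG).
  - exact: (fil_null cF).
  - move=> n; rewrite -[X in F X](grid_end 0 t n).
    exact: grid_stopped_wrt.
  - by apply: filterS (mg_cont cM) => x; exact: grid_stopped_cvg.
rewrite (_ : stopped M sigma t = fun x => M 0 x + (stopped M sigma t x - stopped M sigma 0 x)).
  apply/(measurable_wrtP _ sG); apply: measurable_funD.
    by apply/(measurable_wrtP _ sG); exact: wM.
  exact/(measurable_wrtP _ sG).
by apply/funext => x; rewrite stopped0 addrC subrK.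
Qed.

Let mstop t : 0 <= t <= T -> measurable_fun setT (stopped M sigma t).
Proof. by move=> tT; exact: (measurable_wrt_fun (fil_meas cF (t:=t)) (stopped_adapted tT)). Qed.

(** Optional stopping for a martingale with continuous paths. *)
Lemma stopped_martingale : continuous_martingale F T (stopped M sigma).
Proof.
have dL s t : 0 <= s -> s <= t -> t <= T ->
    L1 mu (fun x => stopped M sigma t x - stopped M sigma s x) /\
    forall B, F s B ->
    (\int[mu]_(x in B) (stopped M sigma t x - stopped M sigma s x)%:E = 0)%E.
  move=> s0 st tT.
  have [sT tT'] := time_itv s0 st tT.
  have mU_ n : measurable_fun setT (grid_stopped s t n n.+1).
    by apply: (L1_measurable (mu := mu)); exact: grid_stopped_L1.
  have mU : measurable_fun setT (fun x => stopped M sigma t x - stopped M sigma s x).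
    by apply: measurable_funB; exact: mstop.
  have cU : {ae mu, forall x, (fun n => grid_stopped s t n n.+1 x) @ \oo -->
      stopped M sigma t x - stopped M sigma s x}.
    by apply: filterS (mg_cont cM) => x; exact: grid_stopped_cvg.
  have UI e (e0 : 0 < e) := grid_stopped_UI s0 st tT e0.
  split; first exact: (vitali_L1 mU_ mU cU UI).
  move=> B FB; apply: (vitali_int0 mU_ mU cU UI (fil_meas cF FB)) => n.
  exact: grid_stopped_int0.
split.
- exact: stopped_adapted.
- apply: filterS (mg_cont cM) => x cx.
  by apply: within_continuous_min cx; have /andP[] := stop.1 x.
- move=> t tT; have /andP[t0 tT'] := tT.
  rewrite (_ : stopped M sigma t = fun x => M 0 x + (stopped M sigma t x - stopped M sigma 0 x)).
    apply: L1D; first by apply: (mg_L1 cM); rewrite lexx (le_trans t0).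
    exact: (dL 0 t _ _ _).1.
  by apply/funext => x; rewrite stopped0 addrC subrK.
- by move=> s t B s0 st tT; apply: (dL s t _ _ _).2.
Qed.

End optional_stopping.

(** * Localization of the bracket *)

(** A bound in square mean gives uniform integrability, since
    [`|u| - k <= u ^+ 2 / k]. *)
Section vitali_square.
Context d (W : measurableType d) (R : realType) (mu : probability W R).
Variables (U_ : nat -> W -> R) (U : W -> R) (K : R).
Hypothesis mU_ : forall n, measurable_fun setT (U_ n).
Hypothesis mU : measurable_fun setT U.
Hypothesis U_U : {ae mu, forall x, U_ ^~ x @ \oo --> U x}.
Hypothesis K0 : 0 <= K.
Hypothesis UK : forall n, (\int[mu]_x ((U_ n x) ^+ 2)%:E <= K%:E)%E.

Let UI : forall e : R, 0 < e -> exists2 k, 0 <= k &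
  forall n, (\int[mu]_x (excess k (U_ n x))%:E <= e%:E)%E.
Proof.
(* the summand [1] keeps [k] positive when [K] is [0] *)
move=> e e0; pose k := K / e + 1.
have k0 : 0 < k by rewrite ltr_wpDl// divr_ge0// ltW.
exists k; first exact: ltW.
move=> n; apply: (@le_trans _ _ (\int[mu]_x (k^-1 * (U_ n x) ^+ 2)%:E)%E).
  apply: ae_int_le => //.
  - exact: measurable_excess.
  - by apply: measurable_funM => //; exact: measurable_funX.
  - by move=> x; exact: excess_ge0.
  - by move=> x; rewrite mulr_ge0 ?sqr_ge0// invr_ge0 ltW.
  - apply: aeW => x; set u := U_ n x.
    rewrite /excess ge_max mulr_ge0 ?sqr_ge0 ?invr_ge0 ?(ltW k0)// andbT.
    rewrite -[u ^+ 2]real_normK ?num_real// mulrC ler_pdivlMr//.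
    by have := sqr_ge0 (`|u| - k); have := sqr_ge0 k; nra.
under eq_integral do rewrite EFinM.
rewrite ge0_integralZl//.
- apply: (le_trans (lee_wpmul2l _ (UK n))); first by rewrite lee_fin invr_ge0 ltW.
  rewrite -EFinM lee_fin mulrC ler_pdivrMr// /k mulrDr mulr1 mulrC divfK ?gt_eqF//.
  by rewrite lerDl ltW.
- by apply/measurable_EFinP; exact: measurable_funX.
- by move=> x _; rewrite lee_fin sqr_ge0.
- by rewrite lee_fin invr_ge0 ltW.
Qed.

Lemma vitali2_L1 : L1 mu U.
Proof. exact: (vitali_L1 mU_ mU U_U UI). Qed.

Lemma vitali2_int0 B : measurable B ->
  (forall n, \int[mu]_(x in B) (U_ n x)%:E = 0)%E ->
  (\int[mu]_(x in B) (U x)%:E = 0)%E.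
Proof. exact: (vitali_int0 mU_ mU U_U UI). Qed.

End vitali_square.

Section localized_bracket.
Context d (W : measurableType d) (R : realType) (mu : probability W R).
Variables (F : R -> set (set W)) (T L : R) (X A : R -> W -> R) (rho : W -> R).
Hypothesis cF : complete_filtration mu F.
Hypothesis L0 : 0 <= L.
Hypothesis X0 : forall x, X 0 x = 0.
Hypothesis A_lip : {ae mu, forall x s t, 0 <= s -> s <= t -> t <= T ->
  0 <= A t x - A s x <= L * (t - s)}.
Hypothesis rhoT : forall x, 0 <= rho x <= T.
Implicit Types (s t : R) (B : set W).

Let N t x := (X t x) ^+ 2 - (X 0 x) ^+ 2 - A t x.
Let Xr t x := stopped X rho t x - X 0 x.
Let Nr t x := stopped N rho t x - N 0 x.
Let Ar t x := stopped A rho t x - A 0 x.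
Hypothesis mgX : continuous_martingale mu F T Xr.
Hypothesis mgN : continuous_martingale mu F T Nr.

Let NrE t x : Nr t x = Xr t x ^+ 2 - Ar t x.
Proof. by rewrite /Nr /Xr /Ar /N /stopped X0; ring. Qed.

Lemma stopped_lip : {ae mu, forall x s t, 0 <= s -> s <= t -> t <= T ->
  0 <= Ar t x - Ar s x <= L * (t - s)}.
Proof.
apply: filterS A_lip => x Ax s t s0 st tT; have /andP[r0 rT] := rhoT x.
rewrite /Ar /stopped opprB addrA subrK.
have m0 : 0 <= Num.min s (rho x) by rewrite le_min s0.
have ms : Num.min s (rho x) <= Num.min t (rho x).
  by rewrite le_min !ge_min st lexx orbT.
have mt : Num.min t (rho x) <= T by rewrite ge_min tT.
have /andP[h1 h2] := Ax _ _ m0 ms mt.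
rewrite h1 (le_trans h2)// ler_wpM2l//.
by rewrite /Num.min; case: ltP => ?; case: ltP => ?; lra.
Qed.

Let Ar0 x : Ar 0 x = 0.
Proof. by rewrite /Ar /stopped min_l ?subrr//; have /andP[] := rhoT x. Qed.

Let mAr t : 0 <= t <= T -> measurable_fun setT (Ar t).
Proof.
move=> tT; rewrite (_ : Ar t = fun x => Xr t x ^+ 2 - Nr t x).
  apply: measurable_funB; last exact: (L1_measurable (mg_L1 mgN tT)).
  by apply: measurable_funX; exact: (L1_measurable (mg_L1 mgX tT)).
by apply/funext => x; rewrite NrE; ring.
Qed.

Let LAr t : 0 <= t <= T -> L1 mu (Ar t).
Proof.
move=> tT; apply: (L1_le (mAr tT) (L1_cst mu (L * (t - 0)))).
have /andP[t0 tT'] := tT.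
apply: filterS stopped_lip => x /(_ _ _ (lexx 0) t0 tT').
by rewrite Ar0 subr0 => /andP[h1 h2]; rewrite ger0_norm.
Qed.

Lemma stopped_square_L1 t : 0 <= t <= T -> L1 mu (fun x => Xr t x ^+ 2).
Proof.
move=> tT; rewrite (_ : (fun _ => _) = Nr t \+ Ar t).
  by apply: L1D; [exact: (mg_L1 mgN)|exact: LAr].
by apply/funext => x /=; rewrite NrE; ring.
Qed.

Let dX2 s t : 0 <= s -> s <= t -> t <= T ->
  L1 mu (fun x => Xr s x * (Xr t x - Xr s x)) /\
  L1 mu (fun x => (Xr t x - Xr s x) ^+ 2).
Proof.
move=> s0 st tT.
have [sT tT'] := time_itv s0 st tT.
have mXs := L1_measurable (mg_L1 mgX sT); have mXt := L1_measurable (mg_L1 mgX tT').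
have Lb : L1 mu (fun x => 3 * (Xr s x ^+ 2 + Xr t x ^+ 2)).
  by apply: L1Z; apply: L1D; exact: stopped_square_L1.
split.
- apply: (L1_le _ Lb).
    by apply: measurable_funM => //; exact: measurable_funB.
  apply: aeW => x; set a := Xr s x; set b := Xr t x.
  by rewrite ler_norml; apply/andP; split; have := sqr_ge0 (a - b); have := sqr_ge0 (a + b); have := sqr_ge0 a; have := sqr_ge0 b; nra.
- apply: (L1_le _ Lb).
    by apply: measurable_funX => //; exact: measurable_funB.
  apply: aeW => x; set a := Xr s x; set b := Xr t x.
  rewrite ger0_norm ?sqr_ge0//.
  by have := sqr_ge0 (a + b); have := sqr_ge0 a; have := sqr_ge0 b; nra.
Qed.

(** The square of an increment is the increment of the square up to a product
    with a past value; the stopped square is integrable because the stopped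
    bracket is bounded. *)
Lemma stopped_bracket_int0 s t B : 0 <= s -> s <= t -> t <= T -> F s B ->
  (\int[mu]_(x in B) ((Xr t x - Xr s x) ^+ 2 - (Ar t x - Ar s x))%:E = 0)%E.
Proof.
move=> s0 st tT FB; have mB := fil_meas cF FB.
have [sT tT'] := time_itv s0 st tT.
have [Lp _] := dX2 s0 st tT.
rewrite (_ : (\int[mu]_(x in B) _)%E =
   \int[mu]_(x in B) ((Nr t x - Nr s x) + (- 2) * (Xr s x * (Xr t x - Xr s x)))%:E)%E; last first.
  by apply: eq_integral => x _; congr EFin; rewrite !NrE; ring.
rewrite intD//; last 2 first.
- by apply: L1B; exact: (mg_L1 mgN).
- exact: L1Z.
rewrite (mg_center mgN)// add0e intZ//.
rewrite (@int_weight_eq0 _ _ _ mu (F s) B (Xr s) (fun x => Xr t x - Xr s x)) ?mule0//.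
- exact: (fil_sigma cF).
- exact: (fil_meas cF).
- exact: (mg_adapted mgX).
- by apply: L1B; exact: (mg_L1 mgX).
- by move=> C FC; exact: (mg_center mgX).
Qed.

Lemma stopped_controlled : controlled_martingale mu F T L Xr.
Proof.
split.
- exact: (mg_adapted mgX).
- exact: (mg_cont mgX).
- exact: (mg_L1 mgX).
- exact: (mg_center mgX).
move=> s t B s0 st tT FB; have mB := fil_meas cF FB.
have [sT tT'] := time_itv s0 st tT.
have [_ L2] := dX2 s0 st tT.
have LA : L1 mu (fun x => Ar t x - Ar s x) by apply: L1B; exact: LAr.
have := stopped_bracket_int0 s0 st tT FB.
have fA : (\int[mu]_(x in B) (Ar t x - Ar s x)%:E \is a fin_num)%E.
  exact/integrable_fin_num/L1_integrable.
rewrite (intB (f := fun x => (Xr t x - Xr s x) ^+ 2))// => /eqP.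
rewrite sube_eq ?add0e ?fin_num_adde_defl// => [/eqP->|]; last first.
  exact/integrable_fin_num/L1_integrable.
rewrite -int_cst//.
apply: L1_int_le => //; first exact: L1_cst.
by apply: filterS stopped_lip => x /(_ _ _ s0 st tT)/andP[].
Qed.

End localized_bracket.

Section delocalization.
Context d (W : measurableType d) (R : realType) (mu : probability W R).
Variables (F : R -> set (set W)) (T L : R) (X A : R -> W -> R).
Variable rho : nat -> W -> R.
Hypothesis cF : complete_filtration mu F.
Hypothesis L0 : 0 <= L.
Hypothesis T0 : 0 <= T.
Hypothesis X0 : forall x, X 0 x = 0.
Hypothesis adX : adapted T F X.
Hypothesis adA : adapted T F A.
Hypothesis contX : {ae mu, forall x, {within `[0, T], continuous (X ^~ x)}}.
Hypothesis A_lip : {ae mu, forall x s t, 0 <= s -> s <= t -> t <= T ->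
  0 <= A t x - A s x <= L * (t - s)}.
Hypothesis rhoT : forall n x, 0 <= rho n x <= T.
Hypothesis rho_T : {ae mu, forall x, \forall n \near \oo, rho n x = T}.
Implicit Types (s t : R) (B : set W).

Let N t x := (X t x) ^+ 2 - (X 0 x) ^+ 2 - A t x.
Hypothesis mgX : forall n,
  continuous_martingale mu F T (fun t x => stopped X (rho n) t x - X 0 x).
Hypothesis mgN : forall n,
  continuous_martingale mu F T (fun t x => stopped N (rho n) t x - N 0 x).

Let Xr n t x := stopped X (rho n) t x - X 0 x.
Let Ar n t x := stopped A (rho n) t x - A 0 x.

Let cXr n := stopped_controlled cF L0 X0 A_lip (rhoT n) (mgX n) (mgN n).
Let lipAr n := stopped_lip L0 A_lip (rhoT n).

Let mX t : 0 <= t <= T -> measurable_fun setT (X t).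
Proof. by move=> tT; exact: (measurable_wrt_fun (fil_meas cF (t:=t)) (adX tT)). Qed.

Let mA t : 0 <= t <= T -> measurable_fun setT (A t).
Proof. by move=> tT; exact: (measurable_wrt_fun (fil_meas cF (t:=t)) (adA tT)). Qed.

Let mdX s t : 0 <= s -> s <= t -> t <= T -> measurable_fun setT (fun x => X t x - X s x).
Proof. by move=> s0 st tT'; apply: measurable_funB; apply: mX; have [] := time_itv s0 st tT'. Qed.

Let mdA s t : 0 <= s -> s <= t -> t <= T -> measurable_fun setT (fun x => A t x - A s x).
Proof. by move=> s0 st tT'; apply: measurable_funB; apply: mA; have [] := time_itv s0 st tT'. Qed.

Let mdXr n s t : 0 <= s -> s <= t -> t <= T ->
  measurable_fun setT (fun x => Xr n t x - Xr n s x).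
Proof.
move=> s0 st tT'; have [? ?] := time_itv s0 st tT'.
by apply: measurable_funB; apply: L1_measurable (cm_L1 (cXr n) _).
Qed.

Let Xr_lim s t : 0 <= s -> s <= t -> t <= T -> {ae mu, forall x,
  \forall n \near \oo, Xr n t x - Xr n s x = X t x - X s x}.
Proof.
move=> s0 st tT'; apply: filterS rho_T => x; apply: filterS => n rn.
rewrite /Xr /stopped rn !min_l//; last exact: le_trans tT'.
by rewrite opprB addrA subrK.
Qed.

Let Ar_lim s t : 0 <= s -> s <= t -> t <= T -> {ae mu, forall x,
  \forall n \near \oo, Ar n t x - Ar n s x = A t x - A s x}.
Proof.
move=> s0 st tT'; apply: filterS rho_T => x; apply: filterS => n rn.
rewrite /Ar /stopped rn !min_l//; last exact: le_trans tT'.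
by rewrite opprB addrA subrK.
Qed.

Let sq_bound n s t : 0 <= s -> s <= t -> t <= T ->
  (\int[mu]_x ((Xr n t x - Xr n s x) ^+ 2)%:E <= (L * (t - s))%:E)%E.
Proof.
move=> s0 st tT'.
have FT : F s setT by apply: sub_sigmaT; exact: (fil_sigma cF).
by have := cm_square (cXr n) s0 st tT' FT; rewrite probability_setT mule1.
Qed.

(** Increments of the stopped processes are bounded in square mean, so their
    centering passes to the limit. *)
Lemma localized_controlled : controlled_martingale mu F T L X.
Proof.
have dL s t : 0 <= s -> s <= t -> t <= T ->
    L1 mu (fun x => X t x - X s x) /\
    forall B, F s B -> (\int[mu]_(x in B) (X t x - X s x)%:E = 0)%E.
  move=> s0 st tT'.
  have cU : {ae mu, forall x, (fun n => Xr n t x - Xr n s x) @ \oo --> X t x - X s x}.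
    by apply: filterS (Xr_lim s0 st tT') => x; exact: cvg_near_cst.
  have K0 : 0 <= L * (t - s) by rewrite mulr_ge0// subr_ge0.
  have m_ n := mdXr n s0 st tT'.
  have m := mdX s0 st tT'.
  split; first exact: (vitali2_L1 m_ m cU K0 (fun n => sq_bound n s0 st tT')).
  move=> B FB.
  apply: (vitali2_int0 m_ m cU K0 (fun n => sq_bound n s0 st tT') (fil_meas cF FB)).
  by move=> n; exact: (cm_center (cXr n)).
split=> //.
- move=> t tT'; have /andP[t0 tleT] := tT'.
  rewrite (_ : X t = fun x => X t x - X 0 x); first exact: (dL 0 t _ _ _).1.
  by apply/funext => x; rewrite X0 subr0.
- by move=> s t B s0 st tT'; exact: (dL s t _ _ _).2.
- move=> s t B s0 st tT' FB.
  apply: (@fatou_bound _ _ _ mu B (fun n x => (Xr n t x - Xr n s x) ^+ 2)).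
  + exact: (fil_meas cF FB).
  + by move=> n; apply: measurable_funX; exact: mdXr.
  + by apply: measurable_funX; exact: mdX.
  + by move=> n x; exact: sqr_ge0.
  + by move=> x; exact: sqr_ge0.
  + apply: filterS (Xr_lim s0 st tT') => x xE e e0; apply: filterS xE => n ->.
    by rewrite lerDl ltW.
  + by move=> n; exact: (cm_square (cXr n)).
Qed.

(** The stopped squares are bounded in square mean by [fourth_moment]; this is
    where sub-Gaussianity of the stopped processes is used. *)
Lemma localized_bracket s t B : 0 <= s -> s <= t -> t <= T -> F s B ->
  (\int[mu]_(x in B) ((X t x - X s x) ^+ 2 - (A t x - A s x))%:E = 0)%E.
Proof.
move=> s0 st tT' FB.
pose U_ n x := (Xr n t x - Xr n s x) ^+ 2 - (Ar n t x - Ar n s x).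
have mdAr n : measurable_fun setT (fun x => Ar n t x - Ar n s x).
  have E u x : Ar n u x = Xr n u x ^+ 2 - (stopped N (rho n) u x - N 0 x).
    by rewrite /Ar /Xr /stopped /N !X0; ring.
  have m u : 0 <= u <= T -> measurable_fun setT (Ar n u).
    move=> uT; rewrite (_ : Ar n u = fun x => Xr n u x ^+ 2 - (stopped N (rho n) u x - N 0 x)).
      apply: measurable_funB; last exact: L1_measurable (mg_L1 (mgN n) uT).
      by apply: measurable_funX; exact: L1_measurable (mg_L1 (mgX n) uT).
    by apply/funext => x; exact: E.
  by apply: measurable_funB; apply: m; have [] := time_itv s0 st tT'.
have mU_ n : measurable_fun setT (U_ n).
  apply: measurable_funB => //; apply: measurable_funX; exact: mdXr.
pose K := 2 * (4 ^+ 4 * (2 * expR (2 * L * T))) + 2 * (L * (t - s)) ^+ 2.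
have K0 : 0 <= K.
  by rewrite addr_ge0// mulr_ge0 ?sqr_ge0// mulr_ge0// mulr_ge0 ?expR_ge0.
apply: (vitali2_int0 (U_ := U_) (K := K)) => //.
- by apply: measurable_funB; [apply: measurable_funX; exact: mdX|exact: mdA].
- have h1 := Xr_lim s0 st tT'; have h2 := Ar_lim s0 st tT'.
  apply: filterS2 h1 h2 => x h1 h2; apply: cvg_near_cst.
  by apply: filterS2 h1 h2 => n; rewrite /U_ => -> ->.
- move=> n.
  apply: (@le_trans _ _ (\int[mu]_x (2 * (Xr n t x - Xr n s x) ^+ 4 +
     2 * (L * (t - s)) ^+ 2)%:E)%E).
    apply: ae_int_le => //.
    + exact: measurable_funX.
    + by apply: measurable_funD => //; apply: measurable_funM => //; apply: measurable_funX; exact: mdXr.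
    + by move=> x; exact: sqr_ge0.
    + move=> x; apply: addr_ge0; first by rewrite mulr_ge0// exprn_even_ge0.
      by rewrite mulr_ge0// sqr_ge0.
    + apply: filterS (lipAr n) => x /(_ _ _ s0 st tT'); rewrite -/(Ar n t x) -/(Ar n s x) /U_.
      set a := (Xr n t x - Xr n s x) ^+ 2; set b := Ar n t x - Ar n s x => /andP[b0 bL].
      have -> : (Xr n t x - Xr n s x) ^+ 4 = a ^+ 2 by rewrite /a -exprM.
      have bb : b ^+ 2 <= (L * (t - s)) ^+ 2 by rewrite lerXn2r ?nnegrE// (le_trans b0).
      by have := sqr_ge0 (a + b); nra.
  under eq_integral do rewrite EFinD.
  rewrite ge0_integralD//.
  + rewrite /K EFinD; apply: leeD; last first.
      by rewrite int_cstT.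
    under eq_integral do rewrite EFinM.
    rewrite ge0_integralZl//.
    * rewrite [leRHS]EFinM lee_wpmul2l ?lee_fin//.
      exact: (fourth_moment cF L0 (cXr n)).
    * by apply/measurable_EFinP; apply: measurable_funX; exact: mdXr.
    * by move=> x _; rewrite lee_fin exprn_even_ge0.
  + by move=> x _; rewrite lee_fin mulr_ge0// exprn_even_ge0.
  + by apply/measurable_EFinP; apply: measurable_funM => //; apply: measurable_funX; exact: mdXr.
  + by move=> x _; rewrite lee_fin mulr_ge0 ?sqr_ge0.
- exact: (fil_meas cF FB).
- by move=> n; exact: (stopped_bracket_int0 cF L0 X0 A_lip (rhoT n) (mgX n) (mgN n)).
Qed.

End delocalization.

(** * Uniqueness of the bracket *)

Section hyperbola.
Context (R : realType).
Implicit Types v w : R.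

(** A convex function with bounded slope, equivalent to a square near [0]. *)
Definition hyp v : R := Num.sqrt (1 + v ^+ 2).

Lemma hyp_sqr v : hyp v ^+ 2 = 1 + v ^+ 2.
Proof. by rewrite sqr_sqrtr// addr_ge0// sqr_ge0. Qed.

Lemma hyp_ge1 v : 1 <= hyp v.
Proof. by rewrite -[leLHS]sqrtr1 ler_sqrt ?lerDl ?sqr_ge0// addr_ge0// sqr_ge0. Qed.

Definition hyp_slope v : R := v / hyp v.

Lemma hyp_slope_le1 v : `|hyp_slope v| <= 1.
Proof.
have h1 := hyp_ge1 v; have h0 : 0 < hyp v by lra.
rewrite normrM normfV (gtr0_norm h0) ler_pdivrMr// mul1r.
rewrite -(@ler_pXn2r _ 2)// ?nnegrE ?(ltW h0)// hyp_sqr real_normK ?num_real//.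
by rewrite lerDr.
Qed.

Lemma hyp_taylor v w :
  hyp w - hyp v - hyp_slope v * (w - v) <= (w - v) ^+ 2 / 2.
Proof.
have h1 := hyp_ge1 v; have h0 : 0 < hyp v by lra.
set z := w - v.
have pos : 0 <= hyp v + hyp_slope v * z + z ^+ 2 / 2.
  have : 0 <= (hyp_slope v + z) ^+ 2 / 2 by rewrite divr_ge0// sqr_ge0.
  have : hyp_slope v ^+ 2 <= 1.
    by rewrite -[hyp_slope v ^+ 2]real_normK ?num_real// expr_le1// hyp_slope_le1.
  by have := sqr_ge0 z; nra.
suff : hyp w <= hyp v + hyp_slope v * z + z ^+ 2 / 2 by lra.
rewrite -(@ler_pXn2r _ 2)// ?nnegrE//; last by have := hyp_ge1 w; lra.
rewrite hyp_sqr.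
have -> : w = v + z by rewrite /z addrC subrK.
have vh : hyp_slope v * hyp v = v by rewrite /hyp_slope divfK ?gt_eqF.
have : 0 <= (hyp_slope v * z + z ^+ 2 / 2) ^+ 2 by exact: sqr_ge0.
have : 0 <= (hyp v - 1) * z ^+ 2 by rewrite mulr_ge0 ?sqr_ge0//; lra.
have hs := hyp_sqr v.
have -> : 1 + (v + z) ^+ 2 = hyp v ^+ 2 + 2 * (hyp_slope v * hyp v) * z + z ^+ 2.
  by rewrite hs vh; ring.
set h := hyp v; set s := hyp_slope v => e1 e2.
have -> : (h + s * z + z ^+ 2 / 2) ^+ 2 = h ^+ 2 + 2 * (s * h) * z +
   h * z ^+ 2 + (s * z + z ^+ 2 / 2) ^+ 2 by field.
by lra.
Qed.

Lemma hyp_lip v w :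
  hyp w - hyp v - hyp_slope v * (w - v) <= 2 * `|w - v|.
Proof.
have : hyp w - hyp v <= `|w - v|.
  suff : hyp w <= hyp v + `|w - v| by lra.
  have h1 := hyp_ge1 v; have z0 := normr_ge0 (w - v).
  rewrite -(@ler_pXn2r _ 2)// ?nnegrE//; last 2 first.
  - by have := hyp_ge1 w; lra.
  - by lra.
  have -> : (hyp v + `|w - v|) ^+ 2 = hyp v ^+ 2 + 2 * hyp v * `|w - v| + `|w - v| ^+ 2.
    by ring.
  rewrite !hyp_sqr real_normK ?num_real//.
  have vh : `|v| <= hyp v.
    rewrite -(@ler_pXn2r _ 2)// ?nnegrE//; last by lra.
    by rewrite hyp_sqr real_normK ?num_real// lerDr.
  have : v * (w - v) <= hyp v * `|w - v|.
    by rewrite (le_trans (ler_norm _))// normrM ler_wpM2r.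
  by rewrite sqrrB; lra.
have : - (hyp_slope v * (w - v)) <= `|w - v|.
  rewrite (le_trans (ler_norm _))// normrN normrM -[leRHS]mul1r ler_wpM2r//.
  exact: hyp_slope_le1.
by lra.
Qed.

Lemma continuous_hyp : continuous hyp.
Proof.
move=> v; apply: (@continuous_comp _ _ _ (fun v => 1 + v ^+ 2) Num.sqrt).
  by apply: cvgD; [exact: cvg_cst|exact: exprn_continuous].
exact: sqrt_continuous.
Qed.

Lemma continuous_hyp_slope : continuous hyp_slope.
Proof.
move=> v; apply: cvgM; first exact: cvg_id.
apply: cvgV; last exact: continuous_hyp.
by rewrite gt_eqF//; have := hyp_ge1 v; lra.
Qed.

Lemma measurable_hyp d' (W' : measurableType d') (f : W' -> R) :
  measurable_fun setT f -> measurable_fun setT (fun x => hyp (f x)).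
Proof.
move=> mf; apply: (measurableT_comp (f := hyp)) => //.
by apply: continuous_measurable_fun; exact: continuous_hyp.
Qed.

Lemma measurable_hyp_slope d' (W' : measurableType d') (f : W' -> R) :
  measurable_fun setT f -> measurable_fun setT (fun x => hyp_slope (f x)).
Proof.
move=> mf; apply: (measurableT_comp (f := hyp_slope)) => //.
by apply: continuous_measurable_fun; exact: continuous_hyp_slope.
Qed.

End hyperbola.

Section bounded_variation_martingale.
Context d (W : measurableType d) (R : realType) (mu : probability W R).
Variables (F : R -> set (set W)) (T : R) (V : R -> W -> R) (t : R) (G : W -> R).
Hypothesis cF : complete_filtration mu F.
Hypothesis cV : continuous_martingale mu F T V.
Hypothesis V0 : forall x, V 0 x = 0.
Hypothesis tT : 0 <= t <= T.
Hypothesis LG : L1 mu G.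
Let u n i := grid 0 t n i.
Hypothesis VG : {ae mu, forall x n,
  \sum_(i < n.+1) `|V (u n i.+1) x - V (u n i) x| <= G x}.

Let t0 : 0 <= t. Proof. by have /andP[] := tT. Qed.
Let tle : t <= T. Proof. by have /andP[] := tT. Qed.

Let uT n i : (i <= n.+1)%N -> 0 <= u n i <= T.
Proof. by move=> ile; exact: grid_itvT. Qed.

Let dV n i x := V (u n i.+1) x - V (u n i) x.

Let LdV n i : (i <= n)%N -> L1 mu (dV n i).
Proof. by move=> ile; apply: L1B; apply: (mg_L1 cV); apply: uT => //; exact: leqW. Qed.

Let wV n i : (i <= n.+1)%N -> measurable_wrt (F (u n i)) (V (u n i)).
Proof. by move=> ile; apply: (mg_adapted cV); exact: uT. Qed.

Let rem n x := \sum_(i < n.+1) Num.min (2 * `|dV n i x|) (dV n i x ^+ 2 / 2).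

Let rem_ge0 n x : 0 <= rem n x.
Proof.
by apply: sumr_ge0 => i _; rewrite le_min mulr_ge0// divr_ge0// sqr_ge0.
Qed.

Let mrem n : measurable_fun setT (rem n).
Proof.
apply: measurable_sum => i.
have mi : measurable_fun setT (dV n i).
  by apply: (L1_measurable (mu := mu)); apply: LdV; rewrite -ltnS.
apply: measurable_minr.
  by apply: measurable_funM => //; exact: measurableT_comp.
by apply: measurable_funM => //; exact: measurable_funX.
Qed.

Let rem_le : {ae mu, forall x n, rem n x <= 2 * G x}.
Proof.
apply: filterS VG => x xG n; apply: (@le_trans _ _ (2 * \sum_(i < n.+1) `|dV n i x|)).
  by rewrite mulr_sumr; apply: ler_sum => i _; rewrite ge_min lexx.
by rewrite ler_wpM2l//; exact: xG.
Qed.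

Let rem_cvg0 : {ae mu, forall x, rem ^~ x @ \oo --> 0}.
Proof.
apply: filterS2 VG (mg_cont cV) => x xG cx.
have G0 : 0 <= G x by apply: le_trans (xG 0%N); exact: sumr_ge0.
apply/cvgrPdist_le => e e0.
have e1 : 0 < e / (G x + 1) by rewrite divr_gt0// ltr_wpDl.
apply: filterS (grid_osc cx (lexx 0) t0 tle e1) => n osc.
rewrite sub0r normrN ger0_norm//.
apply: (@le_trans _ _ (\sum_(i < n.+1) `|dV n i x| * (e / (G x + 1)))).
  apply: ler_sum => i _; rewrite ge_min; apply/orP; right.
  have ile : (i <= n)%N by rewrite -ltnS.
  have h : `|dV n i x| < e / (G x + 1).
    have uu : u n i <= u n i.+1 by exact: grid_mono.
    by apply: (osc i) => //; rewrite -/(u n i) -/(u n i.+1) uu lexx.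
  rewrite -[X in X / _]real_normK ?num_real//.
  have := normr_ge0 (dV n i x); set a := `|_| in h *; set b := e / _ in h *.
  by move=> a0; nra.
rewrite -mulr_suml; apply: (@le_trans _ _ (G x * (e / (G x + 1)))).
  by rewrite ler_wpM2r// ltW.
by rewrite mulrCA ger_pMr// ler_pdivrMr ?mul1r ?lerDl// ltr_wpDl.
Qed.

Let int_rem_cvg0 : (\int[mu]_x (rem n x)%:E)%E @[n --> \oo] --> 0%E.
Proof.
have [|||||_ _ cvgI] := dominated_convergence measurableT
  (f_ := fun n x => (rem n x)%:E) (f := fun x => 0%E)
  (g := fun x => (2 * G x)%:E) (mu := mu).
- by move=> n; exact/measurable_EFinP.
- exact: measurable_cst.
- apply: filterS rem_cvg0 => x xr _; apply: cvg_EFin; first exact: nearW.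
  exact: xr.
- exact: L1Z.
- by apply: filterS rem_le => x xr n _; rewrite lee_fin ger0_norm.
by move: cvgI; rewrite integral0.
Qed.

Let mVt : measurable_fun setT (V t).
Proof. exact: (L1_measurable (mg_L1 cV tT)). Qed.

Let hyp_rem n :
  (\int[mu]_x (hyp (V t x) - 1)%:E <= \int[mu]_x (rem n x)%:E)%E.
Proof.
pose q i x := hyp_slope (V (u n i) x).
have Lq (i : 'I_n.+1) : L1 mu (fun x => q i x * dV n i x).
  have ile : (i <= n)%N by rewrite -ltnS.
  have Ld := LdV ile; have /andP[h _] := uT (leqW ile).
  apply: (@L1_le _ _ _ _ _ (fun x => `|dV n i x|)).
  - apply: measurable_funM; last exact: (L1_measurable Ld).
    apply: measurable_hyp_slope; apply: (L1_measurable (mu := mu)).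
    by apply: (mg_L1 cV); apply: uT; exact: leqW.
  - exact: L1_norm.
  - apply: aeW => x; rewrite normrM -[leRHS]mul1r ler_wpM2r//.
    exact: hyp_slope_le1.
have I0 : (\int[mu]_x (\sum_(i < n.+1) q i x * dV n i x)%:E = 0)%E.
  under eq_integral do rewrite -sumEFin.
  rewrite integral_sum//; apply: big1 => i _.
  have ile : (i <= n)%N by rewrite -ltnS.
  apply: (@int_weight_eq0 _ _ _ mu (F (u n i))).
  - exact: (fil_sigma cF).
  - exact: (fil_meas cF).
  - by apply: sub_sigmaT; exact: (fil_sigma cF).
  - have sG := fil_sigma cF (u n i); apply/(measurable_wrtP _ sG).
    apply: (@measurable_hyp_slope _ _ (g_sigma_algebraType _)).
    by apply/(measurable_wrtP _ sG); apply: wV; exact: leqW.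
  - exact: LdV.
  - exact: Lq.
  - move=> C FC; have /andP[a1 _] := uT (leqW ile).
    have /andP[_ a2] : 0 <= u n i.+1 <= T by apply: uT.
    by apply: (mg_center cV) => //; exact: grid_mono.
have Lsum : L1 mu (fun x => \sum_(i < n.+1) q i x * dV n i x).
  rewrite /L1 (_ : _ \o _ = fun x => (\sum_(i < n.+1) (q i x * dV n i x)%:E)%E).
    by apply: integrable_sum => // i _; exact: Lq.
  by apply/funext => x /=; rewrite sumEFin.
have Lrem : L1 mu (rem n).
  apply: (L1_le (mrem n) (L1Z 2 LG)).
  by apply: filterS rem_le => x /(_ n); rewrite ger0_norm.
have Lh : L1 mu (fun x => hyp (V t x) - 1).
  apply: (@L1_le _ _ _ _ _ (fun x => `|V t x|)).
  - by apply: measurable_funB => //; exact: measurable_hyp.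
  - exact: L1_norm (mg_L1 cV tT).
  - apply: aeW => x; have h1 := hyp_ge1 (V t x).
    rewrite ger0_norm; last by lra.
    suff : hyp (V t x) <= 1 + `|V t x| by lra.
    rewrite -(@ler_pXn2r _ 2)// ?nnegrE//; last by lra.
    rewrite hyp_sqr sqrrD real_normK ?num_real// expr1n mul1r.
    by have := normr_ge0 (V t x); lra.
rewrite -[leRHS]adde0 -I0 -intD//.
apply: le_integral => //; first exact: L1D.
move=> x _; rewrite lee_fin.
have -> : hyp (V t x) - 1 = \sum_(i < n.+1) (hyp (V (u n i.+1) x) - hyp (V (u n i) x)).
  rewrite -(big_mkord xpredT (fun i => hyp (V (u n i.+1) x) - hyp (V (u n i) x))).
  rewrite telescope_sumr// /u grid_end grid0 V0.
  by rewrite {3}/hyp expr0n addr0 sqrtr1.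
rewrite /rem -big_split/=; apply: ler_sum => i _.
rewrite -lerBlDr le_min; apply/andP; split; first exact: hyp_lip.
exact: hyp_taylor.
Qed.

(** A martingale of integrable variation vanishes. Squares need not be
    integrable here, so the square function is replaced by the hyperbola
    [hyp], which has the same second order behaviour but linear growth. *)
Lemma variation_martingale_eq0 : {ae mu, forall x, V t x = 0}.
Proof.
have mh : measurable_fun setT (fun x => (hyp (V t x) - 1)%:E).
  by apply/measurable_EFinP; apply: measurable_funB => //; exact: measurable_hyp.
have h0 x : 0 <= hyp (V t x) - 1 by rewrite subr_ge0 hyp_ge1.
have I0 : (\int[mu]_x `|(hyp (V t x) - 1)%:E| = 0)%E.
  under eq_integral do rewrite gee0_abs ?lee_fin//.
  apply/eqP; rewrite eq_le integral_ge0 ?andbT; last by move=> x _; rewrite lee_fin.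
  by apply: (cvge_ge _ int_rem_cvg0); apply: nearW => n; exact: hyp_rem.
have /(ae_eq_integral_abs mu measurableT mh) := I0.
apply: filterS => x /(_ I)[] /eqP; rewrite subr_eq0 => /eqP h1.
have := hyp_sqr (V t x); rewrite h1 expr1n => /eqP.
by rewrite -subr_eq0 opprD addrA subrr sub0r oppr_eq0 sqrf_eq0 => /eqP.
Qed.

End bounded_variation_martingale.

Section dyadic_points.
Context (R : realType).
Implicit Types (T t : R).

Lemma dyad_itv T m i : 0 <= T -> (i <= 2 ^ m)%N -> 0 <= dyad T m i <= T.
Proof.
move=> T0 im; have e0 : 0 < 2 ^+ m :> R by rewrite exprn_gt0.
rewrite /dyad divr_ge0 ?mulr_ge0 ?(ltW e0)//= ler_pdivrMr// mulrC ler_wpM2l//.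
by rewrite -natrX ler_nat.
Qed.

Lemma dyad_le T n k l : 0 <= T -> (k <= l)%N -> dyad T n k <= dyad T n l.
Proof.
move=> T0 kl; rewrite /dyad ler_wpM2r ?invr_ge0 ?exprn_ge0//.
by rewrite ler_wpM2r// ler_nat.
Qed.

Lemma dyad_end T n : dyad T n (2 ^ n) = T.
Proof. by rewrite /dyad natrX mulrAC divff ?mul1r// gt_eqF// exprn_gt0. Qed.

Lemma dyad_step T n k : dyad T n k.+1 - dyad T n k = T / 2 ^+ n.
Proof. by rewrite /dyad -mulrBl -mulrBl -natr1 addrC addKr mul1r. Qed.

Lemma dyad_refine T n p k : dyad T (n + p) (k * 2 ^ p) = dyad T n k.
Proof.
have en : 2 ^+ n != 0 :> R by rewrite gt_eqF// exprn_gt0.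
have ep : 2 ^+ p != 0 :> R by rewrite gt_eqF// exprn_gt0.
have gen (a b c f : R) : b != 0 -> f != 0 -> a * b * c / (f * b) = a * c / f.
  by move=> b0 f0; field; rewrite b0 f0.
by rewrite /dyad exprD natrM natrX gen.
Qed.

Lemma dyad_coarse T n p i : 0 <= T -> (i <= 2 ^ (n + p))%N ->
  (i %/ 2 ^ p <= 2 ^ n)%N /\
  dyad T n (i %/ 2 ^ p) <= dyad T (n + p) i <= dyad T n (i %/ 2 ^ p).+1.
Proof.
move=> T0 ile; have p0 : (0 < 2 ^ p)%N by rewrite expn_gt0.
split; first by rewrite -(leq_pmul2r p0) -expnD (leq_trans (leq_trunc_div _ _)).
rewrite -!(dyad_refine T n p) !dyad_le//; last exact: leq_trunc_div.
by rewrite ltnW// ltn_ceil.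
Qed.

Lemma dyad_dense T t (dl : R) : 0 < T -> 0 <= t <= T -> 0 < dl ->
  \forall m \near \oo, exists2 i, (i <= 2 ^ m)%N & `|t - dyad T m i| < dl.
Proof.
move=> T0 /andP[t0 tT] dl0; near=> m.
have e0 : 0 < 2 ^+ m :> R by rewrite exprn_gt0.
pose z := t * 2 ^+ m / T.
have z0 : 0 <= z by rewrite divr_ge0// ?mulr_ge0// ltW.
exists (Num.truncn z).
  rewrite -(ler_nat R) natrX (le_trans (_ : _ <= z))//.
    by have /andP[] := truncn_itv z0.
  by rewrite ler_pdivrMr// mulrC ler_wpM2l// ltW.
have tE : t = z * (T / 2 ^+ m).
  by rewrite /z; field; rewrite !gt_eqF.
rewrite /dyad -mulrA {1}tE -mulrBl normrM (gtr0_norm (divr_gt0 T0 e0)).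
have /andP[z1 z2] := truncn_itv z0.
have h : `|z - (Num.truncn z)%:R| <= 1.
  by rewrite ger0_norm; [rewrite lerBlDl natr1 ltW|rewrite subr_ge0].
rewrite (le_lt_trans (ler_wpM2r _ h)) ?mul1r ?divr_ge0 ?(ltW T0) ?(ltW e0)//.
rewrite ltr_pdivrMr// mulrC -ltr_pdivrMr//.
apply: (@le_lt_trans _ _ m%:R); first by near: m; exact: nbhs_infty_ger.
by rewrite -natrX ltr_nat ltn_expl.
Unshelve. all: by end_near. Qed.

Lemma eq_on_dyads T (f g : R -> R) : 0 < T ->
  {within `[0, T], continuous f} -> {within `[0, T], continuous g} ->
  (forall m i, (i <= 2 ^ m)%N -> f (dyad T m i) = g (dyad T m i)) ->
  forall t, 0 <= t <= T -> f t = g t.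
Proof.
move=> T0 /within_continuousP cf /within_continuousP cg fg t tT.
apply/eqP; rewrite -subr_eq0 -normr_le0; apply/ler_addgt0Pr => e e0; rewrite add0r.
have e20 : 0 < e / 2 by rewrite divr_gt0.
have [d1 d10 h1] := cf _ tT _ e20; have [d2 d20 h2] := cg _ tT _ e20.
have d0 : 0 < Num.min d1 d2 by rewrite lt_min d10.
have [m _ /(_ m (leqnn _))[i im]] := dyad_dense T0 tT d0.
rewrite lt_min => /andP[l1 l2].
have iT := dyad_itv (ltW T0) im.
have := h1 _ iT l1; have := h2 _ iT l2; rewrite fg// => a b.
rewrite (splitr e) (_ : f t - g t = (f t - g (dyad T m i)) - (g t - g (dyad T m i))); last by ring.
by rewrite (le_trans (ler_normB _ _))// lerD// ltW.
Qed.

End dyadic_points.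

Section local_martingales.
Context d (W : measurableType d) (R : realType) (mu : probability W R).
Implicit Types (s t : R) (B : set W) (M X A : R -> W -> R).

(** The localizing times reach [T] after finitely many steps, so that along each
    path the stopped process is eventually the process itself. *)
Record local_martingale (F : R -> set (set W)) (T : R) M : Prop := LocalMartingale {
  lm_adapted : adapted T F M ;
  lm_cont : {ae mu, forall x, {within `[0, T], continuous (M ^~ x)}} ;
  lm_loc : exists tau : nat -> W -> R,
    [/\ forall n, stopping_time T F (tau n),
        {ae mu, forall x, \forall n \near \oo, tau n x = T} &
        forall n, continuous_martingale mu F T
          (fun t x => stopped M (tau n) t x - M 0 x)] }.

Variables (F : R -> set (set W)) (T : R).
Hypothesis cF : complete_filtration mu F.

Lemma stopping_time_min (tau sigma : W -> R) :
  stopping_time T F tau -> stopping_time T F sigma ->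
  stopping_time T F (fun x => Num.min (tau x) (sigma x)).
Proof.
move=> [t1 t2] [s1 s2]; split => [x|t tT].
  have /andP[a1 a2] := t1 x; have /andP[b1 b2] := s1 x.
  by rewrite le_min a1 b1/= ge_min a2.
rewrite (_ : [set x | _] = [set x | tau x <= t] `|` [set x | sigma x <= t]).
  by apply: sub_sigmaU; [exact: (fil_sigma cF)|exact: t2|exact: s2].
apply/seteqP; split => x /=; first by rewrite ge_min => /orP[]; [left|right].
by rewrite ge_min => -[]->; rewrite ?orbT.
Qed.

Lemma stopped_earlier M (tau rho : W -> R) :
  continuous_martingale mu F T (fun t x => stopped M tau t x - M 0 x) ->
  stopping_time T F rho -> (forall x, rho x <= tau x) ->
  continuous_martingale mu F T (fun t x => stopped M rho t x - M 0 x).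
Proof.
move=> mg sr rt; have := stopped_martingale cF mg sr.
rewrite (_ : stopped _ _ = (fun t x => stopped M rho t x - M 0 x))//.
apply/funext => t; apply/funext => x; rewrite /stopped.
by rewrite (min_l (_ : Num.min t (rho x) <= tau x))// ge_min rt orbT.
Qed.

End local_martingales.

Section bracket.
Context d (W : measurableType d) (R : realType) (mu : probability W R).
Variables (F : R -> set (set W)) (T L : R) (X A : R -> W -> R).
Hypothesis cF : complete_filtration mu F.
Hypothesis L0 : 0 <= L.
Hypothesis T0 : 0 < T.
Hypothesis X0 : forall x, X 0 x = 0.
Hypothesis lX : local_martingale mu F T X.
Hypothesis adA : adapted T F A.
Hypothesis A_lip : {ae mu, forall x s t, 0 <= s -> s <= t -> t <= T ->
  0 <= A t x - A s x <= L * (t - s)}.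
Implicit Types (s t : R) (B : set W).

Let N A' t x := (X t x) ^+ 2 - (X 0 x) ^+ 2 - A' t x : R.
Hypothesis lN : local_martingale mu F T (N A).

(** Both [X] and [X ^+ 2 - A] are localized by the minimum of their localizing
    times, thanks to optional stopping. *)
Lemma bracket_controlled : controlled_martingale mu F T L X /\
  forall s t B, 0 <= s -> s <= t -> t <= T -> F s B ->
  (\int[mu]_(x in B) ((X t x - X s x) ^+ 2 - (A t x - A s x))%:E = 0)%E.
Proof.
have [adX cX [tau [st_tau tauT mgX]]] := lX.
have [_ _ [sig [st_sig sigT mgN]]] := lN.
pose rho n x := Num.min (tau n x) (sig n x).
have st_rho n : stopping_time T F (rho n).
  exact: (stopping_time_min cF (st_tau n) (st_sig n)).
have rT n x : 0 <= rho n x <= T by exact: (st_rho n).1.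
have rhoT : {ae mu, forall x, \forall n \near \oo, rho n x = T}.
  apply: filterS2 tauT sigT => x h1 h2; apply: filterS2 h1 h2 => n.
  by rewrite /rho => -> ->; rewrite minxx.
have mgXr n : continuous_martingale mu F T (fun t x => stopped X (rho n) t x - X 0 x).
  by apply: (stopped_earlier cF (mgX n)) => // x; rewrite /rho ge_min lexx.
have mgNr n : continuous_martingale mu F T (fun t x => stopped (N A) (rho n) t x - N A 0 x).
  by apply: (stopped_earlier cF (mgN n)) => // x; rewrite /rho ge_min lexx orbT.
split; first exact: (localized_controlled cF L0 X0 adX cX A_lip rT rhoT mgXr mgNr).
move=> s t B s0 st tT FB.
exact: (localized_bracket cF L0 X0 adX adA A_lip rT rhoT mgXr mgNr).
Qed.

Variable A' : R -> W -> R.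
Hypothesis A0 : {ae mu, forall x, A 0 x = 0}.
Hypothesis contA : {ae mu, forall x, {within `[0, T], continuous (A ^~ x)}}.
Hypothesis contA' : {ae mu, forall x, {within `[0, T], continuous (A' ^~ x)}}.
Hypothesis A'0 : {ae mu, forall x, A' 0 x = 0 /\
  {in `[0, T] &, {homo A' ^~ x : s t / s <= t}}}.
Hypothesis lN' : local_martingale mu F T (N A').

(** Two brackets differ by a local martingale of bounded variation; after
    localization the variation is integrable because the square is. *)
Lemma bracket_unique : {ae mu, forall x t, 0 <= t <= T -> A t x = A' t x}.
Proof.
have [_ _ [tau [st_tau tauT mgX]]] := lX.
have [_ _ [sig [st_sig sigT mgN]]] := lN.
have [_ _ [sig' [st_sig' sigT' mgN']]] := lN'.
pose rho n x := Num.min (tau n x) (Num.min (sig n x) (sig' n x)).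
have st_rho n : stopping_time T F (rho n).
  apply: (stopping_time_min cF (st_tau n)).
  exact: (stopping_time_min cF (st_sig n) (st_sig' n)).
have rT n x : 0 <= rho n x <= T by exact: (st_rho n).1.
have rhoT : {ae mu, forall x, \forall n \near \oo, rho n x = T}.
  apply: filterS3 tauT sigT sigT' => x h1 h2 h3; near=> n.
  rewrite /rho (_ : tau n x = T); last by near: n.
  rewrite (_ : sig n x = T); last by near: n.
  rewrite (_ : sig' n x = T); last by near: n.
  by rewrite !minxx.
have mgXr n : continuous_martingale mu F T (fun t x => stopped X (rho n) t x - X 0 x).
  by apply: (stopped_earlier cF (mgX n)) => // x; rewrite /rho ge_min lexx.
have mgNr n : continuous_martingale mu F T (fun t x => stopped (N A) (rho n) t x - N A 0 x).
  by apply: (stopped_earlier cF (mgN n)) => // x; rewrite /rho !ge_min lexx !orbT.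
have mgNr' n : continuous_martingale mu F T (fun t x => stopped (N A') (rho n) t x - N A' 0 x).
  by apply: (stopped_earlier cF (mgN' n)) => // x; rewrite /rho !ge_min lexx !orbT.
pose V n t x := (stopped (N A') (rho n) t x - N A' 0 x) -
  (stopped (N A) (rho n) t x - N A 0 x).
pose Ar n t x := stopped A (rho n) t x - A 0 x.
pose Ar' n t x := stopped A' (rho n) t x - A' 0 x.
have VE n t x : V n t x = Ar n t x - Ar' n t x.
  by rewrite /V /Ar /Ar' /stopped /N; ring.
have mgV n : continuous_martingale mu F T (V n).
  split.
  - move=> t tT; have sG := fil_sigma cF t; apply/(measurable_wrtP _ sG).
    apply: measurable_funB; apply/(measurable_wrtP _ sG).
      exact: (mg_adapted (mgNr' n)).
    exact: (mg_adapted (mgNr n)).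
  - apply: filterS2 (mg_cont (mgNr' n)) (mg_cont (mgNr n)) => x c1 c2.
    by move=> z; apply: cvgB; [exact: c1|exact: c2].
  - by move=> t tT; apply: L1B; [exact: (mg_L1 (mgNr' n))|exact: (mg_L1 (mgNr n))].
  - move=> s t B s0 st tT FB; have mB := fil_meas cF FB.
    have [sT tT'] := time_itv s0 st tT.
    have l1 := L1B (mg_L1 (mgNr' n) tT') (mg_L1 (mgNr' n) sT).
    have l2 := L1B (mg_L1 (mgNr n) tT') (mg_L1 (mgNr n) sT).
    have := intB mB l1 l2.
    rewrite (mg_center (mgNr' n))// (mg_center (mgNr n))// sube0 => <-.
    by apply: eq_integral => x _; congr EFin; rewrite /V /=; ring.
have V0 n x : V n 0 x = 0.
  by rewrite VE /Ar /Ar' /stopped min_l ?subrr//; have /andP[] := rT n x.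
have mono' n : {ae mu, forall x s t, 0 <= s -> s <= t -> t <= T ->
    Ar' n s x <= Ar' n t x}.
  apply: filterS A'0 => x [_ ho] s t s0 st tT; rewrite lerD2r /stopped.
  have /andP[r0 rT'] := rT n x.
  apply: ho.
  - by rewrite in_itv/= le_min s0 r0/= ge_min rT' orbT.
  - by rewrite in_itv/= le_min (le_trans s0)// r0/= ge_min rT' orbT.
  - by rewrite le_min; apply/andP; split; rewrite ge_min ?st ?lexx ?orbT.
have V_eq0 n t : 0 <= t <= T -> {ae mu, forall x, V n t x = 0}.
  move=> tT; have /andP[t0 tle] := tT.
  have LX2 := stopped_square_L1 L0 X0 A_lip (rT n) (mgXr n) (mgNr n) tT.
  have LAr : L1 mu (Ar n t).
    rewrite (_ : Ar n t = fun x => (stopped X (rho n) t x - X 0 x) ^+ 2 -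
       (stopped (N A) (rho n) t x - N A 0 x)); last first.
      by apply/funext => x; rewrite /Ar /stopped /N !X0; ring.
    by apply: L1B => //; exact: (mg_L1 (mgNr n)).
  have LAr' : L1 mu (Ar' n t).
    rewrite (_ : Ar' n t = fun x => Ar n t x - V n t x); last first.
      by apply/funext => x; rewrite VE; ring.
    by apply: L1B => //; exact: (mg_L1 (mgV n)).
  apply: (variation_martingale_eq0 cF (mgV n) (V0 n) tT (L1D LAr LAr')).
  have lipA := stopped_lip L0 A_lip (rT n).
  apply: filterS2 lipA (mono' n) => x l1 l2 m /=.
  have g_itv i : (i <= m)%N ->
     [/\ 0 <= grid 0 t m i, grid 0 t m i <= grid 0 t m i.+1 & grid 0 t m i.+1 <= T].
    move=> im; have /andP[a1 _] := grid_itvT (n := m) (lexx 0) t0 tle (leqW im).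
    have /andP[_ a2] : 0 <= grid 0 t m i.+1 <= T by apply: grid_itvT.
    by split => //; exact: grid_mono.
  have step i : (i <= m)%N -> `|V n (grid 0 t m i.+1) x - V n (grid 0 t m i) x| <=
      (Ar n (grid 0 t m i.+1) x + Ar' n (grid 0 t m i.+1) x) -
      (Ar n (grid 0 t m i) x + Ar' n (grid 0 t m i) x).
    move=> im; have [g1 g2 g3] := g_itv i im.
    have /andP[a _] := l1 _ _ g1 g2 g3; have b := l2 _ _ g1 g2 g3.
    rewrite -/(Ar n (grid 0 t m i.+1) x) -/(Ar n (grid 0 t m i) x) in a.
    by rewrite !VE ler_norml; apply/andP; split; lra.
  apply: (@le_trans _ _ (\sum_(i < m.+1)
      ((Ar n (grid 0 t m i.+1) x + Ar' n (grid 0 t m i.+1) x) -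
      (Ar n (grid 0 t m i) x + Ar' n (grid 0 t m i) x)))).
    by apply: ler_sum => i _; apply: step; rewrite -ltnS.
  rewrite -(big_mkord xpredT (fun i => (Ar n (grid 0 t m i.+1) x + Ar' n (grid 0 t m i.+1) x) -
      (Ar n (grid 0 t m i) x + Ar' n (grid 0 t m i) x))).
  rewrite telescope_sumr// grid_end grid0 /Ar /Ar' /stopped.
  have /andP[r0 _] := rT n x.
  by rewrite !(min_l r0) !subrr addr0 subr0.
have all0 : {ae mu, forall x, forall n m i, (i <= 2 ^ m)%N -> V n (dyad T m i) x = 0}.
  apply: ae_foralln => n; apply: ae_foralln => m; apply: ae_foralln => i.
  have [im|im] := boolP (i <= 2 ^ m)%N; last by apply: aeW => x.
  have iT := dyad_itv (ltW T0) im.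
  by apply: filterS (V_eq0 n _ iT) => x + _.
have h : {ae mu, forall x, {within `[0, T], continuous (A ^~ x)} /\
    {within `[0, T], continuous (A' ^~ x)}} by exact: filterI.
have h' : {ae mu, forall x, A 0 x = 0 /\ A' 0 x = 0}.
  by apply: filterS2 A0 A'0 => x ? [].
have h'' : {ae mu, forall x, (\forall n \near \oo, rho n x = T) /\
  forall n m i, (i <= 2 ^ m)%N -> V n (dyad T m i) x = 0} by exact: filterI.
apply: filterS3 h h' h'' => x [cA cA'] [a0 a'0] [rx allx].
apply: eq_on_dyads => // m i im.
have [n _ /(_ n (leqnn _)) rn] := rx.
have := allx n m i im; rewrite VE /Ar /Ar' /stopped rn a0 a'0.
have /andP[_ iT] := dyad_itv (ltW T0) im.
by rewrite min_l// !subr0 => /eqP; rewrite subr_eq0 => /eqP.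
Unshelve. all: by end_near. Qed.

End bracket.

(** * Exponential tails of the dyadic error *)

Section maximal_inequality.
Context d (W : measurableType d) (R : realType) (mu : probability W R).
Variables (F : R -> set (set W)) (cF : complete_filtration mu F).
Variables (tau : nat -> R) (Z : nat -> W -> R) (NT : W -> R) (K : nat).
Hypothesis tau_mono : forall i j, (i <= j)%N -> (j < K)%N -> tau i <= tau j.
Hypothesis wZ : forall i, (i < K)%N -> measurable_wrt (F (tau i)) (Z i).
Hypothesis LZ : forall i, (i < K)%N -> L1 mu (Z i).
Hypothesis LN : L1 mu NT.
Hypothesis ZN : forall i C, (i < K)%N -> F (tau i) C ->
  (\int[mu]_(x in C) (NT x - Z i x)%:E = 0)%E.

Definition exceed (u : R) (j : nat) : set W :=
  [set x | exists2 i, (i < j)%N & u < Z i x].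

Let exceedS u j : exceed u j.+1 = exceed u j `|` (Z j @^-1` `]u, +oo[).
Proof.
apply/seteqP; split => x /=.
  move=> [l]; rewrite ltnS leq_eqVlt => /orP[/eqP-> uz|lj uz].
    by right; rewrite in_itv/= uz.
  by left; exists l.
by move=> [[l lj uz]|]; [exists l => //; exact: ltnW|rewrite in_itv/= andbT => uz; exists j].
Qed.

Let exceed0 u : exceed u 0 = set0.
Proof. by apply/seteqP; split => x //= []. Qed.

Let exceed_wrt u j i : (i < K)%N -> (j <= i)%N -> F (tau i) (exceed u j).
Proof.
move=> iK; have sG := fil_sigma cF (tau i); elim: j => [_|j IH ji].
  by rewrite exceed0 -setCT; apply: sub_sigmaC => //; exact: sub_sigmaT.
rewrite exceedS; apply: sub_sigmaU => //; first by apply: IH; exact: ltnW.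
apply: (fil_mono cF (tau_mono (ltnW ji) iK)).
apply: wZ; last exact: measurable_itv.
exact: ltn_trans iK.
Qed.

Lemma measurable_exceed u : measurable (exceed u K).
Proof.
case: K exceed_wrt wZ => [_ _|k H wz]; first by rewrite exceed0.
rewrite exceedS; apply: measurableU; first by apply: (fil_meas cF (H u k k _ _)).
by apply: (fil_meas cF (t := tau k)); apply: wz.
Qed.

(** Integrate [expR y >= 1 + y] at [y = lam * (NT - u)] over the event that [Z i]
    is the first to exceed [u]: the linear term contributes a nonnegative
    amount, because [NT] may be replaced there by [Z i > u]. *)
Lemma exceed_exponential lam u : 0 < lam ->
  ((expR (lam * u))%:E * mu (exceed u K) <= \int[mu]_x (expR (lam * NT x))%:E)%E.
Proof.
move=> lam0; have mN := L1_measurable LN.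
have me : measurable_fun setT (fun x => (expR (lam * NT x))%:E).
  by apply/measurable_EFinP; apply: measurableT_comp => //; exact: measurable_funM.
have me' B : measurable_fun B (fun x => (expR (lam * NT x))%:E).
  exact: measurable_funTS.
have e0 x : (0 <= (expR (lam * NT x))%:E)%E by rewrite lee_fin expR_ge0.
suff H j : (j <= K)%N -> measurable (exceed u j) /\
    ((expR (lam * u))%:E * mu (exceed u j) <=
     \int[mu]_(x in exceed u j) (expR (lam * NT x))%:E)%E.
  apply: (le_trans (H K (leqnn _)).2); apply: ge0_subset_integral => //.
  exact: measurable_exceed.
elim: j => [_|j IH jK].
  by rewrite exceed0; split=> //; rewrite measure0 mule0 integral_set0.
have [mE HE] := IH (ltnW jK).
pose C := (Z j @^-1` `]u, +oo[) `&` ~` exceed u j.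
have FC : F (tau j) C.
  have sG := fil_sigma cF (tau j).
  apply: sub_sigmaI => //; first by apply: wZ => //; exact: measurable_itv.
  by apply: sub_sigmaC => //; exact: exceed_wrt.
have mC := fil_meas cF FC.
have EC : exceed u j.+1 = exceed u j `|` C.
  rewrite exceedS; apply/seteqP; split => x; last by move=> [|[]]; [left|right].
  by have [?|?] := pselect (exceed u j x); [left|move=> []; [left|right]].
have dis : [disjoint exceed u j & C]%classic.
  by apply/disj_setPS => x [? []].
have disI : exceed u j `&` C = set0 by apply/seteqP; split => x // [? []].
rewrite EC; split; first exact: measurableU.
rewrite measureU// ge0_integral_setU// muleDr//; last first.
  by rewrite ge0_adde_def// inE.
apply: leeD => //.
have LNu : L1 mu (fun x => NT x - u) by apply: L1B => //; exact: L1_cst.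
have LZu : L1 mu (fun x => Z j x - u) by apply: L1B; [exact: LZ|exact: L1_cst].
have LNZ : L1 mu (fun x => NT x - Z j x) by apply: L1B => //; exact: LZ.
pose f x := 1 + lam * (NT x - u).
have Lf : L1 mu f by apply: L1D; [exact: L1_cst|exact: L1Z].
have Lef : L1 mu (fun x => expR (lam * u) * f x) by exact: L1Z.
have mfp : measurable_fun setT (fun x => Num.max (expR (lam * u) * f x) 0).
  by apply: measurable_maxr => //; exact: (L1_measurable Lef).
have Lfp : L1 mu (fun x => Num.max (expR (lam * u) * f x) 0).
  apply: (@L1_le _ _ _ _ _ (fun x => `|expR (lam * u) * f x|)) => //.
    exact: L1_norm.
  apply: aeW => x; rewrite ger0_norm ?le_max ?lexx ?orbT//.
  by rewrite ge_max ler_norm/=.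
apply: (@le_trans _ _ (\int[mu]_(x in C) (expR (lam * u) * f x)%:E)%E); last first.
  apply: (@le_trans _ _ (\int[mu]_(x in C) (Num.max (expR (lam * u) * f x) 0)%:E)%E).
    apply: le_integral; [exact: mC|exact: L1_integrable|exact: L1_integrable|].
    by move=> x _; rewrite lee_fin le_max lexx.
  apply: ae_int_le => //.
  - by apply: measurableT_comp => //; exact: measurable_funM.
  - by move=> x; rewrite le_max lexx orbT.
  - apply: aeW => x; rewrite ge_max expR_ge0 andbT.
    have -> : lam * NT x = lam * u + lam * (NT x - u) by ring.
    by rewrite expRD ler_wpM2l ?expR_ge0// expR_ge1Dx.
rewrite intZ// lee_wpmul2l ?lee_fin ?expR_ge0//.
rewrite /f (intD (f := cst 1))//; [|exact: L1_cst|exact: L1Z].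
rewrite int_cst// mul1e -[leLHS]adde0 leeD2l//.
rewrite intZ// mule_ge0 ?lee_fin ?(ltW lam0)//.
rewrite (_ : (\int[mu]_(x in C) _)%E =
  (\int[mu]_(x in C) ((NT x - Z j x) + (Z j x - u))%:E)%E); last first.
  by apply: eq_integral => x _; rewrite addrA subrK.
rewrite intD// ZN// add0e; apply: integral_ge0 => x [] /=.
by rewrite in_itv/= andbT => uz _; rewrite lee_fin subr_ge0 ltW.
Qed.

End maximal_inequality.

Section dyadic_error.
Context d (W : measurableType d) (R : realType) (mu : probability W R).
Variables (F : R -> set (set W)) (T L : R) (X A : R -> W -> R) (n : nat).
Hypothesis cF : complete_filtration mu F.
Hypothesis L0 : 0 < L.
Hypothesis T0 : 0 < T.
Hypothesis cX : controlled_martingale mu F T L X.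
Hypothesis bracketA : forall s t B, 0 <= s -> s <= t -> t <= T -> F s B ->
  (\int[mu]_(x in B) ((X t x - X s x) ^+ 2 - (A t x - A s x))%:E = 0)%E.
Hypothesis adA : adapted T F A.
Hypothesis A_lip : {ae mu, forall x s t, 0 <= s -> s <= t -> t <= T ->
  0 <= A t x - A s x <= L * (t - s)}.
Implicit Types (s t : R) (B : set W).

Let tk k := dyad T n k.
Let h := L * T / 2 ^+ n.

Let e0 : 0 < 2 ^+ n :> R. Proof. by rewrite exprn_gt0. Qed.

Let h0 : 0 < h. Proof. by rewrite divr_gt0// mulr_gt0. Qed.

Let tk_step k : tk k.+1 - tk k = T / 2 ^+ n.
Proof. exact: dyad_step. Qed.

Let hE k : L * (tk k.+1 - tk k) = h.
Proof. by rewrite tk_step mulrA. Qed.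

Let tk_lt k : tk k < tk k.+1.
Proof. by rewrite -subr_gt0 tk_step divr_gt0. Qed.

Let tk_le k l : (k <= l)%N -> tk k <= tk l.
Proof. by apply: dyad_le; exact: ltW. Qed.

Let tkT k : (k <= 2 ^ n)%N -> 0 <= tk k <= T.
Proof. by move=> ?; apply: dyad_itv => //; exact: ltW. Qed.

Let LX t : 0 <= t <= T -> L1 mu (X t). Proof. exact: (cm_L1 cX). Qed.

Let mA t : 0 <= t <= T -> measurable_fun setT (A t).
Proof. by move=> tT; exact: (measurable_wrt_fun (fil_meas cF (t:=t)) (adA tT)). Qed.

Let sqdiff s t x := (X t x - X s x) ^+ 2 - (A t x - A s x).

Let LdX2 s t : 0 <= s -> s <= t -> t <= T -> L1 mu (fun x => (X t x - X s x) ^+ 2).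
Proof.
move=> s0 st tT; have [sT tT'] := time_itv s0 st tT.
have FT : F s setT by apply: sub_sigmaT; exact: (fil_sigma cF).
apply: (L1_ge0 (c := L * (t - s))).
- by apply: measurable_funX; apply: (L1_measurable (mu := mu)); apply: L1B; exact: LX.
- by move=> x; exact: sqr_ge0.
- by have := cm_square cX s0 st tT FT; rewrite probability_setT mule1.
Qed.

Let mdA s t : 0 <= s -> s <= t -> t <= T -> measurable_fun setT (fun x => A t x - A s x).
Proof. by move=> s0 st tT; have [? ?] := time_itv s0 st tT; apply: measurable_funB; exact: mA. Qed.

Let LdA s t : 0 <= s -> s <= t -> t <= T -> L1 mu (fun x => A t x - A s x).
Proof.
move=> s0 st tT; apply: (L1_le (mdA s0 st tT) (L1_cst mu (L * (t - s)))).
by apply: filterS A_lip => x /(_ s t s0 st tT)/andP[a b]; rewrite ger0_norm.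
Qed.

Let Lsqdiff s t : 0 <= s -> s <= t -> t <= T -> L1 mu (sqdiff s t).
Proof. by move=> s0 st tT; apply: L1B; [exact: LdX2|exact: LdA]. Qed.

Let adXA u s t (Y := sqdiff s t) : 0 <= s -> s <= t -> t <= u -> u <= T ->
  measurable_wrt (F u) Y.
Proof.
move=> s0 st tu uT; have sG := fil_sigma cF u.
have w (M : R -> W -> R) v : adapted T F M -> 0 <= v -> v <= u ->
    measurable_fun setT (M v : g_sigma_algebraType (F u) -> R).
  move=> aM v0 vu; apply/(measurable_wrtP _ sG) => B mB; apply: (fil_mono cF vu).
  by apply: aM => //; rewrite v0 (le_trans vu).
have su := le_trans st tu; have t0 := le_trans s0 st.
have aX := cm_adapted cX.
apply/(measurable_wrtP _ sG); apply: measurable_funB.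
  by apply: measurable_funX; apply: measurable_funB; exact: w.
by apply: measurable_funB; exact: w.
Qed.

Let D k := sqdiff (tk k) (tk k.+1).

(** For [s] in the [j]-th dyadic interval this is [Q^n - A] at [s], when [A]
    starts from [0]. *)
Definition comp_qv j s x := \sum_(k < j) D k x + sqdiff (tk j) s x.

Definition comp_qvT x := \sum_(k < 2 ^ n) D k x.

Let product_le nu : `|nu| * h <= 1 / 64 ->
  (\int[mu]_x (\prod_(k < 2 ^ n) expR (nu * D k x))%:E <=
   ((1 + block_cst R * (nu * h) ^+ 2) ^+ (2 ^ n))%:E)%E.
Proof.
move=> nuh; have c0 : 0 <= 1 + block_cst R * (nu * h) ^+ 2.
  by rewrite addr_ge0// mulr_ge0 ?sqr_ge0// ltW// block_cst_gt0.
have := @int_prod_le _ _ _ mu F cF tk (fun k x => expR (nu * D k x))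
  (1 + block_cst R * (nu * h) ^+ 2) (2 ^ n) setT.
rewrite probability_setT => H; rewrite -[leRHS]mule1.
have /andP[t00 _] := tkT (leq0n _).
apply: (H _ c0 _ _ _ _ _ (leqnn _)).1 => //.
- by move=> i j ij _; exact: tk_le.
- move=> k kn; have sG := fil_sigma cF (tk k.+1).
  apply/(measurable_wrtP _ sG); apply: measurableT_comp => //.
  apply: measurable_funM => //; apply/(measurable_wrtP _ sG).
  have /andP[? _] := tkT (ltnW kn); have /andP[_ ?] := tkT kn.
  by apply: adXA => //; exact/ltW/tk_lt.
- move=> k C kn FC; rewrite -(hE k).
  have /andP[k0 _] := tkT (ltnW kn); have /andP[_ kT] := tkT kn.
  apply: (block_exponential cF (ltW L0) cX) => //.
  + by apply: mdA => //; exact/ltW/tk_lt.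
  + by apply: filterS A_lip => x; apply => //; exact/ltW/tk_lt.
  + by apply: bracketA => //; exact/ltW/tk_lt.
  + by rewrite hE.
- by apply: sub_sigmaT; exact: (fil_sigma cF).
Qed.

Definition rate (s : R) : R := s / (64 * (L * T)).

(** The [2 ^ n] blocks contribute a factor [1 + O (1 / 2 ^ n)] each at this
    value of the parameter. *)
Lemma comp_qvT_exponential nu (s : R) : 1 <= s -> s ^+ 2 = 2 ^+ n ->
  `|nu| = rate s ->
  (\int[mu]_x (expR (nu * comp_qvT x))%:E <= (expR (block_cst R / 64 ^+ 2))%:E)%E.
Proof.
move=> s1 s2 nus.
have LT0 : 0 < L * T by rewrite mulr_gt0.
have s0 : 0 < s by lra.
have nuh : `|nu| * h = (64 * s)^-1.
  rewrite nus /rate /h -s2; field.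
  by rewrite !gt_eqF.
have nuh' : `|nu| * h <= 1 / 64.
  by rewrite nuh invfM mulrC ler_pM2r ?invr_gt0// invf_le1.
under eq_integral do rewrite /comp_qvT mulr_sumr expR_sum.
apply: (le_trans (product_le nuh')); rewrite lee_fin.
have -> : (nu * h) ^+ 2 = (64 ^+ 2 * 2 ^+ n)^-1.
  rewrite -[LHS]real_normK ?num_real// normrM (gtr0_norm h0) nuh.
  by rewrite exprVn exprMn s2.
apply: (@le_trans _ _ (expR (block_cst R * (64 ^+ 2 * 2 ^+ n)^-1) ^+ (2 ^ n))).
  rewrite lerXn2r ?nnegrE ?expR_ge0// ?expR_ge1Dx//.
  by rewrite addr_ge0// mulr_ge0 ?(ltW (block_cst_gt0 _))// invr_ge0 mulr_ge0// ltW.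
rewrite -expRM_natl ler_expR natrX.
by rewrite le_eqVlt; apply/orP; left; apply/eqP; field; rewrite !gt_eqF.
Qed.

(** The part of the current square still to come is the compensated square of
    the remaining increment, plus a product of this increment with a past
    one. *)
Lemma comp_qv_int0 j s C : (j < 2 ^ n)%N -> tk j <= s -> s <= tk j.+1 -> F s C ->
  (\int[mu]_(x in C) (comp_qvT x - comp_qv j s x)%:E = 0)%E.
Proof.
move=> jn js sj FC; have mC := fil_meas cF FC.
have /andP[tj0 _] := tkT (ltnW jn); have /andP[_ tj1T] := tkT jn.
have s0 := le_trans tj0 js; have sT := le_trans sj tj1T.
have tkk k : (j < k)%N -> (k < 2 ^ n)%N ->
    [/\ 0 <= tk k, s <= tk k, tk k <= tk k.+1 & tk k.+1 <= T].
  move=> jk kn; have /andP[? _] := tkT (ltnW kn); have /andP[_ ?] := tkT kn.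
  by split => //; [exact: (le_trans sj (tk_le jk))|exact/ltW/tk_lt].
pose P x := (X s x - X (tk j) x) * (X (tk j.+1) x - X s x).
have LdX a b : 0 <= a -> a <= b -> b <= T -> L1 mu (fun x => X b x - X a x).
  by move=> a0 ab bT; have [? ?] := time_itv a0 ab bT; apply: L1B; exact: LX.
have LP : L1 mu P.
  apply: (L1_le (g := fun x => (X s x - X (tk j) x) ^+ 2 + (X (tk j.+1) x - X s x) ^+ 2)).
  - by apply: measurable_funM; apply: (L1_measurable (mu := mu)); exact: LdX.
  - by apply: L1D; exact: LdX2.
  - apply: aeW => x; rewrite /P; set a := _ - _; set b := _ - _.
    by rewrite ler_norml; apply/andP; split; have := sqr_ge0 (a - b); have := sqr_ge0 (a + b); have := sqr_ge0 a; have := sqr_ge0 b; nra.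
(* the square of the increment over block [j] is split at [s] *)
have decomp x : comp_qvT x - comp_qv j s x =
    \sum_(j.+1 <= k < 2 ^ n) D k x + (sqdiff s (tk j.+1) x + 2 * P x).
  rewrite /comp_qvT /comp_qv -(big_mkord xpredT (fun k => D k x)).
  rewrite (big_cat_nat (n := j))//=; last exact: ltnW.
  rewrite (big_ltn jn) big_mkord /D /sqdiff /P; ring.
have IP : (\int[mu]_(x in C) (P x)%:E = 0)%E.
  apply: (@int_weight_eq0 _ _ _ mu (F s) C (fun x => X s x - X (tk j) x)
    (fun x => X (tk j.+1) x - X s x)) => //.
  - exact: (fil_sigma cF).
  - exact: (fil_meas cF).
  - have sG := fil_sigma cF s; apply/(measurable_wrtP _ sG).
    apply: measurable_funB; apply/(measurable_wrtP _ sG).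
      by apply: (cm_adapted cX); rewrite s0 sT.
    move=> B mB; apply: (fil_mono cF js).
    by apply: (cm_adapted cX) => //; rewrite tj0 (le_trans js).
  - exact: LdX.
  - by move=> C' FC'; exact: (cm_center cX).
under eq_integral do rewrite decomp.
have LD k : (j < k)%N -> (k < 2 ^ n)%N -> L1 mu (D k).
  by move=> jk kn; have [? _ ? ?] := tkk k jk kn; exact: Lsqdiff.
have Lr : L1 mu (fun x => sqdiff s (tk j.+1) x + 2 * P x).
  by apply: L1D; [exact: Lsqdiff|exact: L1Z].
have sums r : {subset r <= index_iota j.+1 (2 ^ n)} ->
    L1 mu (fun x => \sum_(k <- r) D k x) /\
    (\int[mu]_(x in C) (\sum_(k <- r) D k x)%:E = 0)%E.
  elim: r => [_|k r IH rs].
    split; first by under eq_fun do rewrite big_nil; exact: L1_cst.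
    by under eq_integral do rewrite big_nil; exact: integral0.
  have [|IH1 IH2] := IH; first by move=> l lr; apply: rs; rewrite inE lr orbT.
  have : k \in index_iota j.+1 (2 ^ n) by apply: rs; rewrite inE eqxx.
  rewrite mem_index_iota => /andP[jk kn].
  have Lk := LD k jk kn; have [k0 sk kk kT] := tkk k jk kn.
  split; first by under eq_fun do rewrite big_cons; exact: L1D.
  under eq_integral do rewrite big_cons.
  rewrite intD// IH2 adde0; apply: bracketA => //.
  exact: (fil_mono cF sk).
have [//|Ls Is] := sums (index_iota j.+1 (2 ^ n)).
rewrite intD// Is add0e intD//; [|exact: Lsqdiff|exact: L1Z].
by rewrite intZ// IP mule0 adde0; exact: bracketA.
Qed.

Let tk_end : tk (2 ^ n) = T. Proof. exact: dyad_end. Qed.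

Lemma comp_qv_end x : comp_qv (2 ^ n) T x = comp_qvT x.
Proof. by rewrite /comp_qv tk_end /sqdiff !subrr expr0n subrr addr0. Qed.

Lemma comp_qv_wrt j s : (j <= 2 ^ n)%N -> tk j <= s -> s <= T ->
  measurable_wrt (F s) (comp_qv j s).
Proof.
move=> jn js sT; have sG := fil_sigma cF s; apply/(measurable_wrtP _ sG).
have /andP[tj0 _] := tkT jn.
apply: measurable_funD; last by apply/(measurable_wrtP _ sG); exact: adXA.
apply: measurable_sum => k; apply/(measurable_wrtP _ sG); apply: adXA => //.
- by have /andP[] := tkT (ltnW (leq_trans (ltn_ord k) jn)).
- exact/ltW/tk_lt.
- by apply: le_trans js; exact: tk_le.
Qed.

Lemma comp_qv_L1 j s : (j <= 2 ^ n)%N -> tk j <= s -> s <= T -> L1 mu (comp_qv j s).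
Proof.
move=> jn js sT; have /andP[tj0 _] := tkT jn.
apply: L1D; last exact: Lsqdiff.
elim: j jn {js tj0} => [_|j IH jn].
  by under eq_fun do rewrite big_ord0; exact: L1_cst.
under eq_fun do rewrite big_ord_recr/=.
apply: L1D; first by apply: IH; exact: ltnW.
have /andP[? _] := tkT (ltnW jn); have /andP[_ ?] := tkT jn.
by apply: Lsqdiff => //; exact/ltW/tk_lt.
Qed.

Definition grid_exceed (u : R) p : set W := [set x | exists2 i, (i < (2 ^ (n + p)).+1)%N &
  u < `|comp_qv (i %/ 2 ^ p) (dyad T (n + p) i) x|].

Let block p i : (i < (2 ^ (n + p)).+1)%N ->
  [/\ (i %/ 2 ^ p <= 2 ^ n)%N, tk (i %/ 2 ^ p)%N <= dyad T (n + p) i,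
      dyad T (n + p) i <= T &
      (i %/ 2 ^ p < 2 ^ n)%N /\ dyad T (n + p) i <= tk (i %/ 2 ^ p).+1%N \/
      (i %/ 2 ^ p = 2 ^ n)%N /\ dyad T (n + p) i = T].
Proof.
rewrite ltnS => ile; have [jn /andP[ji ij]] := dyad_coarse (ltW T0) ile.
have /andP[_ iT] := dyad_itv (ltW T0) ile; split=> //.
move: jn; rewrite leq_eqVlt => /orP[/eqP jE|jn]; [right|by left].
by split => //; apply/eqP; rewrite eq_le iT/= -{1}tk_end -jE.
Qed.

Lemma grid_exceed_le (s u : R) p : 1 <= s -> s ^+ 2 = 2 ^+ n ->
  measurable (grid_exceed u p) /\
  (mu (grid_exceed u p) <=
   (2 * expR (block_cst R / 64 ^+ 2) * expR (- (rate s * u)))%:E)%E.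
Proof.
move=> s1 s2; pose K := (2 ^ (n + p)).+1; pose tau i := dyad T (n + p) i.
pose Z i := comp_qv (i %/ 2 ^ p) (tau i).
have r0 : 0 < rate s by rewrite /rate divr_gt0 ?mulr_gt0//; lra.
have tau_mono i j : (i <= j)%N -> (j < K)%N -> tau i <= tau j.
  by move=> ij _; apply: dyad_le => //; exact: ltW.
have wZ i : (i < K)%N -> measurable_wrt (F (tau i)) (Z i).
  by move=> /block[b1 b2 b3 _]; exact: comp_qv_wrt.
have LZ i : (i < K)%N -> L1 mu (Z i).
  by move=> /block[b1 b2 b3 _]; exact: comp_qv_L1.
have LN : L1 mu comp_qvT.
  rewrite (_ : comp_qvT = comp_qv (2 ^ n) T).
    by apply: comp_qv_L1 => //; rewrite tk_end.
  by apply/funext => x; rewrite comp_qv_end.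
have ZN i C : (i < K)%N -> F (tau i) C ->
    (\int[mu]_(x in C) (comp_qvT x - Z i x)%:E = 0)%E.
  move=> /block[b1 b2 b3 [[b4 b5]|[b4 b5]]] FC; first exact: comp_qv_int0.
  under eq_integral do rewrite /Z b4 /tau b5 comp_qv_end subrr.
  exact: integral0.
have wZ' i : (i < K)%N -> measurable_wrt (F (tau i)) (fun x => - Z i x).
  move=> iK; have sG := fil_sigma cF (tau i); apply/(measurable_wrtP _ sG).
  by apply: measurableT_comp => //; apply/(measurable_wrtP _ sG); exact: wZ.
have LZ' i : (i < K)%N -> L1 mu (fun x => - Z i x).
  by move=> iK; have := L1Z (-1) (LZ i iK); under eq_fun do rewrite mulN1r.
have LN' : L1 mu (fun x => - comp_qvT x).
  by have := L1Z (-1) LN; under eq_fun do rewrite mulN1r.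
have ZN' i C : (i < K)%N -> F (tau i) C ->
    (\int[mu]_(x in C) (- comp_qvT x - - Z i x)%:E = 0)%E.
  move=> iK FC; have mC := fil_meas cF FC.
  rewrite (_ : (\int[mu]_(x in C) _)%E =
    (\int[mu]_(x in C) ((-1) * (comp_qvT x - Z i x))%:E)%E); last first.
    by apply: eq_integral => x _; congr EFin; ring.
  by rewrite intZ ?ZN ?mule0//; apply: L1B => //; exact: LZ.
have h1 := exceed_exponential cF tau_mono wZ LZ LN ZN u r0.
have h2 := exceed_exponential cF tau_mono wZ' LZ' LN' ZN' u r0.
have m1 := measurable_exceed cF tau_mono wZ u.
have m2 := measurable_exceed cF tau_mono wZ' u.
have -> : grid_exceed u p = exceed Z u K `|` exceed (fun i x => - Z i x) u K.
  apply/seteqP; split => x /=.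
    by move=> [i iK]; rewrite ltr_normr => /orP[uz|uz]; [left|right]; exists i.
  by move=> [[i iK uz]|[i iK uz]]; exists i => //; rewrite ltr_normr uz ?orbT.
split; first exact: measurableU.
apply: (le_trans (measureU2 _ _ _)) => //.
have bnd E : ((expR (rate s * u))%:E * mu E <= (expR (block_cst R / 64 ^+ 2))%:E ->
    mu E <= (expR (block_cst R / 64 ^+ 2) * expR (- (rate s * u)))%:E)%E.
  move=> hE'; have a0 : (0 <= (expR (- (rate s * u)))%:E)%E by rewrite lee_fin expR_ge0.
  have := lee_wpmul2l a0 hE'.
  have e1 : expR (- (rate s * u)) * expR (rate s * u) = 1 by rewrite -expRD addNr expR0.
  by rewrite muleA -!EFinM e1 mul1e mulrC.
rewrite -mulrA mulr_natl mulr2n EFinD; apply: leeD; apply: bnd.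
  apply: (le_trans h1); apply: (comp_qvT_exponential s1 s2).
  by rewrite gtr0_norm.
apply: (le_trans h2).
under eq_integral do rewrite mulrN -mulNr.
by apply: (comp_qvT_exponential s1 s2); rewrite normrN gtr0_norm.
Qed.

(** The point of index [i] of one grid is the point of index [2 * i] of the next,
    and stays in the same block. *)
Lemma grid_exceed_mono (u : R) p q : (p <= q)%N -> grid_exceed u p `<=` grid_exceed u q.
Proof.
move=> /subnK <-; elim: (q - p)%N => [|r IH]; first by rewrite add0n.
apply: (subset_trans IH) => x [i]; rewrite ltnS => ile uz.
set m := (r + p)%N in ile uz *.
have e : dyad T (n + (r.+1 + p)) (2 * i) = dyad T (n + m) i.
  by rewrite -(dyad_refine T (n + m) 1) addSn addnS addn1 expn1 mulnC.
exists (2 * i)%N.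
  by rewrite addSn addnS expnS ltnS leq_mul2l.
by rewrite e addSn expnS divnMl.
Qed.

(** The bound of [grid_exceed_le] does not depend on the grid. *)
Lemma dyad_exceed_le (s u : R) : 1 <= s -> s ^+ 2 = 2 ^+ n ->
  measurable (\bigcup_p grid_exceed u p) /\
  (mu (\bigcup_p grid_exceed u p) <=
   (2 * expR (block_cst R / 64 ^+ 2) * expR (- (rate s * u)))%:E)%E.
Proof.
move=> s1 s2.
have mE p := (grid_exceed_le u p s1 s2).1.
have mU : measurable (\bigcup_p grid_exceed u p) by exact: bigcupT_measurable.
split => //.
have cv : mu (grid_exceed u p) @[p --> \oo] --> mu (\bigcup_p grid_exceed u p).
  apply: (nondecreasing_cvg_mu (mu := mu) mE mU).
  by move=> p q pq; apply/subsetPset; exact: grid_exceed_mono.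
apply: (cvge_le _ cv).
by apply: nearW => p; exact: (grid_exceed_le u p s1 s2).2.
Qed.

End dyadic_error.

(** * Dyadic quadratic variation of a path *)

Section paths.
Context (R : realType) (T : R).
Hypothesis T0 : 0 < T.
Implicit Types (x : Omega T) (s t : R) (n : nat).

Lemma coord_continuous x : {within `[0, T], continuous (fun t => coord_proc t x)}.
Proof. by rewrite /coord_proc; have := valP (x : C0_path T); rewrite inE => -[]. Qed.

Lemma coord0 x : coord_proc 0 x = 0.
Proof. by rewrite /coord_proc; have := valP (x : C0_path T); rewrite inE => -[]. Qed.

Lemma coord_clamp x t : coord_proc t x = coord_proc (Num.max 0 (Num.min t T)) x.
Proof. by rewrite /coord_proc; have := valP (x : C0_path T); rewrite inE => -[_ _ ->]. Qed.

Lemma le_unorm (f : R -> R) t : 0 <= t <= T -> (`|f t|%:E <= unorm T f)%E.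
Proof.
by move=> tT; apply: ereal_sup_ubound; exists t => //=; rewrite in_itv.
Qed.

Lemma unorm_le (f : R -> R) (c : \bar R) :
  (forall t, 0 <= t <= T -> (`|f t|%:E <= c)%E) -> (unorm T f <= c)%E.
Proof.
move=> fc; apply: ge_ereal_sup => _ [t /= + <-].
by rewrite in_itv/=; exact: fc.
Qed.

Lemma dyad_block n t : 0 <= t <= T ->
  exists2 j, (j < 2 ^ n)%N & dyad T n j <= t <= dyad T n j.+1.
Proof.
move=> /andP[t0 tT].
suff H l : (0 < l)%N -> t <= dyad T n l ->
    exists2 j, (j < l)%N & dyad T n j <= t <= dyad T n j.+1.
  by apply: H; [rewrite expn_gt0|rewrite dyad_end].
elim: l => // l IH _ tl.
have [h|h] := leP (dyad T n l) t; first by exists l => //; rewrite h.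
case: l IH tl h => [_ _|l IH _ h].
  by rewrite /dyad !mul0r ltNge t0.
by have [j jl ?] := IH isT (ltW h); exists j => //; exact: ltnW.
Qed.

(** A single formula on the whole of [[0, T]]: continuity in [t] and the
    nonnegativity of all summands can be read off it. *)
Lemma dyad_qv_sum n x t : 0 <= t <= T -> dyad_qv n x t = \sum_(k < 2 ^ n)
  (coord_proc (Num.min t (dyad T n k.+1)) x - coord_proc (Num.min t (dyad T n k)) x) ^+ 2.
Proof.
move=> tT; have [j jn jt] := dyad_block n tT; rewrite (dyad_qvE x T0 jt).
have /andP[jt1 jt2] := jt.
rewrite /dyad_qv_piece -[in RHS](big_mkord xpredT (fun k =>
  (coord_proc (Num.min t (dyad T n k.+1)) x - coord_proc (Num.min t (dyad T n k)) x) ^+ 2)).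
rewrite (big_cat_nat (n := j))//=; last exact: ltnW.
rewrite (big_ltn jn) (min_l jt2) (min_r jt1) [X in _ = _ + (_ + X)]big1_seq ?addr0.
  rewrite big_mkord; congr (_ + _); apply: eq_bigr => k _.
  by rewrite !min_r//; apply: le_trans jt1; apply: dyad_le; rewrite ?(ltW T0)// ltnW.
move=> k; rewrite mem_index_iota => /andP[_ /andP[jk _]].
have h : t <= dyad T n k by apply: (le_trans jt2); apply: dyad_le => //; exact: ltW.
rewrite !min_l ?subrr ?expr0n//; apply: (le_trans h); apply: dyad_le => //; exact: ltW.
Qed.

Lemma dyad_qv_continuous n x : {within `[0, T], continuous (dyad_qv n x)}.
Proof.
pose g m t := \sum_(k < m)
  (coord_proc (Num.min t (dyad T n k.+1)) x - coord_proc (Num.min t (dyad T n k)) x) ^+ 2.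
have c k : {within `[0, T], continuous
    (fun t => coord_proc (Num.min t (dyad T n k)) x)}.
  apply: (@within_continuous_min _ _ (fun t => coord_proc t x)).
    by rewrite /dyad divr_ge0 ?exprn_ge0// mulr_ge0// ltW.
  exact: coord_continuous.
have cg m : {within `[0, T], continuous (g m)}.
  elim: m => [|m IH].
    rewrite (_ : g 0%N = cst 0); first exact/continuous_subspaceT/cst_continuous.
    by apply/funext => t; rewrite /g big_ord0.
  pose a t := coord_proc (Num.min t (dyad T n m.+1)) x -
    coord_proc (Num.min t (dyad T n m)) x.
  have ca : {within `[0, T], continuous a}.
    by move=> t; apply: cvgB; [exact: c|exact: c].
  rewrite (_ : g m.+1 = fun t => g m t + a t * a t).
    move=> t; apply: cvgD; first exact: IH.
    by apply: cvgM; exact: ca.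
  by apply/funext => t; rewrite /g big_ord_recr.
move/within_continuousP: (cg (2 ^ n)%N) => {}cg; apply/within_continuousP => t tT e e0.
have [dl dl0 H] := cg t tT e e0; exists dl => // s sT ts.
by rewrite !dyad_qv_sum//; exact: H.
Qed.

Lemma dyad_qv0 n x : dyad_qv n x 0 = 0.
Proof.
rewrite dyad_qv_sum ?lexx ?(ltW T0)// big1// => k _.
have h l : 0 <= dyad T n l by rewrite /dyad divr_ge0 ?exprn_ge0// mulr_ge0// ltW.
by rewrite !min_l// subrr expr0n.
Qed.

(** [dyad_qv] increases from a grid point on; only the last, incomplete,
    square may decrease, and it is bounded by the oscillation of the path. *)
Lemma dyad_qv_almost_mono n x s t : 0 <= s -> s <= t -> t <= T ->
  exists2 j, (j < 2 ^ n)%N /\ dyad T n j <= s <= dyad T n j.+1 &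
  dyad_qv n x s - (coord_proc s x - coord_proc (dyad T n j) x) ^+ 2 <= dyad_qv n x t.
Proof.
move=> s0 st tT.
have [sT tT'] := time_itv s0 st tT.
have [j jn js] := dyad_block n sT; exists j => //.
have [l ln lt] := dyad_block n tT'.
rewrite (dyad_qvE x T0 js) /dyad_qv_piece addrK.
have /andP[js1 js2] := js.
rewrite dyad_qv_sum// -(big_mkord xpredT (fun k =>
  (coord_proc (Num.min t (dyad T n k.+1)) x - coord_proc (Num.min t (dyad T n k)) x) ^+ 2)).
rewrite (big_cat_nat (n := j))//=; last exact: ltnW.
rewrite -[leLHS]addr0 lerD//; last by apply: sumr_ge0 => k _; exact: sqr_ge0.
rewrite big_mkord le_eqVlt; apply/orP; left; apply/eqP; apply: eq_bigr => k _.
have h i : (i <= j)%N -> dyad T n i <= t.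
  by move=> ij; apply: le_trans st; apply: le_trans js1; apply: dyad_le => //; exact: ltW.
by rewrite !min_r//; apply: h; [exact: ltnW|exact: ltn_ord].
Qed.

End paths.

Lemma ecvg0P (R : realType) (u : (\bar R)^nat) : (forall n, (0 <= u n)%E) ->
  (u @ \oo --> 0%E) <->
  (forall e : R, 0 < e -> \forall n \near \oo, (u n <= e%:E)%E).
Proof.
move=> u0; split => [/fine_cvgP[fu /cvgrPdist_le cu] e e0|H].
  apply: filterS2 fu (cu e e0) => n fn.
  rewrite sub0r normrN => /ler_normlW; rewrite -lee_fin fineK//.
apply/fine_cvgP; split.
  apply: filterS (H 1 ltr01) => n un.
  by rewrite ge0_fin_numE// (le_lt_trans un)// ltry.
apply/cvgrPdist_le => e e0; apply: filterS (H e e0) => n un.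
have fn : u n \is a fin_num.
  by rewrite ge0_fin_numE// (le_lt_trans un)// ltry.
by rewrite sub0r normrN ger0_norm ?fine_ge0// -lee_fin fineK.
Qed.

Section limit.
Context (R : realType) (T : R).
Hypothesis T0 : 0 < T.
Implicit Types (x : Omega T) (s t : R) (n : nat).

Lemma unorm_ge0 (f : R -> R) : (0 <= unorm T f)%E.
Proof.
apply: (@le_trans _ _ (`|f 0|%:E)); first by rewrite lee_fin.
by apply: le_unorm; rewrite lexx ltW.
Qed.

(** Completeness of the uniform norm on all functions on [[0, T]]. *)
Lemma unorm_cauchy_cvg (f_ : nat -> R -> R) :
  (forall e : R, 0 < e -> exists N, forall m n, (N <= m)%N -> (N <= n)%N ->
    (unorm T (f_ m \- f_ n)%R < e%:E)%E) ->
  exists q : R -> R, (fun n => unorm T (f_ n \- q)) @ \oo --> 0%E.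
Proof.
move=> cf; pose q t : R := lim (f_ n t @[n --> \oo]); exists q.
have cq t : 0 <= t <= T -> f_ n t @[n --> \oo] --> q t.
  move=> tT; apply: cauchy_cvg; apply: cauchy_exP => e e0.
  have [N HN] := cf e e0; exists (f_ N t).
  exists N => // n /= Nn; rewrite /ball/=.
  have := HN N n (leqnn _) Nn; rewrite -lte_fin; apply: le_lt_trans.
  exact: (@le_unorm _ _ (f_ N \- f_ n)).
apply/ecvg0P => [n|e e0]; first exact: unorm_ge0.
have [N HN] := cf e e0; exists N => // n /= Nn.
apply: unorm_le => t tT; rewrite lee_fin.
have c : `|f_ n t - f_ m t| @[m --> \oo] --> `|f_ n t - q t|.
  by apply: cvg_norm; apply: cvgB; [exact: cvg_cst|exact: cq].
rewrite -(cvg_lim _ c)//; apply: limr_le; first exact: cvgP c.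
exists N => // m /= Nm.
rewrite -lee_fin; apply: le_trans (ltW (HN n m Nn Nm)).
exact: (@le_unorm _ _ (f_ n \- f_ m)).
Qed.

Lemma dyad_lim_cvg x : dyad_cauchy x ->
  (fun n => unorm T (dyad_qv n x \- dyad_lim x)) @ \oo --> 0%E.
Proof.
by move=> cx; have := xgetPex (cst 0) (unorm_cauchy_cvg cx).
Qed.

Lemma unorm_cvg_point (f_ : nat -> R -> R) q t (e : R) : 0 <= t <= T ->
  (fun n => unorm T (f_ n \- q)) @ \oo --> 0%E -> 0 < e ->
  \forall n \near \oo, `|f_ n t - q t| <= e.
Proof.
move=> tT /ecvg0P H e0.
have := H (fun n => unorm_ge0 _) e e0; apply: filterS => n un.
rewrite -lee_fin; apply: le_trans un; exact: (@le_unorm _ _ (f_ n \- q)).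
Qed.

Lemma dyad_mesh (dl : R) : 0 < dl -> \forall n \near \oo, T / 2 ^+ n < dl.
Proof.
move=> dl0; near=> n.
rewrite ltr_pdivrMr ?exprn_gt0// mulrC -ltr_pdivrMr//.
apply: (@le_lt_trans _ _ n%:R); first by near: n; exact: nbhs_infty_ger.
by rewrite -natrX ltr_nat ltn_expl.
Unshelve. all: by end_near. Qed.

Lemma dyad_lim_mono x s t : dyad_cauchy x -> 0 <= s -> s <= t -> t <= T ->
  dyad_lim x s <= dyad_lim x t.
Proof.
move=> /dyad_lim_cvg cx s0 st tT.
have [sT tT'] := time_itv s0 st tT.
apply/ler_addgt0Pr => e e0; have e30 : 0 < e / 3 by rewrite divr_gt0.
(* a number in [[0, r]] has a square of at most [r], as [r <= 1] *)
pose r := Num.min 1 (e / 3).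
have r0 : 0 < r by rewrite lt_min ltr01.
have [dl dl0 H] := heine_cantor (@coord_continuous _ _ x) r0.
have c1 := unorm_cvg_point sT cx e30; have c2 := unorm_cvg_point tT' cx e30.
have c3 := dyad_mesh dl0.
have [n [h1 h2 h3]] : exists n, [/\ `|dyad_qv n x s - dyad_lim x s| <= e / 3,
    `|dyad_qv n x t - dyad_lim x t| <= e / 3 & T / 2 ^+ n < dl].
  have [N _ HN] := filterI (filterI c1 c2) c3.
  by have [[? ?] ?] := HN N (leqnn _); exists N.
have [j [jn /andP[js sj]] hm] := dyad_qv_almost_mono T0 n x s0 st tT.
have osc : (coord_proc s x - coord_proc (dyad T n j) x) ^+ 2 <= e / 3.
  have /= := H s (dyad T n j) sT (dyad_itv (ltW T0) (ltnW jn)).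
  have -> : `|s - dyad T n j| < dl.
    rewrite ger0_norm ?subr_ge0//; apply: le_lt_trans h3.
    by rewrite -(dyad_step T n j) lerD2r.
  move=> /(_ isT); set z := _ - _ => zr.
  have : r <= 1 by rewrite /r ge_min lexx.
  have : r <= e / 3 by rewrite /r ge_min lexx orbT.
  rewrite -[z ^+ 2]real_normK ?num_real//; have := normr_ge0 z.
  by move: zr; set w := `|z|; nra.
by move: h1 h2; rewrite !ler_norml => /andP[? ?] /andP[? ?]; lra.
Qed.

(** Monotonicity of the limit is automatic: an increment of [Q^n] is at least
    minus the square of one oscillation of the path, which tends to [0]. *)
Lemma dyad_goodE : @dyad_good R T = @dyad_cauchy R T.
Proof.
apply/seteqP; split => x; first by case.
move=> cx; split => //.
- move=> s t; rewrite !in_itv/= => /andP[s0 _] /andP[_ tT] st.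
  exact: dyad_lim_mono.
- have z : (0 : R) <= 0 <= T by rewrite lexx ltW.
  apply/eqP; rewrite -normr_le0; apply/ler_addgt0Pr => e e0; rewrite add0r.
  have [N _ /(_ N (leqnn _))] := unorm_cvg_point z (dyad_lim_cvg cx) e0.
  by rewrite /= dyad_qv0// sub0r normrN.
Qed.

Lemma dyad_err_cvg x (q : R -> R) :
  (fun n => unorm T (fun t => dyad_qv n x t - q t)) @ \oo --> 0%E ->
  dyad_good x /\ forall t, 0 <= t <= T -> dyad_lim x t = q t.
Proof.
move=> cq; have cx : dyad_cauchy x.
  move=> e e0; have e30 : 0 < e / 3 by rewrite divr_gt0.
  have [N _ HN] := (ecvg0P (fun n => unorm_ge0 _)).1 cq _ e30.
  exists N => m n Nm Nn.
  apply: (@le_lt_trans _ _ (e / 3 + e / 3)%:E); last by rewrite lte_fin; lra.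
  apply: unorm_le => t tT; rewrite EFinD.
  apply: le_trans (leeD (HN m Nm) (HN n Nn)).
  apply: le_trans (leeD (le_unorm _ tT) (le_unorm _ tT)).
  rewrite -EFinD lee_fin /=.
  rewrite (_ : dyad_qv m x t - dyad_qv n x t =
    (dyad_qv m x t - q t) - (dyad_qv n x t - q t)); last by ring.
  exact: ler_normB.
split=> [|t tT]; first by rewrite dyad_goodE.
apply/eqP; rewrite -subr_eq0 -normr_le0; apply/ler_addgt0Pr => e e0; rewrite add0r.
have e20 : 0 < e / 2 by rewrite divr_gt0.
have c1 := unorm_cvg_point tT (dyad_lim_cvg cx) e20.
have c2 := unorm_cvg_point tT cq e20.
have [N _ /(_ N (leqnn _))[h1 h2]] := filterI c1 c2.
move: h1 h2; rewrite /= !ler_norml => /andP[? ?] /andP[? ?].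
by apply/andP; split; lra.
Qed.

End limit.

Section measurability.
Context (R : realType) (T : R).
Hypothesis T0 : 0 < T.
Implicit Types (x : Omega T) (s t : R) (n : nat).

Lemma measurable_coord t : measurable_fun setT (@coord_proc R T t).
Proof.
apply: (measurability _ (RGenOpens.measurableE R)) => // _ [_ [a [b ->] <-]].
rewrite setTI; apply: sub_sigma_algebra => x /=.
rewrite in_itv/= => /andP[ax xb].
pose e := Num.min (coord_proc t x - a) (b - coord_proc t x).
have e0 : 0 < e by rewrite lt_min !subr_gt0 ax.
exists e => // y yx; rewrite in_itv/=.
pose c := Num.max 0 (Num.min t T).
have cT : 0 <= c <= T.
  by rewrite le_max lexx/= ge_max (ltW T0)/= ge_min lexx orbT.
have : `|coord_proc t y - coord_proc t x| < e.
  rewrite (coord_clamp y) (coord_clamp x) -lte_fin; apply: le_lt_trans yx.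
  exact: (@le_unorm _ _ (\val (y : C0_path T) \- \val (x : C0_path T))).
rewrite ltr_norml /e => /andP[h1 h2].
have : e <= coord_proc t x - a by rewrite ge_min lexx.
have : e <= b - coord_proc t x by rewrite ge_min lexx orbT.
by rewrite /e => h3 h4; apply/andP; split; lra.
Qed.

Lemma measurable_dyad_qv n t : measurable_fun setT (fun x => dyad_qv n x t : R).
Proof.
rewrite /dyad_qv /dyad_qv_piece; apply: measurable_funD.
  apply: measurable_sum => k; apply: measurable_funX.
  by apply: measurable_funB; exact: measurable_coord.
by apply: measurable_funX; apply: measurable_funB; exact: measurable_coord.
Qed.

Lemma unorm_le_dyad (f : R -> R) (c : R) : {within `[0, T], continuous f} ->
  (forall m i, (i <= 2 ^ m)%N -> `|f (dyad T m i)| <= c) ->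
  (unorm T f <= c%:E)%E.
Proof.
move=> /within_continuousP cf fc; apply: unorm_le => t tT.
rewrite lee_fin; apply/ler_addgt0Pr => e e0.
have [dl dl0 H] := cf t tT e e0.
have [m _ /(_ m (leqnn _))[i im tm]] := dyad_dense T0 tT dl0.
have := H _ (dyad_itv (ltW T0) im) tm; have := fc m i im => h1 h2.
rewrite -[f t](subrK (f (dyad T m i))) (le_trans (ler_normD _ _))// addrC lerD//.
exact: ltW.
Qed.

(** By continuity in time the uniform norms can be computed on dyadic times,
    so that the Cauchy condition is countable. *)
Lemma measurable_dyad_cauchy : measurable (@dyad_cauchy R T).
Proof.
pose G k N m n p i : set (Omega T) := [set x | (N <= m)%N -> (N <= n)%N ->
  (i <= 2 ^ p)%N -> `|dyad_qv m x (dyad T p i) - dyad_qv n x (dyad T p i)| <= k.+1%:R^-1].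
have -> : @dyad_cauchy R T = \bigcap_k \bigcup_N \bigcap_m \bigcap_n \bigcap_p
    \bigcap_i G k N m n p i.
  apply/seteqP; split => x.
    move=> cx k _; have k0 : 0 < k.+1%:R^-1 :> R by rewrite invr_gt0.
    have [N HN] := cx _ k0; exists N => // m _ n _ p _ i _ Nm Nn ip.
    rewrite -lee_fin; apply: le_trans (ltW (HN m n Nm Nn)).
    apply: (@le_unorm _ _ (dyad_qv m x \- dyad_qv n x)).
    by apply: dyad_itv => //; exact: ltW.
  move=> H e e0.
  have [k ke] : exists k : nat, k.+1%:R^-1 < e.
    exists (Num.truncn e^-1); rewrite invf_plt ?posrE//; exact: truncnS_gt.
  have [N _ HN] := H k I; exists N => m n Nm Nn.
  apply: (@le_lt_trans _ _ (k.+1%:R^-1)%:E); last by rewrite lte_fin.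
  apply: unorm_le_dyad.
    by move=> t; apply: cvgB; exact: dyad_qv_continuous.
  by move=> p i ip; exact: (HN m I n I p I i I).
apply: bigcapT_measurable => k; apply: bigcupT_measurable => N.
apply: bigcapT_measurable => m; apply: bigcapT_measurable => n.
apply: bigcapT_measurable => p; apply: bigcapT_measurable => i.
have [Nm|Nm] := boolP (N <= m)%N; last first.
  rewrite (_ : G _ _ _ _ _ _ = setT)//; apply/seteqP; split => // x _ h.
  by rewrite h in Nm.
have [Nn|Nn] := boolP (N <= n)%N; last first.
  rewrite (_ : G _ _ _ _ _ _ = setT)//; apply/seteqP; split => // x _ _ h.
  by rewrite h in Nn.
have [ip|ip] := boolP (i <= 2 ^ p)%N; last first.
  rewrite (_ : G _ _ _ _ _ _ = setT)//; apply/seteqP; split => // x _ _ _ h.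
  by rewrite h in ip.
have mf : measurable_fun setT (fun x : Omega T =>
    `|dyad_qv m x (dyad T p i) - dyad_qv n x (dyad T p i)|).
  by apply: measurableT_comp => //; apply: measurable_funB; exact: measurable_dyad_qv.
have := mf measurableT _ (measurable_itv `]-oo, k.+1%:R^-1]).
rewrite setTI (_ : _ @^-1` _ = G k N m n p i)//.
apply/seteqP; split => x; rewrite /G /= in_itv/=; first by move=> h _ _ _.
by move=> /(_ Nm Nn ip).
Qed.

End measurability.

(** * The completed probability and its augmented filtrations *)

Section completed_probability.
Context d (W : measurableType d) (R : realType) (P : probability W R).

Notation WC := (caratheodory_type (P^*)%mu).

(** Same measure as [completion P]; the name carries the structure of a
    probability measure. *)
Definition cprob : set WC -> \bar R := completion P.

HB.instance Definition _ := Measure.on cprob.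

Lemma cprobE (A : set W) : measurable A -> cprob A = P A.
Proof. by move=> mA; exact: measurable_mu_extE. Qed.

Lemma sub_completion (A : set W) : measurable A -> measurable (A : set WC).
Proof. by move=> mA; apply: sub_caratheodory; exact: sub_sigma_algebra. Qed.

Lemma cprob_setT : cprob setT = 1%E.
Proof. by rewrite cprobE//; exact: probability_setT. Qed.

HB.instance Definition _ := Measure_isProbability.Build _ _ _ cprob cprob_setT.

(** Countable covers of measure at most [1 / k.+1], intersected over [k]. *)
Lemma outer_null (A : set W) : ((P^*)%mu A = 0)%E -> P.-negligible A.
Proof.
move=> A0.
have cov k : exists B, [/\ measurable B, A `<=` B & (P B <= (k.+1%:R^-1)%:E)%E].
  have : (ereal_inf [set (\sum_(0 <= i <oo) P (B i))%E | B in measurable_cover A]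
      < (k.+1%:R^-1 : R)%:E)%E.
    by move: A0; rewrite /= /mu_ext => ->; rewrite lte_fin invr_gt0.
  move=> /ereal_inf_lt[_ [B [mB AB] <-]] Bk.
  have mU : measurable (\bigcup_i B i) by exact: bigcupT_measurable.
  exists (\bigcup_i B i); split => //.
  apply: le_trans (ltW Bk).
  exact: measure_sigma_subadditive.
have [B HB] := choice cov.
have mI : measurable (\bigcap_k B k).
  by apply: bigcapT_measurable => k; have [] := HB k.
exists (\bigcap_k B k); split => //; last first.
  by move=> x Ax k _; have [_ AB _] := HB k; exact: AB.
apply/eqP; rewrite eq_le measure_ge0 andbT; apply/lee_addgt0Pr => e e0; rewrite add0e.
have ke : (Num.truncn e^-1).+1%:R^-1 < e.
  by rewrite invf_plt ?posrE//; exact: truncnS_gt.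
have [mB _ Bk] := HB (Num.truncn e^-1).
apply: (@le_trans _ _ (P (B (Num.truncn e^-1)))).
  apply: le_measure; rewrite ?inE//.
  exact: bigcap_inf.
by apply: (le_trans Bk); rewrite lee_fin ltW.
Qed.

Lemma cprob_negligible (N : set W) : cprob.-negligible N <-> P.-negligible N.
Proof.
split => [[A [mA A0 NA]]|[A [mA A0 NA]]].
  by case: (outer_null A0) => B [mB B0 AB]; exists B; split => //; exact: subset_trans AB.
by exists A; split => //; [exact: sub_completion|rewrite cprobE].
Qed.

Lemma ae_cprob (Q : W -> Prop) : {ae cprob, forall x, Q x} <-> {ae P, forall x, Q x}.
Proof. exact: cprob_negligible. Qed.

Lemma cprob_complete : measure_is_complete cprob.
Proof. exact: measure_is_complete_caratheodory. Qed.

Lemma ae_measurable_le (S U : set WC) : measurable U ->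
  {ae cprob, forall x, S x <-> U x} -> measurable S /\ (cprob S <= cprob U)%E.
Proof.
move=> mU SU; have [N [mN N0 sub]] := SU.
have SN : S = (U `&` ~` N) `|` (S `&` N).
  apply/seteqP; split => x.
    move=> Sx; have [Nx|Nx] := pselect (N x); [by right|left; split=> //].
    have : ~ ~ (S x <-> U x) by move=> h; apply: Nx; exact: sub.
    by move=> /contrapT[+ _]; exact.
  move=> [[Ux Nx]|[]//].
  have : ~ ~ (S x <-> U x) by move=> h; apply: Nx; exact: sub.
  by move=> /contrapT[_]; exact.
have mSN : measurable (S `&` N).
  apply: cprob_complete; exists N; split => //; exact: subIsetr.
have mS : measurable S.
  by rewrite SN; apply: measurableU => //; apply: measurableI => //; exact: measurableC.
split=> //; apply: (@le_trans _ _ (cprob (U `|` N))).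
  apply: le_measure; rewrite ?inE//; first exact: measurableU.
  by rewrite {1}SN => x [[]|[]]; [left|right].
apply: (le_trans (measureU2 _ mU mN)).
by rewrite [X in (_ + X)%E](N0) adde0.
Qed.

Lemma augmentation_complete (G : R -> set (set W)) :
  (forall s t, s <= t -> G s `<=` G t) -> (forall t, G t `<=` measurable) ->
  complete_filtration cprob (usual_augmentation P G).
Proof.
move=> Gmono Gmeas; split.
- move=> t; apply: sigma_algebra_bigcap => s _.
  exact: smallest_sigma_algebra.
- move=> s t st A FA u /= tu; apply: FA => /=; exact: le_lt_trans tu.
- move=> t A /(_ (t + 1)) /=; rewrite ltrDl => /(_ ltr01).
  apply: smallest_sub => [|B [GB|NB]].
  + exact: (@sigma_algebra_measurable _ WC).
  + by apply: sub_completion; exact: Gmeas GB.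
  + by apply: cprob_complete; exact/cprob_negligible.
- move=> t N /cprob_negligible NN s _.
  by apply: sub_sigma_algebra; right.
Qed.

Lemma natural_filtration_mono (T : R) (M : R -> W -> R) s t : s <= t ->
  natural_filtration T M s `<=` natural_filtration T M t.
Proof.
move=> st; apply: smallest_sub => [|A [u [uT us] [B mB <-]]].
  exact: smallest_sigma_algebra.
apply: sub_sigma_algebra; exists u; last by exists B.
by split => //; exact: le_trans st.
Qed.

Lemma natural_filtration_meas (T : R) (M : R -> W -> R) t :
  (forall s, measurable_fun setT (M s)) ->
  natural_filtration T M t `<=` measurable.
Proof.
move=> mM; apply: smallest_sub => [|_ [s _ [B mB <-]]].
  exact: sigma_algebra_measurable.
by rewrite -[X in measurable X]setTI; exact: mM.
Qed.

Lemma martingale_center (T : R) (F : R -> set (set W)) (M : R -> W -> R) :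
  complete_filtration cprob F -> martingale P T F M ->
  {ae P, forall x, {within `[0, T], continuous (M ^~ x)}} ->
  continuous_martingale cprob F T M.
Proof.
move=> cF [adM LM ceM] cM; split => //.
- exact/ae_cprob.
- move=> s t B s0 st tT FB.
  have mB := fil_meas cF FB.
  have [_ _ /(_ B FB) E] := ceM s t s0 st tT.
  have [sT tT'] := time_itv s0 st tT.
  rewrite (@intB _ _ _ cprob B (M t) (M s))//; last 2 first.
  + exact: LM.
  + exact: LM.
  have fs : (\int[cprob]_(x in B) (M s x)%:E \is a fin_num)%E.
    by apply/integrable_fin_num/L1_integrable => //; exact: LM.
  rewrite (_ : (\int[cprob]_(x in B) (M t x)%:E)%E = (\int[cprob]_(x in B) (M s x)%:E)%E).
    by rewrite subee.
  exact: esym E.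
Qed.

Lemma local_martingale_center (T : R) (F : R -> set (set W)) (M : R -> W -> R) :
  complete_filtration cprob F -> continuous_local_martingale P T F M ->
  local_martingale cprob F T M.
Proof.
move=> cF [adM cM [tau [st_tau mono tauT] mgM]]; split => //.
  exact/ae_cprob.
exists tau; split => //.
- apply/ae_cprob; apply: filterS2 mono tauT => x mono [N NT].
  exists N => // n /= Nn; apply/eqP; rewrite eq_le.
  have /andP[_ ->]/= := (st_tau n).1 x.
  by rewrite -NT; exact: mono.
- move=> n; apply: (martingale_center cF (mgM n)).
  apply: filterS cM => x cx.
  have /andP[t0 _] := (st_tau n).1 x.
  have c := within_continuous_min t0 cx.
  by move=> z; apply: cvgB; [exact: c|exact: cvg_cst].
Qed.

End completed_probability.

Arguments cprob {d W R} P A.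

(** * A bracket with bounded predictable density is Lipschitz *)

Section predictable_density.
Context d (W : measurableType d) (R : realType) (P : probability W R).
Variables (F : R -> set (set W)) (T L : R) (A a : R -> W -> R).
Hypothesis L0 : 0 <= L.
Hypothesis pa : predictable T F a.
Hypothesis Aa : {ae P, forall x, forall t, 0 <= t <= T ->
  ((A t x)%:E = \int[lebesgue_measure]_(s in `[0%R, t]) (a s x)%:E)%E}.
Hypothesis aL : {ae (P \x lebesgue_measure)%E, forall z,
  0 <= z.2 <= T -> 0 <= a z.2 z.1 <= L}.

(** Checked on the predictable rectangles; it makes each path of the density
    measurable in time. *)
Let section_measurable x (C : set (W * R)) :
  <<s setT `*` `[0, T], predictable_rect T F >> C -> measurable [set s | C (x, s)].
Proof.
move: C; apply: smallest_sub => [|C].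
  split.
  - suff -> : [set s : R | (set0 : set (W * R)) (x, s)] = set0 by [].
    by apply/seteqP; split.
  - move=> C mC.
    suff -> : [set s | ((setT `*` `[0, T]) `\` C) (x, s)] =
        `[0, T] `\` [set s | C (x, s)] by exact: measurableD.
    by apply/seteqP; split => s /=; [move=> [[]]|move=> []].
  - move=> C mC.
    suff -> : [set s | (\bigcup_i C i) (x, s)] = \bigcup_i [set s | C i (x, s)].
      exact: bigcupT_measurable.
    by apply/seteqP; split => s /= [i _ Cs]; exists i.
move=> [[B FB <-]|[s [t [B [_ _ _ _ ->]]]]].
- have [Bx|Bx] := pselect (B x).
    suff -> : [set s : R | (B `*` [set 0]) (x, s)] = [set 0] by exact: measurable_set1.
    by apply/seteqP; split => u /= => [[]|].
  suff -> : [set s : R | (B `*` [set 0]) (x, s)] = set0 by [].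
  by apply/seteqP; split => u //= [].
- have [Bx|Bx] := pselect (B x).
    suff -> : [set u : R | (B `*` `]s, t]) (x, u)] = `]s, t]%classic.
      exact: measurable_itv.
    by apply/seteqP; split => u /= => [[]|].
  suff -> : [set u : R | (B `*` `]s, t]) (x, u)] = set0 by [].
  by apply/seteqP; split => u //= [].
Qed.

Lemma predictable_path_measurable x :
  measurable_fun (`[0, T] : set R) (fun s => a s x).
Proof.
move=> _ B mB; rewrite (_ : _ `&` _ = [set s | 0 <= s <= T /\ B (a s x)]).
  exact: (section_measurable x (pa mB)).
by apply/seteqP; split => s /=; rewrite in_itv.
Qed.

(** A null set of the product measure has null sections, almost surely. *)
Lemma density_ae_bound : {ae P, forall x, {ae lebesgue_measure, forall s,
  0 <= s <= T -> 0 <= a s x <= L}}.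
Proof.
have [N [mN N0 sub]] := aL.
have mx : measurable_fun setT (fun x => lebesgue_measure (xsection N x) : \bar R).
  exact: measurable_fun_xsection.
have I0 : (\int[P]_x `|(lebesgue_measure (xsection N x) : \bar R)| = 0)%E.
  rewrite -[RHS]N0; apply: eq_integral => x _ /=.
  by rewrite gee0_abs.
have /(ae_eq_integral_abs P measurableT mx) := I0.
apply: filterS => x /(_ I) /= lx.
exists (xsection N x); split => //; first exact: measurable_xsection.
move=> s /= ns; rewrite /xsection/= inE; apply: sub => /=.
exact: ns.
Qed.

Lemma bracket_lipschitz : {ae P, forall x s t, 0 <= s -> s <= t -> t <= T ->
  0 <= A t x - A s x <= L * (t - s)}.
Proof.
apply: filterS2 Aa density_ae_bound => x AE ab s t s0 st tT.
pose b u := Num.max 0 (Num.min (a u x) L).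
have b0 u : 0 <= b u by rewrite /b le_max lexx.
have bL u : b u <= L by rewrite /b ge_max L0 ge_min lexx orbT.
have ma := predictable_path_measurable x.
have mb : measurable_fun (`[0, T] : set R) b.
  by apply: measurable_maxr => //; exact: measurable_minr.
have subT u : u <= T -> (`[0, u] : set R) `<=` `[0, T].
  by move=> uT v /=; rewrite !in_itv/= => /andP[-> vu]; exact: le_trans uT.
have Ab u : 0 <= u <= T ->
    ((A u x)%:E = \int[lebesgue_measure]_(v in `[0%R, u]) (b v)%:E)%E.
  move=> uT; have /andP[_ uT'] := uT; rewrite AE//; apply: ae_eq_integral => //.
  - by apply/measurable_EFinP; apply: measurable_funS (subT _ uT') ma.
  - by apply/measurable_EFinP; apply: measurable_funS (subT _ uT') mb.
  - have [N [mN N0 sub]] := ab; exists N; split => //.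
    apply: subset_trans sub => v /=; apply: contra_not => av.
    rewrite in_itv/= => /andP[v0 vu].
    have /andP[a0 aLv] : 0 <= a v x <= L by apply: av; rewrite v0 (le_trans vu).
    by rewrite /b min_l// max_r.
have [sT tT'] := time_itv s0 st tT.
have split_itv : `[0, t]%classic = `[0, s]%classic `|` `]s, t]%classic.
  apply/seteqP; split => u /=; rewrite !in_itv/=.
    by move=> /andP[u0 ut]; have [us|us] := leP u s; [left; rewrite u0|right].
  by move=> [/andP[-> us]|/andP[su ->]]; rewrite ?(le_trans us)// (le_trans s0)// ltW.
have mbt : measurable_fun (`]s, t] : set R) (EFin \o b).
  apply/measurable_EFinP; apply: measurable_funS mb => // u /=.
  rewrite !in_itv/= => /andP[su ut]; rewrite (le_trans ut)// andbT.
  by rewrite (le_trans s0)// ltW.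
have E := Ab t tT'; rewrite split_itv ge0_integral_setU//= in E; last 3 first.
- by rewrite -split_itv; apply/measurable_EFinP; apply: measurable_funS (subT _ tT) mb.
- by move=> u _; rewrite lee_fin.
- apply/disj_setPS => u /= []; rewrite !in_itv/= => /andP[_ us] /andP[su _].
  by move: (lt_le_trans su us); rewrite ltxx.
rewrite -(Ab s sT) in E.
have I0 : (0 <= \int[lebesgue_measure]_(v in `]s, t]) (b v)%:E)%E.
  by apply: integral_ge0 => u _; rewrite lee_fin.
have I1 : (\int[lebesgue_measure]_(v in `]s, t]) (b v)%:E <= (L * (t - s))%:E)%E.
  apply: (@le_trans _ _ (\int[lebesgue_measure]_(v in `]s, t]) (cst L%:E v))%E).
    apply: ge0_le_integral => //.
    - by move=> u _; rewrite lee_fin.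
    - by move=> u _; rewrite lee_fin.
  rewrite integral_cst//= lebesgue_measure_itv/= lte_fin.
  case: ifPn => [_|]; first by rewrite -EFinB -EFinM.
  by move=> _; rewrite mule0 lee_fin mulr_ge0// subr_ge0.
move: E I0 I1; case: (integral _ _ _) => [r| |] //=.
rewrite -EFinD => -[->]; rewrite !lee_fin => r0 rL.
by rewrite addrAC subrr add0r r0.
Qed.

End predictable_density.

(** * From exponential tails to norms *)

Section exponential_tail.
Context (R : realType).
Implicit Types C r v : R.

(** Bounds the expectation of [expR (rho * E / 2)] when [E] has tails of mass
    [C] and rate [rho]: a geometric sum over the integer part of [rho * E]. *)
Definition tail_cst C : R := expR (1 / 2) + C * expR 1 / (1 - expR (- (1 / 2))).

Lemma tail_cst_ge1 C : 0 <= C -> 1 <= tail_cst C.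
Proof.
move=> C0; have h1 : 1 <= expR (1 / 2) :> R by rewrite -[leLHS]expR0 ler_expR.
rewrite (le_trans h1)// lerDl divr_ge0 ?mulr_ge0 ?expR_ge0//.
Qed.

Lemma powR_le_expR r v : 0 < r -> 0 <= v -> v `^ r <= r `^ r * expR v.
Proof.
move=> r0 v0; have vr0 : 0 <= v / r by rewrite divr_ge0// ltW.
have vE : v = r * (v / r) by rewrite mulrC divfK// gt_eqF.
rewrite [in leLHS]vE powRM ?(ltW r0)// ler_wpM2l ?powR_ge0//.
apply: (@le_trans _ _ (expR (v / r) `^ r)).
  apply: ge0_ler_powR; rewrite ?nnegrE ?expR_ge0 ?(ltW r0)//.
  by apply: le_trans (expR_ge1Dx _); rewrite lerDr.
by rewrite -expRM divfK// gt_eqF.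
Qed.

Context d (W : measurableType d) (mu : probability W R).
Variables (E : W -> \bar R) (rho C : R).
Hypothesis mE : measurable_fun setT E.
Hypothesis E0 : forall x, (0 <= E x)%E.
Hypothesis rho0 : 0 < rho.
Hypothesis C0 : 0 <= C.
Hypothesis tail : forall u : R, 0 <= u ->
  (mu [set x | (u%:E < E x)%E] <= (C * expR (- (rho * u)))%:E)%E.

Let mS (u : R) : measurable [set x | (u%:E < E x)%E].
Proof. by rewrite -[X in measurable X]setTI; exact: emeasurable_fun_o_infty. Qed.

Lemma tail_fin_num : {ae mu, forall x, E x \is a fin_num}.
Proof.
have mI : measurable [set x | E x = +oo%E].
  rewrite -[X in measurable X]setTI; exact: (mE measurableT (emeasurable_set1 +oo%E)).
exists [set x | E x = +oo%E]; split => //.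
- apply/eqP; rewrite eq_le measure_ge0 andbT; apply/lee_addgt0Pr => e e0; rewrite add0e.
  pose u := C / (rho * e) .
  have u0 : 0 <= u by rewrite divr_ge0// mulr_ge0// ltW.
  apply: (@le_trans _ _ (mu [set x | (u%:E < E x)%E])).
    by apply: le_measure; rewrite ?inE//; [move=> x /= ->; exact: ltry].
  apply: (le_trans (tail u0)); rewrite lee_fin expRN ler_pdivrMr ?expR_gt0//.
  apply: (@le_trans _ _ (e * (1 + rho * u))); last by rewrite ler_wpM2l ?expR_ge1Dx// ltW.
  have -> : e * (1 + rho * u) = e + C by rewrite /u; field; rewrite !gt_eqF.
  by rewrite lerDr ltW.
- move=> x /= /negP; have := E0 x; rewrite fin_numE; case: (E x) => //=.
Qed.

Let Sk k : set W := [set x | ((k%:R / rho)%:E < E x)%E].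

Lemma tail_exponential :
  (\int[mu]_x (expR (rho / 2 * fine (E x)))%:E <= (tail_cst C)%:E)%E.
Proof.
(* If [k.+1] is the integer part of [v := rho * E x], then [x] is in [Sk k], since
   [k < v], and [v < k + 2]; the constant accounts for [v < 1]. *)
pose f N x : R := expR (1 / 2) + \sum_(k < N) expR ((k%:R + 2) / 2) * \1_(Sk k) x.
have mSk k : measurable (Sk k) by exact: mS.
have mI k : measurable_fun setT (fun x => expR ((k%:R + 2) / 2) * \1_(Sk k) x : R).
  by apply: measurable_funM => //; exact: measurable_indic.
have mf N : measurable_fun setT (f N).
  by apply: measurable_funD => //; apply: measurable_sum => k; exact: mI.
have i0 k x : 0 <= expR ((k%:R + 2) / 2) * \1_(Sk k) x :> R.
  by rewrite mulr_ge0 ?expR_ge0.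
have s0 N x : 0 <= \sum_(k < N) expR ((k%:R + 2) / 2) * \1_(Sk k) x :> R.
  by apply: sumr_ge0 => k _; exact: i0.
have f0 N x : 0 <= f N x by rewrite addr_ge0 ?expR_ge0.
apply: (@fatou_bound _ _ _ mu setT f) => //.
- apply: measurableT_comp => //; apply: measurable_funM => //.
  exact: measurableT_comp.
- apply: filterS tail_fin_num => x fx e e0; near=> N.
  set v := rho * fine (E x); suff : expR (rho / 2 * fine (E x)) <= f N x by lra.
  have -> : rho / 2 * fine (E x) = v / 2 by rewrite /v; ring.
  have v0 : 0 <= v by rewrite mulr_ge0 ?fine_ge0// ltW.
  have /andP[k1 k2] := truncn_itv v0.
  have kN : (Num.truncn v < N)%N by near: N; exact: nbhs_infty_gt.
  case: (Num.truncn v) k1 k2 kN => [|k] k1 k2 kN.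
    by rewrite /f -[leLHS]addr0 lerD// ler_expR; lra.
  have kN' := ltnW kN.
  rewrite /f (bigD1 (Ordinal kN'))//=.
  have xS : Sk k x.
    rewrite /Sk/= -(fineK fx) lte_fin ltr_pdivrMr// mulrC -/v.
    by apply: lt_le_trans k1; rewrite ltr_nat.
  rewrite indicE mem_set// mulr1.
  have h1 : expR (v / 2) <= expR ((k%:R + 2) / 2).
    by rewrite ler_expR ler_pM2r ?invr_gt0// ltW// (lt_le_trans k2)// -!natr1; lra.
  have h2 : 0 <= \sum_(i < N | i != Ordinal kN') expR ((i%:R + 2) / 2) * \1_(Sk i) x :> R.
    by apply: sumr_ge0 => i _; exact: i0.
  by have := expR_ge0 (1 / 2 : R); lra.
- move=> N; rewrite /f; under eq_integral do rewrite EFinD.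
  have ms : measurable_fun setT (fun x => \sum_(k < N) expR ((k%:R + 2) / 2) * \1_(Sk k) x : R).
    by apply: measurable_sum => k; exact: mI.
  have se x : [set: W] x -> (0 <= (\sum_(k < N) expR ((k%:R + 2) / 2) * \1_(Sk k) x : R)%:E)%E.
    by move=> _; rewrite lee_fin.
  have sm := (measurable_EFinP setT _).2 ms.
  rewrite ge0_integralD//.
  rewrite /tail_cst EFinD; apply: leeD.
    by rewrite int_cstT.
  under eq_integral do rewrite -sumEFin.
  have mIE k := (measurable_EFinP setT _).2 (mI k).
  rewrite ge0_integral_sum//; last by move=> k; exact: mIE.
  apply: (@le_trans _ _ (\sum_(k < N) (C * expR 1 * expR (- (1 / 2)) ^+ k)%:E)%E).
    apply: lee_sum => k _; under eq_integral do rewrite EFinM.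
    have mi : measurable_fun setT (fun x => (\1_(Sk k) x : R)%:E).
      by apply/measurable_EFinP; exact: measurable_indic.
    rewrite ge0_integralZl ?lee_fin ?expR_ge0//.
    rewrite integral_indic// setIT.
    have k0 : 0 <= k%:R / rho by rewrite divr_ge0// ltW.
    apply: (le_trans (lee_wpmul2l _ (tail k0))); first by rewrite lee_fin expR_ge0.
    rewrite -EFinM lee_fin mulrCA -expRD -mulrA -expRM_natl -expRD.
    rewrite le_eqVlt; apply/orP; left; apply/eqP; congr (C * expR _).
    by field; rewrite gt_eqF.
  rewrite sumEFin lee_fin -mulr_sumr ler_wpM2l ?mulr_ge0 ?expR_ge0//.
  by apply: geometric_sum_le; rewrite ?expR_ge0// expR_lt1; lra.
Unshelve. all: by end_near. Qed.

(** As [v `^ r <= r `^ r * expR v], the norm of exponent [r] grows linearly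
    in [r]. *)
Lemma tail_Lnorm r : 1 <= r ->
  (Lnorm mu r%:E E <= (2 * r * tail_cst C / rho)%:E)%E.
Proof.
move=> r1; have r0 : 0 < r by lra.
have K1 := tail_cst_ge1 C0; have K0 : 0 < tail_cst C by lra.
pose c := (2 * r / rho) `^ r.
have c0 : 0 <= c by exact: powR_ge0.
have int_le : (\int[mu]_x (`|E x| `^ r) <= (c * tail_cst C)%:E)%E.
  apply: (@le_trans _ _ (\int[mu]_x (c * expR (rho / 2 * fine (E x)))%:E)%E).
    apply: ae_ge0_le_integral => //.
    - by move=> x _; exact: poweR_ge0.
    - by apply: (measurableT_comp (measurable_poweR r)); exact: measurableT_comp.
    - by move=> x _; rewrite lee_fin mulr_ge0 ?expR_ge0.
    - apply/measurable_EFinP; apply: measurable_funM => //.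
      by apply: measurableT_comp => //; apply: measurable_funM => //; exact: measurableT_comp.
    - apply: filterS tail_fin_num => x fx _.
      rewrite gee0_abs// -(fineK fx) poweR_EFin lee_fin /=.
      set e := fine (E x); have e0 : 0 <= e by exact: fine_ge0.
      have v0 : 0 <= rho / 2 * e by rewrite mulr_ge0// divr_ge0// ltW.
      have -> : e = (2 / rho) * (rho / 2 * e) by field; rewrite gt_eqF.
      have p0 : 0 <= 2 / rho by rewrite divr_ge0// ltW.
      rewrite powRM//.
      apply: (le_trans (ler_wpM2l (powR_ge0 _ _) (powR_le_expR r0 v0))).
      rewrite mulrA -powRM ?(ltW r0)// /c.
      have -> : 2 / rho * r = 2 * r / rho by ring.
      have -> : 2 / rho * (rho / 2 * e) = e by field; rewrite gt_eqF.
      exact: lexx.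
  under eq_integral do rewrite EFinM.
  rewrite ge0_integralZl//.
  - by rewrite EFinM lee_wpmul2l ?lee_fin// tail_exponential.
  - apply/measurable_EFinP; apply: measurableT_comp => //.
    by apply: measurable_funM => //; exact: measurableT_comp.
rewrite unlock /=.
apply: (@le_trans _ _ ((c * tail_cst C)%:E `^ r^-1)%E).
  apply: gt0_ler_poweR => //; first by rewrite invr_ge0 ltW.
  - by rewrite in_itv/= leey andbT; apply: integral_ge0 => x _; exact: poweR_ge0.
  - by rewrite in_itv/= leey andbT lee_fin mulr_ge0 // ltW.
rewrite poweR_EFin lee_fin powRM// ?(ltW K0)// /c -powRrM mulfV ?gt_eqF// powRr1.
  have -> : 2 * r * tail_cst C / rho = 2 * r / rho * tail_cst C by ring.
  rewrite ler_wpM2l ?divr_ge0 ?mulr_ge0 ?(ltW r0) ?(ltW rho0)//.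
  by apply: ler1_powR => //; rewrite invf_le1.
by rewrite divr_ge0 ?mulr_ge0 ?(ltW r0) ?(ltW rho0).
Qed.

End exponential_tail.

(** * The dyadic error on the path space *)

Section canonical.
Context (R : realType) (T L : R).
Hypothesis T0 : 0 < T.
Hypothesis L0 : 0 < L.
Variable P : probability (Omega T) R.
Hypothesis hP : MLambda L P.
Variable A' : R -> Omega T -> R.
Hypothesis qA' : is_QV P A'.

Notation mu := (cprob P).
Notation F := (canonical_filtration P).
Notation X := (@coord_proc R T).

Lemma canonical_complete : complete_filtration mu F.
Proof.
apply: augmentation_complete.
  by move=> s t; exact: natural_filtration_mono.
by move=> t; apply: natural_filtration_meas => s; exact: measurable_coord.
Qed.

(** The bracket [A] with bounded density carries the estimates; any other version
    [A'] agrees with it almost surely. *)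
Lemma canonical_bracket : exists A : R -> Omega T -> R, [/\
  controlled_martingale mu F T L X,
  (forall s t B, 0 <= s -> s <= t -> t <= T -> F s B ->
    (\int[mu]_(x in B) ((X t x - X s x) ^+ 2 - (A t x - A s x))%:E = 0)%E),
  adapted T F A,
  {ae mu, forall x s t, 0 <= s -> s <= t -> t <= T ->
    0 <= A t x - A s x <= L * (t - s)} &
  {ae mu, forall x, [/\ {within `[0, T], continuous (A' ^~ x)}, A' 0 x = 0 &
    forall t, 0 <= t <= T -> A t x = A' t x]}].
Proof.
have cF := canonical_complete.
case: hP => mgX [A [a [qA pa Aa aL]]].
have [adA cA A0 mgN] := qA; have [adA' cA' A'0 mgN'] := qA'.
have lip := bracket_lipschitz (ltW L0) pa Aa aL.
have lX := local_martingale_center cF mgX.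
have lN := local_martingale_center cF mgN.
have lN' := local_martingale_center cF mgN'.
have lip' := (ae_cprob P _).2 lip.
have [cX brk] := bracket_controlled cF (ltW L0) (@coord0 R T) lX adA lip' lN.
have A00 : {ae mu, forall x, A 0 x = 0}.
  by apply/ae_cprob; apply: filterS A0 => x [].
have uniq := bracket_unique cF (ltW L0) T0 (@coord0 R T) lX lip' lN A00
  ((ae_cprob P _).2 cA) ((ae_cprob P _).2 cA') ((ae_cprob P _).2 A'0) lN'.
exists A; split => //.
have A'0' := (ae_cprob P _).2 A'0; have cA'' := (ae_cprob P _).2 cA'.
by apply: filterS3 uniq A'0' cA'' => x ? [].
Qed.

(** By continuity, a supremum over [[0, T]] exceeds [u] exactly when some dyadic
    time, of level at least [n], witnesses it. *)
Lemma dyad_err_exceed (A : R -> Omega T -> R) n x (u : R) :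
  {within `[0, T], continuous (A' ^~ x)} -> A' 0 x = 0 ->
  (forall t, 0 <= t <= T -> A t x = A' t x) ->
  (u%:E < dyad_err n A' x)%E <-> (\bigcup_p grid_exceed T X A n u p) x.
Proof.
move=> cA' A'0 AA'.
have compE j t : (j <= 2 ^ n)%N -> dyad T n j <= t <= dyad T n j.+1 -> t <= T ->
    comp_qv T X A n j t x = dyad_qv n x t - A' t x.
  move=> jn jt tT; rewrite (dyad_qvE x T0 jt) /comp_qv /dyad_qv_piece.
  have /andP[j0 jT] := dyad_itv (ltW T0) jn.
  have /andP[jt1 _] := jt.
  have tT' : 0 <= t <= T by rewrite tT (le_trans j0).
  rewrite AA'// AA' ?j0//.
  have -> : \sum_(k < j) ((X (dyad T n k.+1) x - X (dyad T n k) x) ^+ 2 -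
      (A (dyad T n k.+1) x - A (dyad T n k) x)) =
    \sum_(k < j) (X (dyad T n k.+1) x - X (dyad T n k) x) ^+ 2 - A' (dyad T n j) x.
    rewrite sumrB; congr (_ - _).
    rewrite -(big_mkord xpredT (fun k => A (dyad T n k.+1) x - A (dyad T n k) x)).
    rewrite telescope_sumr// AA' ?j0//.
    have d0 : dyad T n 0 = 0 by rewrite /dyad !mul0r.
    by rewrite d0 AA' ?A'0 ?subr0// lexx ltW.
  by ring.
have grid_block p i : (i <= 2 ^ (n + p))%N ->
    [/\ (i %/ 2 ^ p <= 2 ^ n)%N, dyad T n (i %/ 2 ^ p) <= dyad T (n + p) i <=
        dyad T n (i %/ 2 ^ p).+1 & 0 <= dyad T (n + p) i <= T].
  by move=> ile; have [] := dyad_coarse (ltW T0) ile; split=> //; exact: dyad_itv (ltW T0) _.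
pose N t := dyad_qv n x t - A' t x.
have cN : {within `[0, T], continuous N}.
  by move=> t; apply: cvgB; [exact: dyad_qv_continuous|exact: cA'].
split.
  move=> /ereal_sup_gt[_ [t /= + <-]]; rewrite in_itv/= lte_fin -/(N t) => tT ut.
  have /within_continuousP/(_ t tT) := cN.
  have e0 : 0 < `|N t| - u by rewrite subr_gt0.
  move=> /(_ _ e0)[dl dl0 H].
  have [m0 _ Hm] := dyad_dense T0 tT dl0.
  have [i] := Hm (n + m0)%N (leq_addl _ _); move=> im tm.
  exists m0 => //; exists i; first by rewrite ltnS.
  have [b1 b2 b3] := grid_block m0 i im; have /andP[_ b4] := b3.
  rewrite compE// -/(N (dyad T (n + m0) i)).
  have := H _ b3 tm; have := lerB_dist (N t) (N (dyad T (n + m0) i)).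
  by lra.
move=> [p _ [i]]; rewrite ltnS => ile ui.
have [b1 b2 b3] := grid_block p i ile; have /andP[_ b4] := b3.
rewrite compE// in ui.
apply: (@lt_le_trans _ _ (`|N (dyad T (n + p) i)|%:E)); first by rewrite lte_fin.
exact: (@le_unorm R T N).
Qed.

Lemma dyad_err_tail n (s : R) : 1 <= s -> s ^+ 2 = 2 ^+ n -> forall u : R,
  measurable ([set x | (u%:E < dyad_err n A' x)%E] : set (caratheodory_type (P^*)%mu)) /\
  (mu [set x | (u%:E < dyad_err n A' x)%E] <=
   (2 * expR (block_cst R / 64 ^+ 2) * expR (- (rate T L s * u)))%:E)%E.
Proof.
move=> s1 s2 u; have cF := canonical_complete.
have [A [cX brk adA lip good]] := canonical_bracket.
have [mU bU] := dyad_exceed_le cF L0 T0 cX brk adA lip u s1 s2.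
have SU : {ae mu, forall x, [set x | (u%:E < dyad_err n A' x)%E] x <->
    (\bigcup_p grid_exceed T X A n u p) x}.
  have [N [mN N0 sub]] := good; exists N; split => //.
  apply: subset_trans sub => x /=; apply: contra_not => -[c1 c2 c3].
  exact: dyad_err_exceed.
have [mS leS] := ae_measurable_le mU SU.
by split => //; exact: le_trans bU.
Qed.

Lemma dyad_err_ge0 n (x : Omega T) : (0 <= dyad_err n A' x)%E.
Proof. exact: unorm_ge0. Qed.

Lemma measurable_dyad_err n : measurable_fun setT
  (dyad_err n A' : caratheodory_type (P^*)%mu -> \bar R).
Proof.
pose s : R := Num.sqrt (2 ^+ n).
have e1 : 1 <= 2 ^+ n :> R by rewrite -natrX ler1n expn_gt0.
have s2 : s ^+ 2 = 2 ^+ n by rewrite sqr_sqrtr// (le_trans ler01).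
have s1 : 1 <= s by rewrite -[leLHS]sqrtr1 ler_sqrt// (lt_le_trans ltr01).
apply: (measurability _ (ErealGenOInfty.measurableE R)) => // _ [_ [u ->] <-].
rewrite setTI (_ : _ @^-1` _ = [set x | (u%:E < dyad_err n A' x)%E]).
  exact: (dyad_err_tail s1 s2 u).1.
by apply/seteqP; split => x /=; rewrite in_itv/= andbT.
Qed.

End canonical.

Section conclusion.
Context (R : realType).
Implicit Types (T L : R).

(** Both signs of the error contribute the exponential moment of
    [comp_qvT_exponential]. *)
Definition tail_mass : R := 2 * expR (block_cst R / 64 ^+ 2).

Lemma tail_mass_gt0 : 0 < tail_mass.
Proof. by rewrite mulr_gt0 ?expR_gt0. Qed.

Lemma root_scale n (s := 2 `^ (n%:R / 2) : R) : 1 <= s /\ s ^+ 2 = 2 ^+ n.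
Proof.
split.
  rewrite -[leLHS](powRr0 2); apply: ler_powR; first by rewrite ler1n.
  by rewrite divr_ge0.
rewrite /s -powR_mulrn ?powR_ge0// -powRrM divfK// powR_mulrn//.
Qed.

Lemma Lnorm_dyad_err T L P A r n : 0 < T -> 0 < L -> MLambda L P -> is_QV P A ->
  2 <= r ->
  (Lnorm (completion P) r%:E (dyad_err n A : Omega T -> \bar R) <=
   (128 * tail_cst tail_mass * r * L * T * 2 `^ (- (n%:R / 2)))%:E)%E.
Proof.
move=> T0 L0 hP qA r2; have [s1 s2] := root_scale n.
set s := 2 `^ _ in s1 s2.
have rate0 : 0 < rate T L s by rewrite /rate divr_gt0 ?mulr_gt0//; lra.
have := tail_Lnorm (measurable_dyad_err T0 L0 hP qA n)
  (dyad_err_ge0 T0 A n) rate0 (ltW tail_mass_gt0)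
  (fun u _ => (dyad_err_tail T0 L0 hP qA s1 s2 u).2) (r := r).
have r1 : 1 <= r by lra.
move=> /(_ r1) H; apply: (le_trans H); rewrite lee_fin powRN -/s /rate.
rewrite le_eqVlt; apply/orP; left; apply/eqP; field.
by rewrite !gt_eqF//; lra.
Qed.

Lemma tail_dyad_err T L P A n u : 0 < T -> 0 < L -> MLambda L P -> is_QV P A ->
  0 <= u ->
  (completion P [set x : Omega T | (u%:E < dyad_err n A x)%E] <=
   (tail_mass * expR (- (64^-1 * (2 `^ (n%:R / 2) * u / (L * T)))))%:E)%E.
Proof.
move=> T0 L0 hP qA u0; have [s1 s2] := root_scale n.
apply: (le_trans (dyad_err_tail T0 L0 hP qA s1 s2 u).2).
rewrite lee_fin le_eqVlt; apply/orP; left; apply/eqP.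
congr (_ * expR (- _)); rewrite /rate; field.
by rewrite !gt_eqF.
Qed.

(** The tails are summable over [n], so the error exceeds a given level for
    finitely many [n] only. *)
Lemma dyad_err_ae_cvg T L P A : 0 < T -> 0 < L -> MLambda L P -> is_QV P A ->
  {ae P, forall x : Omega T, (fun n => dyad_err n A x) @ \oo --> 0%E}.
Proof.
move=> T0 L0 hP qA.
pose S k n : set (caratheodory_type (P^*)%mu) :=
  [set x | ((k.+1%:R^-1 : R)%:E < dyad_err n A x)%E].
have mS k n : measurable (S k n).
  have [s1 s2] := root_scale n.
  exact: (dyad_err_tail T0 L0 hP qA s1 s2 k.+1%:R^-1).1.
have null k : cprob P (lim_sup_set (S k)) = 0%E.
  apply: lim_sup_set_cvg0 => //.
  pose q : R := 2 `^ (- (1 / 2)).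
  have q0 : 0 <= q by exact: powR_ge0.
  have q1 : q < 1.
    rewrite /q powRN invf_lt1 ?powR_gt0// div1r powR12_sqrt//.
    by rewrite -[ltLHS]sqrtr1 ltr_sqrt// ltr1n.
  pose K : R := tail_mass * (64 * (L * T) * k.+1%:R).
  have K0 : 0 <= K by rewrite mulr_ge0 ?(ltW tail_mass_gt0)// !mulr_ge0// ltW.
  have bnd n : (cprob P (S k n) <= (K * q ^+ n)%:E)%E.
    have u0 : 0 <= k.+1%:R^-1 :> R by rewrite invr_ge0.
    apply: (le_trans (tail_dyad_err n T0 L0 hP qA u0)); rewrite lee_fin.
    rewrite (_ : K * q ^+ n = tail_mass * (64 * (L * T) * k.+1%:R * q ^+ n)); last first.
      by rewrite /K !mulrA.
    rewrite ler_wpM2l ?(ltW tail_mass_gt0)//.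
    have [s1 s2] := root_scale n; set s := 2 `^ _ in s1 s2 *.
    have -> : q ^+ n = s^-1.
      rewrite /q -powR_mulrn ?powR_ge0// -powRrM /s -powRN; congr (2 `^ _); lra.
    set z := 64^-1 * _.
    have z0 : 0 < z by rewrite mulr_gt0// divr_gt0 ?mulr_gt0// ?invr_gt0//; lra.
    have -> : 64 * (L * T) * k.+1%:R * s^-1 = z^-1.
      by rewrite /z; field; rewrite !gt_eqF//; lra.
    rewrite expRN lef_pV2 ?posrE ?expR_gt0//.
    by apply: le_trans (expR_ge1Dx z); rewrite lerDr.
  apply: (@le_lt_trans _ _ (K / (1 - q))%:E); last exact: ltry.
  apply: lime_le; first by apply: is_cvg_nneseries => n _ _; exact: measure_ge0.
  apply: nearW => n; rewrite big_mkord.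
  apply: (@le_trans _ _ (\sum_(i < n) (K * q ^+ i)%:E)%E).
    by apply: lee_sum => i _; exact: bnd.
  rewrite sumEFin lee_fin -mulr_sumr ler_wpM2l//.
  exact: geometric_sum_le.
have : {ae cprob P, forall x, forall k, ~ lim_sup_set (S k) x}.
  apply: ae_foralln => k; exists (lim_sup_set (S k)); split=> //.
    apply: bigcapT_measurable => n; apply: bigcup_measurable => j _; exact: mS.
    exact: (null k).
  by move=> x /= /contrapT.
move=> /ae_cprob[N [mN N0 sub]]; exists N; split => //.
apply: subset_trans sub => x /=; apply: contra_not => nx.
apply/ecvg0P => [n|e e0]; first exact: dyad_err_ge0.
have ke : (Num.truncn e^-1).+1%:R^-1 < e.
  by rewrite invf_plt ?posrE//; exact: truncnS_gt.
have /existsNP[N1] := nx (Num.truncn e^-1).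
move=> /not_implyP[_ nN]; exists N1 => // n /= Nn.
rewrite leNgt; apply/negP => en; apply: nN; exists n => //.
by apply: lt_trans en; rewrite lte_fin.
Qed.

End conclusion.

Theorem theorem5p4 (R : realType) :
  [/\ exists C : R, forall T L : R, 0 < T -> 0 < L ->
        forall (r : R) (n : nat), 2 <= r -> (1 <= n)%N ->
        (ereal_sup [set e : \bar R |
           exists2 P : probability (Omega T) R, MLambda L P &
           exists2 A : R -> Omega T -> R, is_QV P A &
             e = Lnorm (completion P) r%:E (dyad_err n A)]
         <= (C * r * L * T * 2 `^ (- (n%:R / 2)))%:E)%E,
      exists c C : R, [/\ 0 < c, 0 < C & forall T L : R, 0 < T -> 0 < L ->
        forall n : nat, (1 <= n)%N -> forall u : R, 0 <= u ->
        (ereal_sup [set e : \bar R |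
           exists2 P : probability (Omega T) R, MLambda L P &
           exists2 A : R -> Omega T -> R, is_QV P A &
             e = completion P [set x | (u%:E < dyad_err n A x)%E]]
         <= (C * expR (- (c * (2 `^ (n%:R / 2) * u / (L * T)))))%:E)%E],
      forall T L : R, 0 < T -> 0 < L ->
        forall P : probability (Omega T) R, MLambda L P ->
        measurable (@dyad_good R T) /\ P (@dyad_good R T) = 1%E &
      forall T L : R, 0 < T -> 0 < L ->
        forall P : probability (Omega T) R, MLambda L P ->
        forall A : R -> Omega T -> R, is_QV P A ->
        {ae P, forall x, @dyad_good R T x /\
          forall t, 0 <= t <= T -> dyad_lim x t = A t x}].
Proof.
split.
- exists (128 * tail_cst (tail_mass R)) => T L T0 L0 r n r2 _.
  apply: ge_ereal_sup => _ [P hP [A qA ->]].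
  exact: Lnorm_dyad_err.
- exists 64^-1, (tail_mass R); split.
  + by rewrite invr_gt0.
  + exact: tail_mass_gt0.
  + move=> T L T0 L0 n _ u u0; apply: ge_ereal_sup => _ [P hP [A qA ->]].
    exact: tail_dyad_err.
- move=> T L T0 L0 P hP.
  have mG : measurable (@dyad_good R T).
    by rewrite dyad_goodE//; exact: measurable_dyad_cauchy.
  split=> //.
  have [A qA] : exists A, is_QV P A by case: hP => _ [A [a [qA _ _ _]]]; exists A.
  have G : {ae P, forall x, @dyad_good R T x}.
    apply: filterS (dyad_err_ae_cvg T0 L0 hP qA) => x cx.
    exact: (dyad_err_cvg T0 cx).1.
  have : P (~` @dyad_good R T) = 0%E.
    by apply/negligibleP; [exact: measurableC|exact: G].
  rewrite probability_setC// => /eqP; rewrite sube_eq// ?add0e; first by move=> /eqP <-.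
- move=> T L T0 L0 P hP A qA.
  apply: filterS (dyad_err_ae_cvg T0 L0 hP qA) => x cx.
  exact: (dyad_err_cvg T0 cx).
Qed.
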